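(* Let $0<\mu\le1$. The derivative $f\mapsto f'$ on $C_c^\infty(\mathbb{R})$ is closable in $L^2(\nu_\mu)$. Its closure $D_\mu$ has domain $$\mathrm{Dom}(D_\mu)=W^{1,2}(\nu_\mu).$$ Furthermore, $$\mathrm{Dom}(N_\mu^{1/2})=\mathrm{Dom}(D_\mu),\qquad N_\mu=D_\mu^*D_\mu .$$ The divergence $\delta_\mu=D_\mu^*$ satisfies $$\delta_\mu g=-g'+\left(x-2\frac{(e_0^{(\mu)})'}{e_0^{(\mu)}}\right)g$$ for $g\in C_c^\infty(\mathbb{R})$. The domain of $N_\mu$ consists of those $f\in W^{1,2}(\nu_\mu)$ whose derivative $f'$ is locally absolutely continuous and for which $$-f''+\left(x-2\frac{(e_0^{(\mu)})'}{e_0^{(\mu)}}\right)f'\in L^2(\nu_\mu),$$ and on this domain this expression equals $N_\mu f$.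
   Context: $\gamma(\mathrm{d}x)=(2\pi)^{-1/2}e^{-x^2/2}\,\mathrm{d}x$ is the standard Gaussian measure on $\mathbb{R}$, and $W^{1,2}(\gamma)$ is the space of locally absolutely continuous $f$ with $f,f'\in L^2(\gamma)$. For $0<\mu\le1$ let $c_\mu=\frac{1-\mu^2}{4\mu^2}$ and let $A_\mu$ be the nonnegative self-adjoint operator in $L^2(\gamma)$ associated with the closed form $$a_\mu[f,g]=\int_{-\infty}^\infty f'\overline{g'}\,\mathrm{d}\gamma+c_\mu\int_{-\infty}^0x^2f\overline g\,\mathrm{d}\gamma,\qquad \mathrm{Dom}(a_\mu)=W^{1,2}(\gamma);$$ it acts as $A_\mu f=-f''+xf'+c_\mu x^2\mathbf{1}_{\{x<0\}}f$. It has compact resolvent and simple eigenvalues $0\le\alpha_0(\mu)<\alpha_1(\mu)<\cdots\to\infty$. $e_0^{(\mu)}$ is the strictly positive, continuously differentiable, $L^2(\gamma)$-normalised eigenfunction for $\alpha_0(\mu)$. $\nu_\mu(\mathrm{d}x)=(e_0^{(\mu)}(x))^2\,\gamma(\mathrm{d}x)$, a probability measure. $G_\mu:L^2(\nu_\mu)\to L^2(\gamma)$, $G_\mu f=e_0^{(\mu)}f$, is unitary. The deformed number operator is $$N_\mu=G_\mu^{-1}(A_\mu-\alpha_0(\mu)I)G_\mu,\qquad \mathrm{Dom}(N_\mu)=\{f\in L^2(\nu_\mu):e_0^{(\mu)}f\in\mathrm{Dom}(A_\mu)\},$$ a nonnegative self-adjoint operator in $L^2(\nu_\mu)$. $W^{1,2}(\nu_\mu)$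 consists of locally absolutely continuous functions $f$ on $\mathbb{R}$ with $f,f'\in L^2(\nu_\mu)$, with norm $\|f\|^2=\int(|f|^2+|f'|^2)\,\mathrm{d}\nu_\mu$. $D_\mu^*$ is the Hilbert-space adjoint in $L^2(\nu_\mu)$. *)

(* Defs.v *)
(* The Hilbert spaces are complex: functions are R -> R[i], and since R[i] is
   not a normed module over R, measurability, differentiation and integration
   are taken on real and imaginary parts. *)
From HB Require Import structures.
From mathcomp Require Import all_boot all_order all_algebra.
From mathcomp Require Import all_classical all_reals all_analysis.
From mathcomp Require Import measurable_realfun complex.

Set Implicit Arguments.
Unset Strict Implicit.
Unset Printing Implicit Defensive.

Import Order.TTheory GRing.Theory Num.Theory.
Import numFieldNormedType.Exports.

Local Open Scope classical_set_scope.
Local Open Scope ring_scope.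

Section Calculus.
Context {R : realType}.
Implicit Types (f : R -> R[i]) (F : R -> R).

(* Absolute continuity on every compact interval; two intervals ]u, v[ may
   share an endpoint, and degenerate ones contribute nothing. *)
Definition loc_ac_real F : Prop :=
  forall a b : R, a < b -> forall eps : R, 0 < eps ->
  exists2 delta : R, 0 < delta &
    forall (n : nat) (u v : 'I_n -> R),
      (forall i, a <= u i /\ u i <= v i /\ v i <= b) ->
      trivIset setT (fun i => `]u i, v i[%classic) ->
      \sum_(i < n) (v i - u i) < delta ->
      \sum_(i < n) `|F (v i) - F (u i)| < eps.

Definition loc_ac f : Prop :=
  loc_ac_real (fun x => complex.Re (f x)) /\
  loc_ac_real (fun x => complex.Im (f x)).

(* [derive1] takes a fixed value at points of non-differentiability, so for
   locally absolutely continuous f this is the a.e. derivative of f extended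
   by a constant on a Borel null set. *)
Definition cderiv f : R -> R[i] := fun x =>
  Complex (derive1 (fun y => complex.Re (f y)) x)
          (derive1 (fun y => complex.Im (f y)) x).

Definition smooth_real F : Prop := forall (n : nat) x, derivable (derive1n n F) x 1.

Definition Cc_infty f : Prop :=
  [/\ smooth_real (fun x => complex.Re (f x)),
      smooth_real (fun x => complex.Im (f x)) &
      exists M : R, forall x, M < `|x| -> f x = 0].

End Calculus.

Section L2.
Context {R : realType} (m : {measure set (measurableTypeR R) -> \bar R}).
Implicit Types f g h : R -> R[i].

Definition L2sq f : \bar R :=
  (\int[m]_x (complex.Re (f x) ^+ 2 + complex.Im (f x) ^+ 2)%:E)%E.

Definition L2 f : Prop :=
  [/\ measurable_fun [set: measurableTypeR R] (fun x => complex.Re (f x)),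
      measurable_fun [set: measurableTypeR R] (fun x => complex.Im (f x)) &
      (L2sq f < +oo)%E].

Definition cintegral (A : set (measurableTypeR R)) f : R[i] :=
  Complex (Rintegral m A (fun x => complex.Re (f x)))
          (Rintegral m A (fun x => complex.Im (f x))).

Definition inner f g : R[i] := cintegral setT (fun x => f x * conjc (g x)).

Definition aeq f g : Prop := ae_eq m setT f g.

(* W^{1,2}(m) as a space of functions, and as a space of L^2(m)-classes. *)
Definition W12 f : Prop := [/\ loc_ac f, L2 f & L2 (cderiv f)].

Definition W12_class f : Prop := L2 f /\ exists2 f1, W12 f1 & aeq f f1.

End L2.

(* An operator in L^2(m) is represented by its graph [T f g] ("f is in the
   domain and T f = g"), a relation between functions standing for their
   almost-everywhere classes. *)
Definition graph (R : realType) : Type := (R -> R[i]) -> (R -> R[i]) -> Prop.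

Section Operators.
Context {R : realType} (m : {measure set (measurableTypeR R) -> \bar R}).
Implicit Types (S T : graph R) (f g h k : R -> R[i]).

Definition dom T f : Prop := exists g, T f g.

Definition value_at T f h : Prop :=
  T f h /\ forall k, T f k -> aeq m k h.

Definition graph_closure T : graph R := fun f g =>
  [/\ L2 m f, L2 m g &
      forall eps : R, 0 < eps -> exists f1 g1,
        [/\ T f1 g1, (L2sq m (f \- f1)%R < eps%:E)%E &
            (L2sq m (g \- g1)%R < eps%:E)%E]].

Definition closable T : Prop := forall f g h,
  graph_closure T f g -> graph_closure T f h -> aeq m g h.

Definition adjoint T : graph R := fun g h =>
  [/\ L2 m g, L2 m h &
      forall f k, T f k -> inner m k g = inner m f h].

Definition compose S T : graph R := fun f h => exists2 g, T f g & S g h.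

Definition densely_defined T : Prop := forall f, L2 m f ->
  forall eps : R, 0 < eps ->
  exists2 g, dom T g & (L2sq m (f \- g)%R < eps%:E)%E.

Definition self_adjoint T : Prop :=
  densely_defined T /\ forall f g, T f g <-> adjoint T f g.

(* In the partial order of R[i], 0 <= z means that z is real and >= 0. *)
Definition nonnegative T : Prop := forall f g, T f g -> 0 <= inner m g f.

Definition is_sqrt_of T S : Prop :=
  [/\ self_adjoint S, nonnegative S &
      forall f h, compose S S f h <-> T f h].

End Operators.

Section Gaussian.
Context {R : realType}.
Implicit Types (f g h : R -> R[i]) (mu lam alpha : R).

Definition gaussian : {measure set (measurableTypeR R) -> \bar R} :=
  normal_prob 0 1.

Definition c_ mu : R := (1 - mu ^+ 2) / (4 * mu ^+ 2).

Definition a_form mu f g : R[i] :=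
  inner gaussian (cderiv f) (cderiv g) +
  (c_ mu)%:C%C *
    cintegral gaussian [set x | x < 0]
      (fun x => (x ^+ 2)%:C%C * f x * conjc (g x)).

(* The operator associated with the form: Dom A_mu consists of the f in the
   form domain for which g |-> a_mu[f, g] is represented by some A_mu f. *)
Definition A_ mu : graph R := fun f h =>
  [/\ L2 gaussian f, L2 gaussian h &
      exists f1, [/\ W12 gaussian f1, aeq gaussian f f1 &
        forall g, W12 gaussian g -> a_form mu f1 g = inner gaussian h g]].

Definition eigenvalue_of (T : graph R) lam : Prop := exists f,
  [/\ L2 gaussian f, ~ aeq gaussian f (fun=> 0) &
      T f (fun x => lam%:C%C * f x)].

Definition is_ground_state mu alpha0 (e0 : R -> R) : Prop :=
  [/\ eigenvalue_of (A_ mu) alpha0 /\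
        (forall lam, eigenvalue_of (A_ mu) lam -> alpha0 <= lam),
      A_ mu (fun x => (e0 x)%:C%C) (fun x => alpha0%:C%C * (e0 x)%:C%C),
      forall x, 0 < e0 x,
      (forall x, derivable e0 x 1) /\ continuous (derive1 e0) &
      L2sq gaussian (fun x => (e0 x)%:C%C) = 1%E].

End Gaussian.

Section Deformed.
Context {R : realType}.

Definition nu_ (e0 : {mfun measurableTypeR R >-> R}) :
    set (measurableTypeR R) -> \bar R :=
  fun A => (\int[gaussian]_(x in A) (e0 x ^+ 2)%:E)%E.

Section nu_measure.
Variable e0 : {mfun measurableTypeR R >-> R}.

Let nu0 : nu_ e0 set0 = 0%E.
Proof. by rewrite /nu_ integral_set0. Qed.

Let nu_ge0 A : (0 <= nu_ e0 A)%E.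
Proof. by apply: integral_ge0 => x _; rewrite lee_fin sqr_ge0. Qed.

Let nu_sigma_additive : semi_sigma_additive (nu_ e0).
Proof.
move=> /= A mA tA mUA; rewrite /nu_ ge0_integral_bigcup//=; last first.
- by move=> x _; rewrite lee_fin sqr_ge0.
- apply/measurable_funTS/measurable_EFinP/measurable_funX.
  exact: measurable_funPT.
- apply: is_cvg_ereal_nneg_natsum_cond => n _ _.
  by apply: integral_ge0 => x _; rewrite lee_fin sqr_ge0.
Qed.

HB.instance Definition _ :=
  isMeasure.Build _ _ _ (nu_ e0) nu0 nu_ge0 nu_sigma_additive.

End nu_measure.

Implicit Types (f g h : R -> R[i]) (mu alpha : R).
Implicit Types e : {mfun measurableTypeR R >-> R}.

(* G^{-1} (A - alpha0) G f = h, read as A (G f) = G h + alpha0 G f. *)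
Definition G_ e0 f : R -> R[i] := fun x => (e0 x)%:C%C * f x.

Definition N_ mu alpha0 e0 : graph R := fun f h =>
  [/\ L2 (nu_ e0) f, L2 (nu_ e0) h &
      A_ mu (G_ e0 f) (fun x => G_ e0 h x + alpha0%:C%C * G_ e0 f x)].

Definition test_derivative : graph R := fun f g => Cc_infty f /\ g = cderiv f.

Definition D_ e0 : graph R := graph_closure (nu_ e0) test_derivative.

Definition delta_ e0 : graph R := adjoint (nu_ e0) (D_ e0).

(* - g' + (x - 2 e0' / e0) g *)
Definition divergence_expr (e0 : R -> R) g : R -> R[i] := fun x =>
  - cderiv g x + (x - 2 * (derive1 e0 x / e0 x))%:C%C * g x.

End Deformed.

(* Main.v *)
(* All operators act separately on real and imaginary parts, so everything reduces
   to real functions on the line with a positive C^1 weight w.  By the du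
   Bois-Reymond lemma an element (f, g) of the closure of the derivative has an
   absolutely continuous representative with derivative g; conversely the residual r
   of the orthogonal projection of (f, f') on the graph of the closure solves
   (r' w)' = r w, and testing with chi^2 r for cutoffs chi gives r = 0.

   The weak equation of the ground state e says (e' p)' = (V - alpha0) e p, with p the
   Gaussian density, V = c_mu x^2 1_{x<0}; hence the ground state identity
     a[e U, e W] - alpha0 <e U, e W> = int U' W' e^2 p
   for compactly supported W.  With cutoffs (a Caccioppoli estimate in one direction,
   the bound of x f in L^2(gamma) by the W^{1,2}(gamma) norm in the other) it yields
   N = D^* D, and the du Bois-Reymond lemma then gives the regularity of Dom(N).

   D^* D has a square root S because B = (1 + D^* D)^-1 is a contraction:
   S = sqrt(1 - B) sqrt(B)^-1, the roots being limits of polynomials in B.  Any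
   self-adjoint S with S^2 = D^* D has the domain of D, since Dom(D^* D) is a core of
   both S and D and |S f| = |D f| on it. *)
Require Import Defs.
From HB Require Import structures.
From mathcomp Require Import all_boot all_order all_algebra.
From mathcomp Require Import all_classical all_reals all_analysis.
From mathcomp Require Import complex.
From mathcomp Require Import measurable_realfun ring lra.

Set Implicit Arguments.
Unset Strict Implicit.
Unset Printing Implicit Defensive.

Import Order.TTheory GRing.Theory Num.Theory.
Import numFieldNormedType.Exports.

Local Open Scope classical_set_scope.
Local Open Scope ring_scope.

(** * Absolute continuity *)

Section AbsCont.
Context {R : realType}.
Implicit Types (F G : R -> R) (a b : R) (s : seq (R * R)) (p q : R * R).
Local Notation leb := (@lebesgue_measure R).

(** The derivative in the statement is the pointwise [derive1], whereas the analysis needs an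
    integrable density. Measurability of [derive1] and the fundamental theorem for absolutely
    continuous functions therefore precede the operator theory: the variation of the function
    induces a Stieltjes measure, and Radon-Nikodym gives the density. The ground state e comes with
    positivity, C^1 regularity and a weak equation, but with no growth bound on e'/e. Every bound at
    infinity hence comes from cutoffs of slope at most 1, arranged so that the error terms are
    square-integrable quantities and what remains is a sum of squares with nonnegative coefficients.
    A given square root of N may a priori mix real and imaginary parts, so it need not be the
    complexification of a real operator. Existence is proved on real L^2; the domain of an arbitrary
    root is found in complex L^2 regarded as a real Hilbert space under the real part of the inner
    product. Instead of a spectral theorem, a scalar iteration with the same nonnegative
    coefficients majorises the operator iteration for the root. *)

Definition nonoverlap p q : bool := (p.2 <= q.1) || (q.2 <= p.1).

Definition subitvs a b s : bool := all (fun p => [&& a <= p.1, p.1 <= p.2 & p.2 <= b]) s.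

Definition total_length s : R := \sum_(p <- s) (p.2 - p.1).

(** Finite families are lists of endpoint pairs, so that refining an interval and moving it between
    families become concatenations. Degenerate and abutting intervals are allowed. *)
Definition abs_cont_on a b F : Prop := forall eps, 0 < eps ->
  exists2 delta, 0 < delta & forall s, subitvs a b s -> pairwise nonoverlap s ->
    total_length s < delta -> \sum_(p <- s) `|F p.2 - F p.1| < eps.

Lemma nonoverlapC : symmetric nonoverlap.
Proof. by move=> p q; rewrite /nonoverlap orbC. Qed.

Lemma loc_ac_real_on F a b : a < b -> loc_ac_real F -> abs_cont_on a b F.
Proof.
move=> ab acF eps e0; have [d d0 H] := acF a b ab eps e0.
exists d => // s sin sdis slen.
pose u (i : 'I_(size s)) := (nth (0, 0) s i).1.
pose v (i : 'I_(size s)) := (nth (0, 0) s i).2.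
have uv i : a <= u i /\ u i <= v i /\ v i <= b.
  by have /allP/(_ _ (mem_nth (0, 0) (ltn_ord i)))/and3P[] := sin.
have tr : trivIset setT (fun i => `]u i, v i[%classic).
  have W (i j : 'I_(size s)) x : (i < j)%N ->
     `]u i, v i[%classic x -> `]u j, v j[%classic x -> False.
    move=> ij; rewrite /= !in_itv/= => /andP[ux xv] /andP[ux' xv'].
    have /(pairwiseP (0, 0))/(_ i j) := sdis.
    rewrite !inE !ltn_ord => /(_ isT isT ij) /orP[|] h.
      by have := lt_trans xv (le_lt_trans h ux'); rewrite ltxx.
    by have := lt_trans xv' (le_lt_trans h ux); rewrite ltxx.
  move=> i j _ _ [x [xi xj]]; apply/eqP/negPn/negP => nij.
  have [ij|ij|/val_inj ij] := ltngtP i j; last by rewrite ij eqxx in nij.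
  - exact: (W i j x).
  - exact: (W j i x).
have := H _ u v uv tr.
rewrite /total_length (big_nth (0, 0)) big_mkord in slen.
by move=> /(_ slen); rewrite (big_nth (0, 0)) big_mkord.
Qed.

Lemma variation_pairs F a b l : itv_partition a b l ->
  variation a b F l = \sum_(p <- zip (a :: l) l) `|F p.2 - F p.1|.
Proof.
elim: l a => [a /itv_partition_nil ab|h t ih a].
  by rewrite /variation/= !big_nil.
move=> abl; have := itv_partition_cons abl => /ih.
rewrite /variation /= big_nat_recl//= big_cons/= => ->.
by [].
Qed.

Lemma partition_pairs a b l : itv_partition a b l ->
  [/\ subitvs a b (zip (a :: l) l), pairwise nonoverlap (zip (a :: l) l) &
      total_length (zip (a :: l) l) = b - a].
Proof.
elim: l a => [a /itv_partition_nil ab|h t ih a].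
  by rewrite /= /total_length big_nil ab subrr.
move=> abl; have hb := itv_partition_cons abl.
have [h1 h2 h3] := ih _ hb.
have ah : a < h by case: abl => /= /andP[].
have lehb := itv_partition_le hb.
split.
- rewrite /= lexx (ltW ah) lehb /=; apply: sub_all h1 => p /and3P[hp pp pb].
  by rewrite (le_trans (ltW ah) hp) pp.
- rewrite [zip _ _]/= pairwise_cons h2 andbT.
  by apply: sub_all h1 => p /and3P[hp pp pb]; rewrite /nonoverlap /= hp.
- by rewrite /total_length big_cons/= -/(total_length (zip (h :: t) t)) h3 addrC subrKA.
Qed.

Lemma total_length_cat s1 s2 :
  total_length (s1 ++ s2) = total_length s1 + total_length s2.
Proof. by rewrite /total_length big_cat. Qed.

(** Induction on [s1]: the variation of one interval is a supremum over its partitions, and the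
    pieces of a partition can join [s2] without changing the total length or creating overlaps. The
    bound is not strict because a supremum is taken. *)
Lemma abs_cont_on_tv F a b : abs_cont_on a b F ->
  forall eps, 0 < eps -> exists2 delta, 0 < delta &
    forall s1 s2, subitvs a b (s1 ++ s2) -> pairwise nonoverlap (s1 ++ s2) ->
    total_length (s1 ++ s2) < delta ->
    (\sum_(p <- s1) total_variation p.1 p.2 F +
     (\sum_(p <- s2) `|F p.2 - F p.1|)%:E <= eps%:E)%E.
Proof.
move=> acF eps e0; have [d d0 H] := acF eps e0; exists d => //.
elim=> [|p s1 ih] s2 sin sdis slen.
  by rewrite big_nil add0e lee_fin ltW// H.
have ppin : [&& a <= p.1, p.1 <= p.2 & p.2 <= b] by case/andP: sin.
have /and3P[ap pp pb] := ppin.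
have in' : subitvs a b (s1 ++ s2) by case/andP: sin.
have dis' : pairwise nonoverlap (s1 ++ s2) by case/andP: sdis.
have pdis : all (nonoverlap p) (s1 ++ s2) by case/andP: sdis.
have len' : total_length (s1 ++ s2) < d.
  apply: le_lt_trans slen; rewrite cat_cons /total_length big_cons.
  by rewrite lerDr subr_ge0.
rewrite big_cons.
have ih0 := ih s2 in' dis' len'.
set X := (\sum_(j <- s1) _)%E; set Y := (\sum_(j <- s2) _)%:E.
have X0 : (0 <= X)%E.
  rewrite /X big_seq; apply: sume_ge0 => q qs.
  have /allP/(_ q) := in'; rewrite mem_cat qs => /(_ isT)/and3P[_ qq _].
  exact: total_variation_ge0.
have Xfin : X \is a fin_num.
  rewrite ge0_fin_numE//; apply: (@le_lt_trans _ _ (eps%:E)); last exact: ltry.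
  apply: le_trans ih0; rewrite leeDl// lee_fin.
  by apply: sumr_ge0.
(* The variation [X] of the remaining intervals is finite by the induction hypothesis, so it can be
   moved across the inequality; this isolates the supremum that defines the variation of [p]. *)
rewrite -addeA -leeBrDr ?fin_numD ?Xfin//.
rewrite /total_variation; apply: ge_ereal_sup => _ [_ [l pl <-] <-].
rewrite leeBrDr ?fin_numD ?Xfin// variation_pairs//.
have [l1 l2 l3] := partition_pairs pl.
set t := zip _ _ in l1 l2 l3 *.
have tin : subitvs a b t.
  apply: sub_all l1 => q /and3P[q1 q2 q3].
  by rewrite (le_trans ap q1) q2 (le_trans q3 pb).
have tdis q : q \in s1 ++ s2 -> all (nonoverlap q) t.
  move=> qs; have /allP/(_ _ qs)/orP := pdis => pq.
  apply/allP => r /(allP l1)/and3P[r1 r2 r3]; rewrite /nonoverlap.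
  by case: pq => h; [rewrite (le_trans r3 h) orbT|rewrite (le_trans h r1)].
have := ih (t ++ s2).
rewrite big_cat/= EFinD => h; rewrite addeCA; apply: h.
- by move: in'; rewrite /subitvs !all_cat => /andP[-> ->]; rewrite andbT; exact: tin.
- move: dis'; rewrite pairwise_cat => /and3P[dis1 dis2 dis3].
  rewrite !pairwise_cat dis2 l2 dis3 allrel_catr dis1 !andbT.
  apply/andP; split.
    by apply/allrelP => q r qs rt; apply: (allP (tdis q _)); rewrite ?mem_cat ?qs.
  apply/allrelP => r q rt qs; rewrite nonoverlapC.
  by apply: (allP (tdis q _)); rewrite ?mem_cat ?qs ?orbT.
- apply: le_lt_trans slen; rewrite !total_length_cat l3.
  by rewrite /total_length big_cons; lra.
Qed.

(** With the delta belonging to eps = 1, an interval shorter than delta has variation at most 1, and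
    steps of length delta / 2 reach [x] after finitely many intervals. *)
Lemma abs_cont_on_tv_fin F a b : abs_cont_on a b F ->
  forall x, a <= x <= b -> total_variation a x F \is a fin_num.
Proof.
move=> acF; have [d d0 H] := abs_cont_on_tv acF ltr01.
have one u v : a <= u -> u <= v -> v <= b -> v - u < d ->
    (total_variation u v F <= 1)%E.
  move=> au uv vb uvd.
  have := H [:: (u, v)] [::]; rewrite /= au uv vb /= /total_length !big_cons !big_nil.
  by rewrite adde0 addr0 adde0 /=; apply.
have S n x : a <= x <= b -> x - a <= (d / 2) *+ n ->
    total_variation a x F \is a fin_num.
  elim: n x => [|n ih] x /andP[ax xb].
    rewrite mulr0n subr_le0 => xa.
    by have -> : x = a; [apply/eqP; rewrite eq_le ax xa|rewrite total_variationxx].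
  rewrite mulrSr => xn; pose y := Num.max a (x - d / 2).
  have ay : a <= y by rewrite le_max lexx.
  have yx : y <= x by rewrite ge_max ax /=; lra.
  have yb : y <= b by lra.
  have yn : y - a <= (d / 2) *+ n.
    have [h|h] := leP (x - d / 2) a.
      by rewrite /y max_l// subrr mulrn_wge0//; lra.
    by rewrite /y max_r//; [lra|exact: ltW].
  rewrite (total_variationD F ay yx) fin_numD ih ?ay//=.
  rewrite ge0_fin_numE ?total_variation_ge0//.
  apply: (@le_lt_trans _ _ 1%E); last exact: ltry.
  apply: one => //; have : x - d / 2 <= y by rewrite le_max lexx orbT.
  by lra.
move=> x axb; have [k hk] : exists k, x - a <= (d / 2) *+ k.
  exists (Num.bound ((x - a) / (d / 2))).
  rewrite -mulr_natr -ler_pdivrMl; last by lra.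
  rewrite mulrC ltW// archi_boundP// divr_ge0//; lra.
exact: (S k).
Qed.

(** [V] is the total variation from a. It dominates the increments of F, so V and V - F are both
    nondecreasing: this is the Jordan decomposition, with absolute continuity retained. *)
Lemma abs_cont_on_monotone F a b : abs_cont_on a b F ->
  exists2 V, abs_cont_on a b V &
    forall x y, a <= x -> x <= y -> y <= b -> `|F y - F x| <= V y - V x.
Proof.
move=> acF; have fin := abs_cont_on_tv_fin acF.
exists (fun x => fine (total_variation a x F)); last first.
  move=> x y ax xy yb.
  have ay := le_trans ax xy; have xb := le_trans xy yb.
  have tvD := total_variationD F ax xy.
  have fx := fin x; rewrite ax xb in fx; have {fx}fx := fx isT.
  have fy := fin y; rewrite ay yb in fy; have {fy}fy := fy isT.
  have fxy : total_variation x y F \is a fin_num.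
    by move: fy; rewrite tvD fin_numD => /andP[].
  rewrite tvD fineD// addrAC subrr add0r -lee_fin fineK//.
  exact: total_variation_ge.
move=> eps e0; have e20 : 0 < eps / 2 by lra.
have [d d0 H] := abs_cont_on_tv acF e20; exists d => // s sin sdis slen.
have := H s [::]; rewrite cats0 big_nil adde0 => /(_ sin sdis slen) h.
apply: (@le_lt_trans _ _ (eps / 2)); last by lra.
rewrite -lee_fin; apply: le_trans h; rewrite -sumEFin le_eqVlt; apply/orP; left; apply/eqP.
apply: eq_big_seq => p ps; have /allP/(_ p ps)/and3P[ap pp pb] := sin.
have tvD := total_variationD F ap pp.
have fx := fin p.1; rewrite ap (le_trans pp pb) in fx; have {fx}fx := fx isT.
have fy := fin p.2; rewrite (le_trans ap pp) pb in fy; have {fy}fy := fy isT.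
have fxy : total_variation p.1 p.2 F \is a fin_num.
  by move: fy; rewrite tvD fin_numD => /andP[].
by rewrite tvD fineD// addrAC subrr add0r ger0_norm ?fine_ge0 ?total_variation_ge0// fineK.
Qed.

(** Composition with this retraction onto [a, b] extends a function by constants, as needed for a
    cumulative function on the whole line. *)
Definition clamp a b x : R := Num.min b (Num.max a x).

Lemma clamp_in a b x : a <= b -> a <= clamp a b x <= b.
Proof. by move=> ab; rewrite /clamp le_min ab le_max lexx /= ge_min lexx. Qed.

Lemma clamp_id a b x : a <= x <= b -> clamp a b x = x.
Proof. by move=> /andP[ax xb]; rewrite /clamp max_r// min_r. Qed.

Lemma clamp_le a b x y : x <= y -> clamp a b x <= clamp a b y.
Proof.
move=> xy; rewrite /clamp; case: (leP a x) => ?; case: (leP a y) => ?;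
  repeat (match goal with |- context [Num.min b ?z] => case: (leP b z) => ? end); lra.
Qed.

Lemma clamp_lip a b x y : x <= y -> clamp a b y - clamp a b x <= y - x.
Proof.
move=> xy; rewrite /clamp; case: (leP a x) => ?; case: (leP a y) => ?;
  repeat (match goal with |- context [Num.min b ?z] => case: (leP b z) => ? end); lra.
Qed.

Lemma abs_cont_on_clamp a b c d F : a <= b -> abs_cont_on a b F ->
  abs_cont_on c d (F \o clamp a b).
Proof.
move=> ab acF eps e0; have [dl d0 H] := acF eps e0; exists dl => // s sin sdis slen.
pose s' := [seq (clamp a b p.1, clamp a b p.2) | p <- s].
have := H s'; rewrite /s' big_map /=; apply.
- apply/allP => _ /mapP[p ps ->] /=.
  have /andP[-> _] := clamp_in p.1 ab; have /andP[_ ->] := clamp_in p.2 ab.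
  by have /allP/(_ _ ps)/and3P[_ pp _] := sin; rewrite clamp_le.
- rewrite pairwise_map; apply: sub_pairwise sdis => p q /orP[|] h; apply/orP.
    by left; exact: clamp_le.
  by right; exact: clamp_le.
- apply: le_lt_trans slen; rewrite /total_length big_map /= big_seq [leRHS]big_seq.
  apply: ler_sum => p ps; apply: clamp_lip.
  by have /allP/(_ _ ps)/and3P[_ ? _] := sin.
Qed.

Lemma abs_cont_on_continuous a b F : abs_cont_on a b F ->
  forall x, a < x < b -> {for x, continuous F}.
Proof.
move=> acF x /andP[ax xb]; apply/cvgrPdist_lt => eps e0.
have [d d0 H] := acF eps e0.
have one u v : a <= u -> u <= v -> v <= b -> v - u < d -> `|F v - F u| < eps.
  move=> au uv vb uvd.
  have := H [:: (u, v)]; rewrite /= au uv vb /= /total_length !big_cons !big_nil.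
  by rewrite !addr0 /=; apply.
apply/nbhs_ballP; exists (Num.min d (Num.min (x - a) (b - x))) => /=.
  by rewrite !lt_min d0 !subr_gt0 ax xb.
move=> y; rewrite /ball/= !lt_min => /and3P[].
rewrite !ltr_norml => /andP[? ?] /andP[? ?] /andP[? ?]; rewrite -ltr_norml.
have [xy|yx] := leP x y.
  rewrite distrC; apply: one => //; lra.
apply: one => //; lra.
Qed.

(** The last clause pins down an empty component: both of its endpoints lie at [a], where it
    overlaps no other interval of the family. *)
Lemma open_itvE a b (I : set R) : a <= b -> open I -> is_interval I ->
  I `<=` `]a, b[%classic ->
  exists u v, [/\ a <= u, u <= v, v <= b, I = `]u, v[%classic &
    (u < v) || (v == a)].
Proof.
move=> ab oI iI Iab; have [->|/set0P I0] := eqVneq I set0.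
  by exists a, a; split => //; [rewrite set_itvoo0//|rewrite eqxx orbT].
have lI : has_lbound I by exists a => x /Iab/=; rewrite in_itv/= => /andP[/ltW].
have uI : has_ubound I by exists b => x /Iab/=; rewrite in_itv/= => /andP[_ /ltW].
have IE : I = `]inf I, sup I[%classic.
  by rewrite -interval_bounded_interior//; apply/esym/interior_id.
have uv : inf I < sup I.
  case: I0 => x; rewrite {1}IE/= in_itv/= => /andP[]; exact: lt_trans.
exists (inf I), (sup I); split => //; last by rewrite uv.
- by apply: lb_le_inf => // x /Iab/=; rewrite in_itv/= => /andP[/ltW].
- exact: ltW.
- by apply: ge_sup => // x /Iab/=; rewrite in_itv/= => /andP[_ /ltW].
Qed.

End AbsCont.

(** * Radon-Nikodym density of a monotone absolutely continuous function *)

Section AbsContDensity.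
Context {R : realType}.
Implicit Types (F G : R -> R) (a b : R) (s : seq (R * R)) (p q : R * R).
Local Notation leb := (@lebesgue_measure R).

Lemma stieltjes_itvoc (C : cumulative R R) a b : a <= b ->
  lebesgue_stieltjes_measure C `]a, b]%classic = (C b - C a)%:E.
Proof.
move=> ab; rewrite /lebesgue_stieltjes_measure /measure_extension/=.
by rewrite measurable_mu_extE/= ?wlength_itv_bnd//; exact: is_ocitv.
Qed.

Lemma itvoo_meet (u v u' v' : R) : u < v -> u' < v' -> u' < v -> u < v' ->
  (`]u, v[%classic `&` `]u', v'[%classic) !=set0.
Proof.
move=> uv uv' h h'; exists ((Num.max u u' + Num.min v v') / 2).
split; rewrite /= in_itv/=; case: (leP u u') => ?; case: (leP v v') => ?;
  apply/andP; split; lra.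
Qed.

Variables (a b : R) (V : R -> R).
Hypotheses (ab : a < b) (acV : abs_cont_on a b V).
Hypothesis ndV : forall x y, a <= x -> x <= y -> y <= b -> V x <= V y.

Let ab1 : a - 1 <= b + 1.
Proof. by rewrite lerBlDr (le_trans (ltW ab))// -addrA lerDl. Qed.

Let W := V \o clamp a b.

Let ndW : nondecreasing W.
Proof.
move=> x y xy; have /andP[? _] := clamp_in x (ltW ab).
have /andP[_ ?] := clamp_in y (ltW ab).
by apply: ndV => //; exact: clamp_le.
Qed.

Let rcW : right_continuous W.
Proof.
apply: right_continuousW => x.
have acW := @abs_cont_on_clamp R a b (x - 1) (x + 1) V (ltW ab) acV.
by apply: (abs_cont_on_continuous acW); lra.
Qed.

HB.instance Definition _ := isCumulative.Build R _ R W ndW rcW.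

Let mu := lebesgue_stieltjes_measure W.

(** A bounded window makes the Stieltjes measure finite; the margin 1 keeps every []a, x]] with x at
    most b inside it. *)
Let D : set (measurableTypeR R) := `]a - 1, b + 1[%classic.

Let mD : measurable D. Proof. exact: measurable_itv. Qed.

Let muD : (mu D < +oo)%E.
Proof.
apply: (@le_lt_trans _ _ (mu `]a - 1, b + 1]%classic)).
  apply: le_measure; rewrite ?inE; [exact: measurable_itv|exact: measurable_itv|].
  by apply: subset_itvl; rewrite bnd_simp.
by rewrite /mu stieltjes_itvoc// ltry.
Qed.

Let nu : {finite_measure set (measurableTypeR R) -> \bar R} := mfrestr mD muD.

(** A null set has an open neighbourhood of length below delta. Its components are disjoint
    intervals; absolute continuity of [W] bounds the Stieltjes mass of any finite number of them by
    e, hence the mass of the whole series. *)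
Let nu_dom : nu `<< leb.
Proof.
apply/null_content_dominatesP => A mA A0.
apply/eqP; rewrite eq_le measure_ge0 andbT; apply/lee_addgt0Pr => e e0; rewrite add0e.
have acW := @abs_cont_on_clamp R a b (a - 1) (b + 1) V (ltW ab) acV.
have [d d0 H] := acW e e0.
have [|U [oU AU UAd]] := lebesgue_regularity_outer mA _ d0; first by rewrite A0.
have mU : measurable (U : set (measurableTypeR R)) by exact: open_measurable.
have Ud : (leb U < d%:E)%E.
  rewrite -(setDUK AU); apply: le_lt_trans (measureU2 _ _ _) _ => //.
    exact: measurableD.
  by rewrite [X in (X + _)%E]A0 add0e.
pose U' := U `&` D.
have oU' : open U' by apply: openI => //; exact: interval_open.
pose I := open_disjoint_itv oU'.
have IU : U' = \bigcup_k I k by exact: open_disjoint_itv_bigcup.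
have Iex k := @open_itvE _ (a - 1) (b + 1) (I k).
have ID k : I k `<=` `]a - 1, b + 1[%classic.
  by move=> x Ix; have [] : U' x by rewrite IU; exists k.
have {}Iex k := Iex k ab1 (@open_disjoint_itv_open _ _ oU' k) (@open_disjoint_itv_is_interval _ _ oU' k) (ID k).
pose u k := projT1 (cid (Iex k)).
pose v k := projT1 (cid (projT2 (cid (Iex k)))).
have uv k : [/\ a - 1 <= u k, u k <= v k, v k <= b + 1, I k = `]u k, v k[%classic &
    (u k < v k) || (v k == a - 1)].
  exact: (projT2 (cid (projT2 (cid (Iex k))))).
have mI k : measurable (I k : set (measurableTypeR R)).
  by case: (uv k) => _ _ _ -> _; exact: measurable_itv.
have tI : trivIset setT I by exact: open_disjoint_itv_trivIset.
apply: (@le_trans _ _ (mu U')).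
  rewrite /nu /= /mfrestr /mrestr; apply: le_measure; rewrite ?inE.
  - exact: measurableI.
  - exact: measurableI.
  - exact: setSI.
have lebI : (\sum_(0 <= k <oo) leb (I k) = leb U')%E.
  by rewrite IU measure_bigcup//; apply: eq_eseriesl => i; rewrite in_setT.
have muI : (\sum_(0 <= k <oo) mu (I k) = mu U')%E.
  rewrite IU /mu (@measure_bigcup _ _ _ (lebesgue_stieltjes_measure W) setT I)//.
  by apply: eq_eseriesl => i; rewrite in_setT.
rewrite -muI; apply: lime_le; first exact: is_cvg_nneseries.
apply: nearW => n.
pose s := [seq (u k, v k) | k <- index_iota 0 n].
apply: (@le_trans _ _ (\sum_(p <- s) (`|W p.2 - W p.1|)%:E)%E).
  rewrite big_map; apply: lee_sum => k _.
  have [h1 h2 h3 h4 _] := uv k.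
  apply: (@le_trans _ _ (mu `]u k, v k]%classic)).
    rewrite h4; apply: le_measure; rewrite ?inE; [exact: measurable_itv|exact: measurable_itv|].
    by apply: subset_itvl; rewrite bnd_simp.
  by rewrite /mu stieltjes_itvoc//= lee_fin ler_norm.
rewrite sumEFin lee_fin ltW//; apply: H.
- by apply/allP => _ /mapP[k _ ->] /=; have [-> -> ->] := uv k.
- rewrite pairwise_map; apply/(pairwiseP 0%N) => i j.
  rewrite !inE size_iota subn0 => ilt jlt ij.
  rewrite !nth_iota ?subn0// !add0n /nonoverlap /=.
  have [i1 i2 i3 i4 i5] := uv i; have [j1 j2 j3 j4 j5] := uv j.
  (* Empty components sit at the left end a - 1 of the window and so precede everything. Two
     nondegenerate components that overlap share a point, hence have the same index. *)
  case/orP : i5 => [i5|/eqP ->]; last by rewrite j1.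
  case/orP : j5 => [j5|/eqP ->]; last by rewrite i1 orbT.
  apply/negPn/negP; rewrite negb_or -!ltNge => /andP[ji ij'].
  have : i = j.
    by apply: tI => //; rewrite i4 j4; exact: itvoo_meet.
  by move=> eij; rewrite eij ltnn in ij.
- rewrite -lte_fin; apply: le_lt_trans Ud.
  apply: (@le_trans _ _ (leb U')); last first.
    by apply: le_measure; rewrite ?inE//; [exact: measurableI|exact: subIsetl].
  rewrite -lebI /total_length big_map -sumEFin.
  rewrite (eq_bigr (fun k => leb (I k))); last first.
    move=> k _; have [_ h2 _ -> _] := uv k; rewrite lebesgue_measure_itv/= lte_fin.
    by move: h2; rewrite le_eqVlt => /predU1P[->|->]; rewrite ?ltxx ?subrr ?EFinB.
  exact: nneseries_lim_ge.
Qed.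

Lemma monotone_abs_cont_density : exists2 g : R -> R,
  leb.-integrable setT (EFin \o g) &
  forall x, a <= x -> x <= b -> V x - V a = \int[leb]_(t in `]a, x]) g t.
Proof.
have [f [f0 ff fi fE]] := radon_nikodym_sigma_finite nu_dom.
exists (fine \o f).
  rewrite (_ : _ \o _ = f)//; apply/funext => x /=; exact: fineK.
move=> x ax xb; rewrite /Rintegral.
have -> : (\int[leb]_(t in `]a, x]) ((fine \o f) t)%:E = \int[leb]_(t in `]a, x]) f t)%E.
  by apply: eq_integral => t _ /=; exact: fineK.
rewrite -fE; last exact: measurable_itv.
rewrite /nu /= /mfrestr /mrestr setIidl; last first.
  move=> t /=; rewrite /D /= !in_itv/= => /andP[h1 h2].
  by rewrite (lt_trans _ h1) ?ltrBlDr ?ltrDl// (le_lt_trans h2)// (le_lt_trans xb)// ltrDl.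
by rewrite /mu stieltjes_itvoc//= /W /= !clamp_id ?lexx ?ax ?(ltW ab).
Qed.

End AbsContDensity.

(** * Measurability of the pointwise derivative *)

Section Derive1.
Context {R : realType}.
Implicit Types (F G : R -> R).
Local Notation leb := (@lebesgue_measure R).

Lemma derive1_dvg F x : ~ derivable F x 1 -> derive1 F x = 0.
Proof.
move=> nF; apply: dvgP; apply: contra_not nF.
rewrite /derivable (_ : (fun h : R => h^-1 *: _) =
  (fun h => h^-1 *: ((F \o shift x) (h *: 1) - F x)))//.
by apply/funext => h /=; rewrite [h *: 1]mulr1.
Qed.

Lemma derivable_quotient F x :
  derivable F x 1 <-> cvg (h^-1 * (F (h + x) - F x) @[h --> 0^']).
Proof.
rewrite /derivable (_ : (fun h : R => h^-1 *: _) =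
  (fun h => h^-1 * (F (h + x) - F x)))//.
by apply/funext => h /=; rewrite [h *: 1]mulr1.
Qed.

(** The tolerances 1/(k+1) and 1/(m+1) leave uncountable quantifiers only over h and h', and for
    continuous F these give an intersection of closed sets. The set of differentiability points is
    then Borel. *)
Lemma derivable_cauchy F x : derivable F x 1 <->
  forall k : nat, exists m : nat, forall h h' : R,
    h != 0 -> h' != 0 -> `|h| < m.+1%:R^-1 -> `|h'| < m.+1%:R^-1 ->
    `|h^-1 * (F (h + x) - F x) - h'^-1 * (F (h' + x) - F x)| <= k.+1%:R^-1.
Proof.
rewrite derivable_quotient; split.
  move=> /cvg_ex[l ql] k.
  have k0 : 0 < k.+1%:R^-1 / 2 :> R by rewrite divr_gt0.
  have /cvgrPdist_lt/(_ _ k0)/nbhs_ballP[d /= d0 H] := ql.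
  exists (Num.bound d^-1) => h h' h0 h'0 hm h'm.
  have small (z : R) : `|z| < (Num.bound d^-1).+1%:R^-1 -> `|z| < d.
    move=> /lt_le_trans; apply; rewrite invf_ple ?posrE//.
    rewrite ltW// (lt_trans (archi_boundP _))// ?invr_ge0 1?ltW// ltr_nat//.
  have := H h; rewrite /ball/= sub0r normrN => /(_ (small _ hm) h0) A.
  have := H h'; rewrite /ball/= sub0r normrN => /(_ (small _ h'm) h'0) B.
  rewrite -[X in `|X|](subrKA l) (le_trans (ler_normD _ _))//.
  by rewrite [X in X + _]distrC (splitr k.+1%:R^-1) lerD// ltW.
move=> H; apply: cauchy_cvg; apply: cauchy_exP => e e0.
have [m Hm] := H (Num.bound e^-1).
pose z : R := m.+1%:R^-1 / 2.
have z0 : z != 0 by rewrite gt_eqF// divr_gt0.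
have zm : `|z| < m.+1%:R^-1.
  by rewrite gtr0_norm ?divr_gt0// ltr_pdivrMr// ltr_pMr// ltr1n.
exists (z^-1 * (F (z + x) - F x)).
apply/nbhs_ballP; exists m.+1%:R^-1 => //= h; rewrite /ball/= sub0r normrN => hm h0.
apply: le_lt_trans (Hm _ _ z0 h0 zm hm) _.
rewrite invf_plt ?posrE// (lt_trans (archi_boundP _)) ?invr_ge0 1?ltW// ltr_nat//.
Qed.

(** Each [C k m] is closed because the quotients are continuous, so the differentiability set [D] is
    Borel. On [D] the derivative is the limit of the quotients with increments 1/(n+1); off [D] it
    takes the default value 0. *)
Lemma measurable_derive1 F : continuous F ->
  measurable_fun [set: measurableTypeR R] (derive1 F).
Proof.
move=> cF.
pose q h x := h^-1 * (F (h + x) - F x).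
have cq h : continuous (q h).
  move=> x; apply: cvgM; first exact: cvg_cst.
  apply: cvgB; last exact: cF.
  apply: (@continuous_comp _ _ _ (fun x => h + x) F); last exact: cF.
  by apply: cvgD; [exact: cvg_cst|exact: cvg_id].
pose C k m := \bigcap_(hh in [set hh : R * R | [/\ hh.1 != 0, hh.2 != 0,
   `|hh.1| < m.+1%:R^-1 & `|hh.2| < m.+1%:R^-1]])
     [set x | `|q hh.1 x - q hh.2 x| <= k.+1%:R^-1].
have cC k m : closed (C k m).
  apply: closed_bigI => hh _.
  have -> : [set x | `|q hh.1 x - q hh.2 x| <= k.+1%:R^-1] =
    (fun x => `|q hh.1 x - q hh.2 x|) @^-1` [set y | y <= k.+1%:R^-1] by [].
  apply: preimage_closed; last exact: closed_le.
  by move=> x _; apply: cvg_norm; apply: cvgB; exact: cq.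
pose D := \bigcap_k \bigcup_m C k m.
have DE : D = [set x | derivable F x 1].
  apply/seteqP; split => x.
    move=> Dx; apply/derivable_cauchy => k; have [m _ Cm] := Dx k Logic.I.
    by exists m => h h' h0 h'0 hm h'm; apply: (Cm (h, h')).
  move=> /derivable_cauchy H k _; have [m Hm] := H k; exists m => // -[h h'] [] /= *.
  exact: Hm.
have mD : measurable (D : set (measurableTypeR R)).
  apply: bigcapT_measurable => k; apply: bigcupT_measurable => m.
  exact: closed_measurable.
have mDq : measurable_fun (D : set (measurableTypeR R)) (derive1 F).
  apply: (measurable_fun_cvg (h := fun n : nat => q n.+1%:R^-1)).
    by move=> n; apply: measurable_funTS; apply: continuous_measurable_fun; exact: cq.
  move=> x; rewrite DE => /derivable_quotient dF.
  have {}dF : (fun h => q h x) @ 0^' --> derive1 F x by exact: dF.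
  have /cvg_at_rightP := cvg_dnbhs_at_right dF.
  by apply; split => //; exact: cvg_harmonic.
rewrite -(setUv D); apply/measurable_funU => //; first exact: measurableC.
split => //.
have m0 : measurable_fun (~` D : set (measurableTypeR R)) (fun _ => 0 : R) by exact: measurable_cst.
apply: eq_measurable_fun m0 => x; rewrite inE DE /= => nd.
by rewrite derive1_dvg.
Qed.

End Derive1.

(** * Fundamental theorem of calculus for locally absolutely continuous functions *)

Section LocallyAbsCont.
Context {R : realType}.
Implicit Types (F G g : R -> R) (a b : R).
Local Notation leb := (@lebesgue_measure R).

Lemma ae_mono (m : {measure set (measurableTypeR R) -> \bar R}) (P Q : R -> Prop) :
  (forall x, P x -> Q x) -> {ae m, forall x, P x} -> {ae m, forall x, Q x}.
Proof. by move=> PQ; apply: (@filterS _ _ (ae_filter_ringOfSetsType m)). Qed.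

Lemma ae_and (m : {measure set (measurableTypeR R) -> \bar R}) (P Q : R -> Prop) :
  {ae m, forall x, P x} -> {ae m, forall x, Q x} ->
  {ae m, forall x, P x /\ Q x}.
Proof. by move=> aP aQ; apply: (@filterI _ _ (ae_filter_ringOfSetsType m)). Qed.

Lemma abs_cont_onB a b F G : abs_cont_on a b F -> abs_cont_on a b G ->
  abs_cont_on a b (F \- G).
Proof.
move=> acF acG e e0; have e20 : 0 < e / 2 by lra.
have [d1 d10 H1] := acF _ e20; have [d2 d20 H2] := acG _ e20.
exists (Num.min d1 d2); first by rewrite lt_min d10.
move=> s sin sdis; rewrite lt_min => /andP[s1 s2].
have := ltrD (H1 s sin sdis s1) (H2 s sin sdis s2).
rewrite -splitr -big_split/=; apply: le_lt_trans; apply: ler_sum => p _.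
rewrite (_ : F p.2 - G p.2 - (F p.1 - G p.1) = (F p.2 - F p.1) - (G p.2 - G p.1)).
  exact: ler_normB.
by lra.
Qed.

(** F is the difference of the monotone functions V and V - F, and the densities subtract
    accordingly. *)
Lemma abs_cont_density F a b : a < b -> abs_cont_on a b F ->
  exists2 g : R -> R, leb.-integrable setT (EFin \o g) &
  forall x, a <= x -> x <= b -> F x - F a = \int[leb]_(t in `]a, x]) g t.
Proof.
move=> ab acF; have [V acV VF] := abs_cont_on_monotone acF.
have ndV x y : a <= x -> x <= y -> y <= b -> V x <= V y.
  by move=> ax xy yb; rewrite -subr_ge0 (le_trans _ (VF x y ax xy yb)).
have ndVF x y : a <= x -> x <= y -> y <= b -> (V \- F) x <= (V \- F) y.
  move=> ax xy yb; have := le_trans (ler_norm _) (VF x y ax xy yb) => /=; lra.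
have [g ig gE] := monotone_abs_cont_density ab acV ndV.
have [h ih hE] := monotone_abs_cont_density ab (abs_cont_onB acV acF) ndVF.
exists (fun x => g x - h x).
  by apply: (integrableB _ ig ih).
move=> x ax xb; rewrite RintegralB//; last 2 first.
- by apply: integrableS ig.
- by apply: integrableS ih.
by rewrite -gE// -hE//=; lra.
Qed.

Lemma near_add_derive (F P : R -> R) (c x : R) : {near x, (fun y => c + P y) =1 F} ->
  derivable P x 1 -> derivable F x 1 /\ derive1 F x = derive1 P x.
Proof.
move=> nP dP; have dc : derivable (cst c : R -> R) x 1 by exact: derivable_cst.
have dQ : derivable ((cst c : R -> R) \+ P) x 1 by exact: derivableD.
split; first exact: near_eq_derivable nP dQ.
rewrite !derive1E -(near_eq_derive _ nP).
by rewrite (deriveD dc dP) derive_cst add0r.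
Qed.

Lemma ae_derive_integral F g a b : leb.-integrable setT (EFin \o g) ->
  (forall x, a <= x -> x <= b -> F x - F a = \int[leb]_(t in `]a, x]) g t) ->
  {ae leb, forall x, a < x < b -> derivable F x 1 /\ derive1 F x = g x}.
Proof.
move=> ig Fg.
have lg : locally_integrable setT g by apply: open_integrable_locally => //; exact: openT.
have iy y : leb.-integrable [set` Interval (BRight a) (BRight y)] (EFin \o g).
  by apply: integrableS ig.
have := FTC1 iy lg; apply: ae_mono => x /= H /andP[ax xb]; have [dP P'] := H ax.
have nearP : {near x, (fun y => F a + \int[leb]_(t in `]a, y]) g t) =1 F}.
  near=> y; rewrite /= -Fg; first by lra.
    by near: y; exact: lt_le_nbhsr.
  by near: y; exact: lt_le_nbhsl.
have [d1 d2] := near_add_derive nearP dP.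
by split => //; rewrite d2 P'.
Unshelve. all: by end_near. Qed.

Lemma loc_ac_ae_density F a b : a < b -> loc_ac_real F ->
  exists g : R -> R, [/\ leb.-integrable setT (EFin \o g),
  forall x, a <= x -> x <= b -> F x - F a = \int[leb]_(t in `]a, x]) g t &
  {ae leb, forall x, a < x < b -> derivable F x 1 /\ derive1 F x = g x}].
Proof.
move=> ab /(loc_ac_real_on ab)/(abs_cont_density ab)[g ig gE].
by exists g; split => //; exact: ae_derive_integral.
Qed.

Lemma loc_ac_continuous F : loc_ac_real F -> continuous F.
Proof.
move=> acF x; have := loc_ac_real_on (_ : x - 1 < x + 1) acF.
move=> /(_ ltac:(lra)) acx; apply: (abs_cont_on_continuous acx); lra.
Qed.

Lemma loc_ac_derivable F : loc_ac_real F -> {ae leb, forall x, derivable F x 1}.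
Proof.
move=> acF.
have H (n : nat) : {ae leb, forall x, - n.+1%:R < x < n.+1%:R -> derivable F x 1}.
  have n1 : - n.+1%:R < n.+1%:R :> R by rewrite gtrN.
  have [g [_ _]] := loc_ac_ae_density n1 acF.
  by apply: ae_mono => x /= h /h[].
have := ae_foralln H; apply: ae_mono => x /(_ (Num.bound `|x|)); apply.
rewrite -ltr_norml (lt_trans (archi_boundP _))// ltr_nat//.
Qed.

(** The density is taken on [a - 1, b + 1], so that its a.e. identification with [derive1 F], which
    holds on an open interval, covers all of [a, b]. *)
Lemma loc_ac_FTC F a b : loc_ac_real F -> a <= b ->
  leb.-integrable `[a, b] (EFin \o derive1 F) /\
  \int[leb]_(t in `[a, b]) derive1 F t = F b - F a.
Proof.
move=> acF ab; have ab1 : a - 1 < b + 1.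
  by rewrite ltrBlDr (le_lt_trans ab)// -addrA ltrDl.
have [g [ig gE aeg]] := loc_ac_ae_density ab1 acF.
have mF : measurable_fun [set: measurableTypeR R] (derive1 F).
  by apply: measurable_derive1; exact: loc_ac_continuous.
have mg : measurable_fun [set: measurableTypeR R] g.
  by have /integrableP[/measurable_EFinP] := ig.
have aeq : ae_eq leb `[a, b]%classic g (derive1 F).
  move: aeg; apply: ae_mono => x H /=; rewrite in_itv/= => /andP[ax xb].
  have [|_ ->//] := H; apply/andP; split.
    by rewrite (lt_le_trans _ ax)// ltrBlDr ltrDl.
  by rewrite (le_lt_trans xb)// ltrDl.
have ig' : leb.-integrable `[a, b] (EFin \o g) by apply: integrableS ig.
split.
  apply/integrableP; split; first exact/measurable_funTS/measurable_EFinP.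
  have /integrableP[_] := ig'; congr (_ < _)%E.
  apply: ae_eq_integral => //.
  - by apply/measurable_funTS; apply/measurableT_comp => //; exact/measurable_EFinP.
  - by apply/measurable_funTS; apply/measurableT_comp => //; exact/measurable_EFinP.
  - by move: aeq; apply: ae_mono => x H /= /H ->.
have -> : \int[leb]_(t in `[a, b]) derive1 F t = \int[leb]_(t in `[a, b]) g t.
  congr fine; apply: ae_eq_integral => //.
  - exact/measurable_funTS/measurable_EFinP.
  - exact/measurable_funTS/measurable_EFinP.
  - by move: aeq; apply: ae_mono => x H /= /H ->.
rewrite -Rintegral_itv_obnd_cbnd; last first.
  by apply: integrableS ig.
have b1 : a - 1 <= b by rewrite lerBlDr (le_trans ab)// lerDl.
have a1 : a - 1 <= a by rewrite lerBlDr lerDl.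
have bb1 : b <= b + 1 by rewrite lerDl.
have aba : a <= b + 1 by exact: le_trans ab bb1.
rewrite -(@Rintegral_itvB _ _ (BRight (a - 1)) (BRight b))//; last first.
  by apply: integrableS ig.
by rewrite -!gE//; lra.
Qed.

Lemma Rintegral_itv_cat g a b c : leb.-integrable `[a, b] (EFin \o g) ->
  a <= c -> c <= b ->
  \int[leb]_(t in `[a, b]) g t = \int[leb]_(t in `[a, c]) g t + \int[leb]_(t in `[c, b]) g t.
Proof.
move=> ig ac cb; rewrite -(@Rintegral_itv_obnd_cbnd _ c); last first.
  by apply: integrableS ig => //; apply: subset_itvr; rewrite bnd_simp.
by rewrite -(@Rintegral_itvB _ _ (BLeft a) (BRight b))// addrCA subrr addr0.
Qed.

Definition loc_integrable g : Prop :=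
  measurable_fun [set: measurableTypeR R] g /\
  forall a b, leb.-integrable `[a, b] (EFin \o g).

(** The signed integral from 0 to x: for x other than 0 one of the two intervals is empty. *)
Definition prim g x : R :=
  \int[leb]_(t in `[0, x]) g t - \int[leb]_(t in `[x, 0]) g t.

Lemma primB g a b : loc_integrable g -> a <= b ->
  prim g b - prim g a = \int[leb]_(t in `[a, b]) g t.
Proof.
move=> [_ ig] ab.
have z x : 0 <= x -> \int[leb]_(t in `[x, 0]) g t = 0.
  rewrite le_eqVlt => /predU1P[<-|x0]; first by rewrite set_itv1 Rintegral_set1.
  by rewrite set_itv_ge ?Rintegral_set0// bnd_simp -ltNge.
have z' x : x <= 0 -> \int[leb]_(t in `[0, x]) g t = 0.
  rewrite le_eqVlt => /predU1P[->|x0]; first by rewrite set_itv1 Rintegral_set1.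
  by rewrite set_itv_ge ?Rintegral_set0// bnd_simp -ltNge.
rewrite /prim; have [a0|a0] := leP 0 a.
  by rewrite !z ?(le_trans a0 ab)// (@Rintegral_itv_cat _ 0 b a)//; lra.
have [b0|b0] := leP 0 b.
  rewrite (z b)// (z' a) ?(ltW a0)// (@Rintegral_itv_cat _ a b 0) ?(ltW a0)//; lra.
by rewrite (z' b) ?(ltW b0)// (z' a) ?(ltW a0)// (@Rintegral_itv_cat _ a 0 b) ?(ltW b0)//; lra.
Qed.

Lemma prim_derive g : loc_integrable g ->
  {ae leb, forall x, derivable (prim g) x 1 /\ derive1 (prim g) x = g x}.
Proof.
move=> lg.
have H (n : nat) : {ae leb, forall x, - n.+1%:R < x < n.+1%:R ->
    derivable (prim g) x 1 /\ derive1 (prim g) x = g x}.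
  have n1 : - n.+1%:R <= n.+1%:R :> R by rewrite ltW// gtrN.
  pose h := g \_ `[- n.+1%:R, n.+1%:R].
  have ih : leb.-integrable setT (EFin \o h).
    rewrite /h -restrict_EFin; apply/integrable_restrict => //; rewrite setTI.
    exact: lg.2.
  have := @ae_derive_integral (prim g) h (- n.+1%:R) n.+1%:R ih.
  suff hE x : - n.+1%:R <= x -> x <= n.+1%:R ->
      prim g x - prim g (- n.+1%:R) = \int[leb]_(t in `](- n.+1%:R), x]) h t.
    move=> /(_ hE); apply: ae_mono => x H /[dup]/H[d1 ->] /andP[/ltW nx /ltW xn].
    by split => //; rewrite /h patchE mem_set//= in_itv/= nx.
  move=> nx xn; rewrite primB// -Rintegral_itv_obnd_cbnd; last first.
    by apply: integrableS (lg.2 (- n.+1%:R) x) => //; apply: subset_itvr; rewrite bnd_simp.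
  apply: eq_Rintegral => t; rewrite inE/= in_itv/= => /andP[nt tx].
  by rewrite /h patchE mem_set//= in_itv/= (ltW nt) (le_trans tx).
have := ae_foralln H; apply: ae_mono => x /(_ (Num.bound `|x|)); apply.
by rewrite -ltr_norml (lt_trans (archi_boundP _))// ltr_nat.
Qed.

Lemma le_Rintegral_prim g a b : loc_integrable g -> a <= b ->
  `|prim g b - prim g a| <= \int[leb]_(t in `[a, b]) `|g t|.
Proof. by move=> lg ab; rewrite primB// le_normr_Rintegral//; exact: lg.2. Qed.

(** Absolute continuity of the integral of |g| over [a, b], applied to the union of the disjoint
    intervals. *)
Lemma prim_loc_ac g : loc_integrable g -> loc_ac_real (prim g).
Proof.
move=> lg a b ab e e0; pose h := g \_ `[a, b].
have ih : leb.-integrable setT (EFin \o h).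
  rewrite /h -restrict_EFin; apply/integrable_restrict => //; rewrite setTI.
  exact: lg.2.
have [d [d0 H]] := integral_normr_continuous ih e0; exists d => // n u v uv tuv len.
pose I i : set (measurableTypeR R) := `]u i, v i[%classic.
have mI i : measurable (I i) by exact: measurable_itv.
pose A := \big[setU/set0]_(i < n) I i.
have mA : measurable A by apply: bigsetU_measurable.
have /H : (leb A < d%:E)%E.
  rewrite /A measure_bigsetU_ord// (eq_bigr (fun i => (v i - u i)%:E)).
    by rewrite sumEFin lte_fin.
  move=> i _; have [_ [+ _]] := uv i.
  rewrite (_ : _ (I i) = leb `]u i, v i[%classic)// lebesgue_measure_itv/= lte_fin.
  by rewrite le_eqVlt => /predU1P[->|->]; rewrite ?ltxx ?subrr ?EFinB.
move=> /(_ mA); apply: le_lt_trans.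
have Iab i : I i `<=` `[a, b].
  have [au [_ vb]] := uv i; apply: subset_itv; rewrite bnd_simp//.
have inh i : leb.-integrable (I i) (EFin \o (fun x => `|h x|)).
  by apply: (@integrable_norm _ _ _ leb); apply: integrableS ih.
have -> : \int[leb]_(x in A) `|h x| = \sum_(i < n) \int[leb]_(x in I i) `|h x|.
  rewrite /Rintegral /A integral_bigsetU_EFin//=; last 3 first.
  - exact: index_enum_uniq.
  - by apply: sub_trivIset tuv.
  - apply/measurable_funTS/measurable_EFinP/measurableT_comp => //.
    by have /integrableP[/measurable_EFinP] := ih.
  rewrite -sum_fine//= => i _; exact: integrable_fin_num.
apply: ler_sum => i _; have [au [uvi vb]] := uv i.
apply: le_trans (le_Rintegral_prim lg uvi) _.
rewrite le_eqVlt; apply/orP; left; apply/eqP.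
rewrite -Rintegral_itv_obnd_cbnd -?Rintegral_itv_bndo_bndc.
- apply: eq_Rintegral => x; rewrite inE => /Iab xab.
  by rewrite /h patchE mem_set.
- apply: (@integrable_norm _ _ _ leb); apply: integrableS (lg.2 (u i) (v i)) => //.
  by apply: subset_itv; rewrite bnd_simp.
- apply: (@integrable_norm _ _ _ leb); apply: integrableS (lg.2 (u i) (v i)) => //.
  by apply: subset_itvr; rewrite bnd_simp.
Qed.

Lemma continuous_bounded_itv F a b : continuous F ->
  exists2 K, 0 < K & forall x, a <= x -> x <= b -> `|F x| <= K.
Proof.
move=> cF; have [ba|ab] := ltP b a.
  by exists 1 => // x ax xb; have := le_trans ax xb; rewrite leNgt ba.
have [|c _ H] := @EVT_max R (fun x => `|F x|) a b ab.
  by apply: continuous_subspaceT => x; apply: cvg_norm; exact: cF.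
exists (`|F c| + 1) => [|x ax xb]; first by rewrite ltr_wpDl.
by rewrite (le_trans (H x _)) ?in_itv/= ?ax// lerDl.
Qed.

Lemma loc_acD F G : loc_ac_real F -> loc_ac_real G -> loc_ac_real (F \+ G).
Proof.
move=> acF acG a b ab e e0; have e20 : 0 < e / 2 by rewrite divr_gt0.
have [d1 d10 H1] := acF a b ab _ e20; have [d2 d20 H2] := acG a b ab _ e20.
exists (Num.min d1 d2); first by rewrite lt_min d10.
move=> n u v uv tuv; rewrite lt_min => /andP[s1 s2].
have := ltrD (H1 n u v uv tuv s1) (H2 n u v uv tuv s2).
rewrite -splitr -big_split/=; apply: le_lt_trans; apply: ler_sum => i _.
by rewrite opprD addrACA ler_normD.
Qed.

Lemma loc_acM F G : loc_ac_real F -> loc_ac_real G -> loc_ac_real (F \* G).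
Proof.
move=> acF acG a b ab e e0.
have [K K0 HK] := continuous_bounded_itv a b (loc_ac_continuous acF).
have [L L0 HL] := continuous_bounded_itv a b (loc_ac_continuous acG).
have eL0 : 0 < e / 2 / L by rewrite !divr_gt0.
have eK0 : 0 < e / 2 / K by rewrite !divr_gt0.
have [d1 d10 H1] := acF a b ab _ eL0; have [d2 d20 H2] := acG a b ab _ eK0.
exists (Num.min d1 d2); first by rewrite lt_min d10.
move=> n u v uv tuv; rewrite lt_min => /andP[s1 s2].
have h1 := H1 n u v uv tuv s1; have h2 := H2 n u v uv tuv s2.
rewrite ltr_pdivlMr// in h1; rewrite ltr_pdivlMr// in h2.
have := ltrD h1 h2; rewrite -splitr !mulr_suml -big_split/=; apply: le_lt_trans.
apply: ler_sum => i _; have [au [uvi vb]] := uv i.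
rewrite (_ : F (v i) * G (v i) - F (u i) * G (u i) =
  (F (v i) - F (u i)) * G (v i) + (G (v i) - G (u i)) * F (u i)); last by ring.
rewrite (le_trans (ler_normD _ _))// !normrM lerD// ler_wpM2l//.
- by rewrite HL// (le_trans au).
- by rewrite HK// (le_trans uvi).
Qed.

Lemma loc_ac_lip F : (forall a b, exists K, forall x y, a <= x -> x <= y ->
  y <= b -> `|F y - F x| <= K * (y - x)) -> loc_ac_real F.
Proof.
move=> H a b ab e e0; have [K HK] := H a b.
have K1 : 0 < `|K| + 1 by rewrite ltr_wpDl.
exists (e / (`|K| + 1)) => [|n u v uv tuv]; first by rewrite divr_gt0.
rewrite ltr_pdivlMr// mulrC mulr_sumr; apply: le_lt_trans; apply: ler_sum => i _.
have [au [uvi vb]] := uv i; apply: le_trans (HK _ _ au uvi vb) _.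
by rewrite ler_wpM2r ?subr_ge0// (le_trans (ler_norm _))// lerDl.
Qed.

Lemma loc_ac_C1 F : (forall x, derivable F x 1) -> continuous (derive1 F) ->
  loc_ac_real F.
Proof.
move=> dF cF; apply: loc_ac_lip => a b.
have [K K0 HK] := continuous_bounded_itv a b cF; exists K => x y ax xy yb.
have [||c] := @MVT_segment R F (derive1 F) x y xy.
- by move=> z _; rewrite derive1E; apply/derivableP.
- apply: continuous_subspaceT => z; apply: differentiable_continuous.
  exact/derivable1_diffP.
rewrite in_itv/= => /andP[xc cy] ->; rewrite normrM [`|y - x|]ger0_norm ?subr_ge0//.
by rewrite ler_wpM2r ?subr_ge0// HK// ?(le_trans ax)// (le_trans cy).
Qed.

Lemma loc_ac_cst (c : R) : loc_ac_real (fun=> c).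
Proof. by apply: loc_ac_lip => a b; exists 0 => x y *; rewrite subrr normr0 mul0r. Qed.

End LocallyAbsCont.

(** * Test functions and the du Bois-Reymond lemma *)

Section SmoothFunctions.
Context {R : realType}.
Implicit Types (F G : R -> R) (p : {poly R}) (x a b c d : R).
Local Notation leb := (@lebesgue_measure R).

Lemma is_derive_derive1 F x d : is_derive x 1 F d -> derivable F x 1 /\ derive1 F x = d.
Proof. by move=> h; rewrite derive1E (@derive_val _ _ _ _ _ _ _ h); split => //; exact: ex_derive. Qed.

Lemma derivable_is_derive F x : derivable F x 1 -> is_derive x 1 F (derive1 F x).
Proof. by move=> h; rewrite derive1E; exact: derivableP. Qed.

Lemma is_derive_add F G x a b : is_derive x 1 F a -> is_derive x 1 G b ->
  is_derive x 1 (fun y => F y + G y) (a + b).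
Proof. by move=> hF hG; exact: is_deriveD. Qed.

Lemma is_derive_mul F G x a b : is_derive x 1 F a -> is_derive x 1 G b ->
  is_derive x 1 (fun y => F y * G y) (a * G x + F x * b).
Proof.
move=> hF hG; rewrite (_ : _ + _ = F x *: b + G x *: a); first exact: is_deriveM.
by rewrite /GRing.scale/= addrC; congr (_ + _); exact: mulrC.
Qed.

Lemma is_derive_const (c x : R) : is_derive x 1 (fun _ : R => c) 0.
Proof. exact: is_derive_cst. Qed.

Lemma is_derive_affine (a b x : R) : is_derive x 1 (fun y : R => a * y + b) a.
Proof.
have := is_derive_add (is_derive_mul (is_derive_const a x) (is_derive_id x 1)) (is_derive_const b x).
by rewrite mul0r add0r mulr1 addr0.
Qed.

Lemma derive1_add F G x : derivable F x 1 -> derivable G x 1 ->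
  derive1 (fun y => F y + G y) x = derive1 F x + derive1 G x.
Proof.
move=> /derivable_is_derive hF /derivable_is_derive hG.
by have [_ ->] := is_derive_derive1 (is_derive_add hF hG).
Qed.

Lemma derive1_mul F G x : derivable F x 1 -> derivable G x 1 ->
  derive1 (fun y => F y * G y) x = derive1 F x * G x + F x * derive1 G x.
Proof.
move=> /derivable_is_derive hF /derivable_is_derive hG.
by have [_ ->] := is_derive_derive1 (is_derive_mul hF hG).
Qed.

Lemma near_derive1 F G x : {near x, F =1 G} -> derive1 F x = derive1 G x.
Proof. by move=> h; rewrite !derive1E; exact: near_eq_derive. Qed.

(** A coinduction principle: a class of differentiable functions stable under differentiation
    consists of smooth functions. *)
Lemma smooth_real_class (P : (R -> R) -> Prop) :
  (forall F, P F -> (forall x, derivable F x 1) /\ P (derive1 F)) ->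
  forall F, P F -> smooth_real F.
Proof.
move=> HP F PF n; have Pn : P (derive1n n F).
  by elim: n => [//|n ih]; rewrite derive1nS; have [] := HP _ ih.
by have [] := HP _ Pn.
Qed.

Lemma smooth_derivable F : smooth_real F -> forall x, derivable F x 1.
Proof. by move=> /(_ 0%N). Qed.

Lemma smooth_derive1 F : smooth_real F -> smooth_real (derive1 F).
Proof. by move=> sF n x; rewrite -derive1Sn. Qed.

Lemma smooth_antideriv F G : (forall x, is_derive x 1 F (G x)) -> smooth_real G ->
  smooth_real F.
Proof.
move=> FG sG [|n] x; first by have [] := is_derive_derive1 (FG x).
rewrite derive1Sn (_ : derive1 F = G)//.
by apply/funext => y; have [] := is_derive_derive1 (FG y).
Qed.

(** The derivative of a product is a sum of two products, so the products of smooth functions are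
    not visibly stable under differentiation; the generated algebra is. *)
Inductive smooth_alg : (R -> R) -> Prop :=
| smooth_alg_base F : smooth_real F -> smooth_alg F
| smooth_alg_add F G : smooth_alg F -> smooth_alg G -> smooth_alg (fun x => F x + G x)
| smooth_alg_mul F G : smooth_alg F -> smooth_alg G -> smooth_alg (fun x => F x * G x).

Lemma smooth_alg_smooth F : smooth_alg F -> smooth_real F.
Proof.
apply: smooth_real_class => {}F; elim=> {F} [F sF|F G _ [dF sF] _ [dG sG]|F G aF [dF sF] aG [dG sG]].
- split; first exact: smooth_derivable.
  exact/smooth_alg_base/smooth_derive1.
- split=> [x|]; first by have [] := is_derive_derive1 (is_derive_add (derivable_is_derive (dF x)) (derivable_is_derive (dG x))).
  rewrite (_ : derive1 _ = fun x => derive1 F x + derive1 G x); first exact: smooth_alg_add.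
  by apply/funext => x; rewrite derive1_add.
- split=> [x|]; first by have [] := is_derive_derive1 (is_derive_mul (derivable_is_derive (dF x)) (derivable_is_derive (dG x))).
  rewrite (_ : derive1 _ = fun x => derive1 F x * G x + F x * derive1 G x).
    by apply: smooth_alg_add; apply: smooth_alg_mul.
  by apply/funext => x; rewrite derive1_mul.
Qed.

Lemma smoothD F G : smooth_real F -> smooth_real G -> smooth_real (fun x => F x + G x).
Proof. by move=> sF sG; apply: smooth_alg_smooth; apply: smooth_alg_add; exact: smooth_alg_base. Qed.

Lemma smoothM F G : smooth_real F -> smooth_real G -> smooth_real (fun x => F x * G x).
Proof. by move=> sF sG; apply: smooth_alg_smooth; apply: smooth_alg_mul; exact: smooth_alg_base. Qed.

Lemma smooth_cst (c : R) : smooth_real (fun=> c).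
Proof.
apply: (@smooth_real_class (fun F => exists c, F = fun=> c)); last by exists c.
move=> _ [d ->]; split=> [x|]; first exact: derivable_cst.
by exists 0; apply/funext => x; have [] := is_derive_derive1 (is_derive_const d x).
Qed.

Lemma is_derive_comp_affine F a b x d : is_derive (a * x + b) 1 F d ->
  is_derive x 1 (fun y => F (a * y + b)) (d * a).
Proof. by move=> h; exact: (@is_derive1_comp _ F (fun y => a * y + b) x d a h (is_derive_affine a b x)). Qed.

Lemma smooth_comp_affine F (a b : R) : smooth_real F -> smooth_real (fun x => F (a * x + b)).
Proof.
move=> sF; apply: (@smooth_real_class (fun F => exists G c, smooth_real G /\ F = fun x => G (a * x + b) * c)); last first.
  by exists F, 1; split => //; apply/funext => x; rewrite mulr1.
move=> _ [G [c [sG ->]]].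
have H x : is_derive x 1 (fun x => G (a * x + b) * c) (derive1 G (a * x + b) * (a * c)).
  have := is_derive_mul (is_derive_comp_affine (derivable_is_derive (@smooth_derivable G sG (a * x + b))))
    (is_derive_const c x).
  by rewrite mulr0 addr0 mulrA.
split=> [x|]; first by have [] := is_derive_derive1 (H x).
exists (derive1 G), (a * c); split; first exact: smooth_derive1.
by apply/funext => x; have [] := is_derive_derive1 (H x).
Qed.

(** The functions p(1/x) exp(-1/x), extended by 0 to x <= 0, form a class stable under
    differentiation, which replaces p by X^2 (p - p'). [eta 1] is the standard flat function. *)
Definition eta p (x : R) : R := if 0 < x then p.[x^-1] * expR (- x^-1) else 0.

Lemma is_derive_horner p (x : R) : is_derive x 1 (horner p) (p^`()).[x].
Proof.
elim/poly_ind: p => [|p c ih].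
  rewrite (_ : horner 0 = fun=> 0); last by apply/funext => y; rewrite horner0.
  by rewrite deriv0 horner0; exact: is_derive_const.
rewrite (_ : horner _ = fun y => p.[y] * y + c); last first.
  by apply/funext => y; rewrite hornerMXaddC.
rewrite derivD derivM derivC derivX addr0 mulr1 hornerD hornerMX.
have := is_derive_add (is_derive_mul ih (is_derive_id x 1)) (is_derive_const c x).
by rewrite mulr1 addr0.
Qed.

Lemma is_derive_eta_pos p x : 0 < x -> is_derive x 1 (eta p) (eta ('X^2 * (p - p^`())) x).
Proof.
move=> x0; have x0' : x != 0 by rewrite gt_eqF.
have nE : {near x, (fun y => p.[y^-1] * expR (- y^-1)) =1 eta p}.
  by near=> y; rewrite /eta ifT//; near: y; exact: lt_nbhsr.
apply: near_eq_is_derive nE _.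
have dV : is_derive x 1 (fun y : R => y^-1) (- x ^- 2).
  have := @is_deriveV R id x 1 1 x0' (is_derive_id x 1).
  by rewrite [_ *: _]mulr1.
have dN : is_derive x 1 (fun y : R => - y^-1) (x ^- 2).
  by rewrite -[x ^- 2]opprK; exact: is_deriveN.
have d1 := is_derive1_comp (is_derive_horner p x^-1) dV.
have d2 := @is_derive1_comp R expR (fun y => - y^-1) x _ _ (is_derive_expR (- x^-1)) dN.
have := is_derive_mul d1 d2; rewrite /eta x0 /=.
congr (is_derive _ _ _ _); rewrite hornerM hornerXn hornerD hornerN exprVn; ring.
Unshelve. all: by end_near. Qed.

Lemma is_derive_eta_neg p x : x < 0 -> is_derive x 1 (eta p) 0.
Proof.
move=> x0; apply: near_eq_is_derive (is_derive_const 0 x).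
by near=> y; rewrite /eta ltNge ltW//; near: y; exact: lt_nbhsl.
Unshelve. all: by end_near. Qed.

Lemma poly_growth p : exists k : nat, exists2 C, 0 <= C &
  forall t, 1 <= t -> `|p.[t]| <= C * t ^+ k.
Proof.
elim/poly_ind: p => [|p c [k [C C0 ih]]].
  by exists 0%N, 0 => // t _; rewrite horner0 normr0 mul0r.
exists k.+1, (C + `|c|); first by rewrite addr_ge0.
move=> t t1; rewrite hornerMXaddC (le_trans (ler_normD _ _))// mulrDl lerD//.
  by rewrite normrM exprSr mulrA [`|t|]ger0_norm ?(le_trans ler01)// ler_wpM2r ?ih// (le_trans ler01).
by rewrite ler_peMr// exprn_ege1.
Qed.

(** exp(t) is the (n+1)-st power of exp(t / (n+1)), and the latter is at least t / (n+1). *)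
Lemma expR_pow_bound (n : nat) (t : R) : 0 <= t -> t ^+ n.+1 * expR (- t) <= n.+1%:R ^+ n.+1.
Proof.
move=> t0; rewrite expRN ler_pdivrMr ?expR_gt0//.
have tn : t = n.+1%:R * (t / n.+1%:R) by rewrite mulrC divfK// pnatr_eq0.
rewrite [in leRHS]tn expRM_natl -exprMn ler_pXn2r ?nnegrE ?mulr_ge0 ?expR_ge0//.
rewrite {1}tn ler_wpM2l//; apply: le_trans (expR_ge1Dx _); rewrite lerDr//.
Qed.

(** A quadratic bound at 0 is what makes the derivative there 0. In terms of t = 1/x, two extra
    powers of t are traded for x^2 and the exponential absorbs the resulting power t^(k+2). *)
Lemma eta_bound p : exists2 C, 0 <= C & forall x, `|x| < 1 -> `|eta p x| <= C * x ^+ 2.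
Proof.
have [k [C C0 HC]] := poly_growth p.
exists (C * (k.+2%:R ^+ k.+2)); first by rewrite mulr_ge0// exprn_ge0.
move=> x; rewrite /eta; case: ifPn => [x0|_ _]; last first.
  by rewrite normr0 mulr_ge0 ?sqr_ge0// mulr_ge0// exprn_ge0.
rewrite gtr0_norm// => x1; have t1 : 1 <= x^-1 by rewrite invf_ge1// ltW.
rewrite normrM [`|expR _|]ger0_norm ?expR_ge0//.
have := expR_pow_bound k.+1 (le_trans ler01 t1).
rewrite -(ler_pM2l (exprn_gt0 2 x0)) => h.
apply: (@le_trans _ _ (C * x^-1 ^+ k * expR (- x^-1))).
  by rewrite ler_wpM2r ?expR_ge0// HC.
apply: (@le_trans _ _ (C * (x ^+ 2 * (x^-1 ^+ k.+2 * expR (- x^-1))))); last first.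
  by rewrite -mulrA ler_wpM2l// [leRHS]mulrC.
rewrite le_eqVlt; apply/orP; left; apply/eqP; rewrite -mulrA; congr (_ * _).
rewrite mulrA; congr (_ * _); rewrite -(addn2 k) exprD mulrCA -exprMn divff ?gt_eqF//.
by rewrite expr1n mulr1.
Qed.

Lemma is_derive_eta p x : is_derive x 1 (eta p) (eta ('X^2 * (p - p^`())) x).
Proof.
have [x0|x0|<-] := ltgtP 0 x; first exact: is_derive_eta_pos.
  by rewrite {2}/eta ltNge ltW//; exact: is_derive_eta_neg.
rewrite {2}/eta ltxx; have [C C0 HC] := eta_bound p.
have lim0 : h^-1 *: ((eta p \o shift 0) (h *: 1) - eta p 0) @[h --> 0^'] --> (0 : R).
  apply/cvgrPdist_lt => e e0; have C1 : 0 < C + 1 by rewrite ltr_wpDl.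
  near=> h; have h0 : h != 0 by near: h; exact: nbhs_dnbhs_neq.
  have h1 : `|h| < 1 by near: h; exact: dnbhs0_lt.
  have he : `|h| < e / (C + 1) by near: h; apply: dnbhs0_lt; rewrite divr_gt0.
  rewrite /= addr0 [h *: 1]mulr1 sub0r normrN {2}/eta ltxx subr0 [_ *: _]/(_ * _).
  rewrite normrM normfV ltr_pdivrMl ?normr_gt0//.
  apply: le_lt_trans (HC h h1) _; rewrite -real_normK ?num_real// expr2.
  rewrite mulrA mulrC ltr_pM2l ?normr_gt0//.
  rewrite ltr_pdivlMr// in he; apply: le_lt_trans he.
  by rewrite mulrC ler_wpM2l// lerDl.
by apply: DeriveDef; [apply/cvg_ex; exists 0|apply/cvg_lim].
Unshelve. all: by end_near. Qed.

Lemma smooth_eta p : smooth_real (eta p).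
Proof.
apply: (@smooth_real_class (fun F => exists q, F = eta q)); last by exists p.
move=> _ [q ->]; split=> [x|]; first by have [] := is_derive_derive1 (is_derive_eta q x).
exists ('X^2 * (q - q^`())); apply/funext => x.
by have [] := is_derive_derive1 (is_derive_eta q x).
Qed.

Lemma eta1_ge0 x : 0 <= eta 1 x.
Proof. by rewrite /eta; case: ifP => // _; rewrite hornerC mul1r expR_ge0. Qed.

Lemma eta1_le1 x : eta 1 x <= 1.
Proof.
rewrite /eta; case: ifPn => // x0; rewrite hornerC mul1r -expR0 ler_expR.
by rewrite oppr_le0 invr_ge0 ltW.
Qed.

Lemma eta1_le0 x : x <= 0 -> eta 1 x = 0.
Proof. by move=> x0; rewrite /eta ltNge x0. Qed.

Lemma eta1_cvg x : 0 < x -> eta 1 (n.+1%:R * x) @[n --> \oo] --> (1 : R).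
Proof.
move=> x0; rewrite (_ : (fun n : nat => _) = expR \o (fun n : nat => - x^-1 * n.+1%:R^-1)).
  have h : (fun n : nat => - x^-1 * n.+1%:R^-1) @ \oo --> - x^-1 * 0.
    by apply: cvgMr; exact: cvg_harmonic.
  rewrite mulr0 in h; have := cvg_comp _ _ h (@continuous_expR R 0).
  by rewrite expR0.
apply/funext => n /=; rewrite /eta mulr_gt0// hornerC mul1r invfM mulrC mulNr.
by rewrite mulrC.
Qed.

End SmoothFunctions.

(** * Vanishing weak derivatives and the du Bois-Reymond lemma *)

Section DuBoisReymond.
Context {R : realType}.
Implicit Types (F G P Q Z : R -> R) (x a b c h M : R).
Local Notation leb := (@lebesgue_measure R).

Lemma dominated_Rintegral (m : {measure set (measurableTypeR R) -> \bar R})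
    (f_ : nat -> R -> R) (f g : R -> R) :
  (forall n, measurable_fun [set: measurableTypeR R] (f_ n)) ->
  measurable_fun [set: measurableTypeR R] f ->
  {ae m, forall x, f_ n x @[n --> \oo] --> f x} ->
  m.-integrable setT (EFin \o g) ->
  {ae m, forall x, forall n, `|f_ n x| <= g x} ->
  m.-integrable setT (EFin \o f) /\
  (\int[m]_x f_ n x @[n --> \oo] --> \int[m]_x f x)%R.
Proof.
move=> mf_ mf cf ig bf.
have [||||| i1 _ i3] := @dominated_convergence _ _ _ m setT measurableT
    (fun n => EFin \o f_ n) (EFin \o f) (EFin \o g).
- by move=> n; exact/measurable_EFinP.
- exact/measurable_EFinP.
- move: cf; apply: ae_mono => x cx _.
  by apply: (cvg_comp _ _ cx) => //; exact: cvg_EFin_nbhs.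
- exact: ig.
- by move: bf; apply: ae_mono => x bx n _; rewrite lee_fin.
split => //; apply: fine_cvg.
rewrite fineK; last exact: integrable_fin_num.
exact: i3.
Qed.

Lemma eq0_cpt_integrable (f : R -> R) M : measurable_fun [set: measurableTypeR R] f ->
  (forall x, M < `|x| -> f x = 0) ->
  leb.-integrable `[- M, M] (EFin \o f) -> leb.-integrable setT (EFin \o f).
Proof.
move=> mf f0 If.
rewrite (_ : f = f \_ `[- M, M]); last first.
  apply/funext => x; rewrite patchE; case: ifPn => // /negP.
  by rewrite inE/= in_itv/= -ler_norml => /negP; rewrite -ltNge; exact: f0.
by rewrite -restrict_EFin; apply/integrable_restrict => //; rewrite setTI.
Qed.

Lemma Rintegral_cpt (f : R -> R) M : (forall x, M < `|x| -> f x = 0) ->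
  \int[leb]_x f x = \int[leb]_(x in `[- M, M]) f x.
Proof.
move=> f0; rewrite [RHS]Rintegral_mkcond; apply: eq_Rintegral => x _.
rewrite patchE; case: ifPn => // /negP.
by rewrite inE/= in_itv/= -ler_norml => /negP; rewrite -ltNge; exact: f0.
Qed.

Lemma derive1_eq0_cpt F M x : (forall x, M < `|x| -> F x = 0) -> M < `|x| ->
  derive1 F x = 0.
Proof.
move=> F0 Mx; rewrite (@near_derive1 _ F (fun=> 0)) ?derive1_cst//.
have cn : (fun y : R => `|y|) @ x --> `|x| by apply: cvg_norm; exact: cvg_id.
near=> y; apply: F0; near: y; exact: cvgr_gt cn _ Mx.
Unshelve. all: by end_near. Qed.

Lemma integral_derive1_cpt F M : loc_ac_real F -> (forall x, M < `|x| -> F x = 0) ->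
  leb.-integrable setT (EFin \o derive1 F) /\ \int[leb]_x derive1 F x = 0.
Proof.
move=> acF F0; pose N := `|M| + 1.
have MN : M < N by rewrite (le_lt_trans (ler_norm _))// ltrDl.
have N0 : 0 < N by rewrite ltr_wpDl.
have F0' x : N < `|x| -> derive1 F x = 0.
  by move=> Nx; apply: (derive1_eq0_cpt F0); exact: lt_trans Nx.
have NN : - N <= N by rewrite ge0_cp// ltW.
have [i1 i2] := loc_ac_FTC acF NN.
have mF : measurable_fun [set: measurableTypeR R] (derive1 F).
  by apply: measurable_derive1; exact: loc_ac_continuous.
split; first exact: eq0_cpt_integrable F0' i1.
by rewrite (Rintegral_cpt F0') i2 !F0 ?subrr// ?normrN gtr0_norm.
Qed.

Definition test_fun F : Prop := smooth_real F /\ exists M, forall x, M < `|x| -> F x = 0.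

Lemma test_fun_ac F : test_fun F -> loc_ac_real F.
Proof.
move=> [sF _]; apply: loc_ac_C1; first exact: smooth_derivable.
move=> x; apply: differentiable_continuous; apply/derivable1_diffP.
exact: (smooth_derivable (smooth_derive1 sF)).
Qed.

Lemma smooth_continuous F : smooth_real F -> continuous F.
Proof.
move=> sF x; apply: differentiable_continuous; apply/derivable1_diffP.
exact: (smooth_derivable sF).
Qed.

Lemma continuous_loc_integrable F : continuous F -> loc_integrable F.
Proof.
move=> cF; split; first exact: continuous_measurable_fun.
move=> a b; apply: continuous_compact_integrable; first exact: segment_compact.
exact: continuous_subspaceT.
Qed.

Lemma loc_integrableM P F : loc_integrable P -> continuous F ->
  loc_integrable (fun x => P x * F x).
Proof.
move=> [mP iP] cF; have mF : measurable_fun [set: measurableTypeR R] F.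
  exact: continuous_measurable_fun.
split; first exact: measurable_funM.
move=> a b; have [K K0 HK] := continuous_bounded_itv a b cF.
have : leb.-integrable `[a, b] (EFin \o (fun x => K * `|P x|)).
  rewrite (_ : _ \o _ = fun x => (K%:E * (`|P x|%R)%:E)%E); last first.
    by apply/funext => x; rewrite /= EFinM.
  by apply: integrableZl => //; apply: (@integrable_norm _ _ _ leb); exact: iP.
apply: le_integrable => //.
  by apply/measurable_funTS/measurable_EFinP; exact: measurable_funM.
move=> x /=; rewrite in_itv/= => /andP[ax xb]; rewrite lee_fin normrM mulrC.
by rewrite (ger0_norm (mulr_ge0 (ltW K0) (normr_ge0 _))) ler_wpM2r// HK.
Qed.

Lemma loc_integrableD P Q : loc_integrable P -> loc_integrable Q ->
  loc_integrable (fun x => P x + Q x).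
Proof.
move=> [mP iP] [mQ iQ]; split; first exact: measurable_funD.
by move=> a b; apply: (integrableD _ (iP a b) (iQ a b)).
Qed.

Lemma loc_integrableN P : loc_integrable P -> loc_integrable (fun x => - P x).
Proof.
move=> [mP iP]; split; first exact: measurableT_comp.
by move=> a b; apply: (integrableN (iP a b)).
Qed.

Lemma loc_integrable_cpt P M : loc_integrable P -> (forall x, M < `|x| -> P x = 0) ->
  leb.-integrable setT (EFin \o P).
Proof. by move=> [mP iP] P0; apply: eq0_cpt_integrable mP P0 (iP _ _). Qed.

Lemma prim_continuous_derive F : continuous F ->
  forall x, is_derive x 1 (prim F) (F x).
Proof.
move=> cF x; have lF := continuous_loc_integrable cF.
have x1 : x < x + 1 by rewrite ltrDl.
have x2 : x - 1 < x by rewrite ltrBlDr ltrDl.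
have [d1 d2] := continuous_FTC1_closed x1 (lF.2 (x - 1) (x + 1)) x2 (cF x).
have nP : {near x, (fun y => prim F (x - 1) + \int[leb]_(t in `[x - 1, y]) F t) =1 prim F}.
  near=> y; rewrite -primB//; first by rewrite addrCA subrr addr0.
  by near: y; exact: lt_le_nbhsr.
have [e1 e2] := near_add_derive nP d1.
by have := derivable_is_derive e1; rewrite e2 d2.
Unshelve. all: by end_near. Qed.

(** Smooth functions with values in [0, 1] that vanish off ]a, b[ and tend pointwise to its
    indicator. *)
Definition bump (n : nat) a b x : R := eta 1 (n.+1%:R * (x - a)) * eta 1 (n.+1%:R * (b - x)).

Lemma smooth_bump n a b : smooth_real (bump n a b).
Proof.
rewrite (_ : bump n a b = fun x => eta 1 (n.+1%:R * x + - (n.+1%:R * a)) *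
    eta 1 (- n.+1%:R * x + n.+1%:R * b)).
  by apply: smoothM; apply: smooth_comp_affine; exact: smooth_eta.
apply/funext => x; rewrite /bump; congr (eta 1 _ * eta 1 _); first by rewrite mulrBr.
by rewrite mulrBr mulNr addrC.
Qed.

Lemma bump_out n a b x : ~~ (a < x < b) -> bump n a b x = 0.
Proof.
rewrite /bump negb_and -!leNgt => /orP[xa|bx].
  by rewrite [eta 1 (_ * (x - a))]eta1_le0 ?mul0r// pmulr_rle0// subr_le0.
by rewrite [eta 1 (_ * (b - x))]eta1_le0 ?mulr0// pmulr_rle0// subr_le0.
Qed.

Lemma bump_norm n a b x : `|bump n a b x| <= 1.
Proof.
rewrite ger0_norm ?mulr_ge0 ?eta1_ge0// /bump -[leRHS]mulr1.
by rewrite ler_pM ?eta1_ge0 ?eta1_le1.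
Qed.

Lemma bump_cvg a b x : bump n a b x @[n --> \oo] --> (\1_(`]a, b[%classic : set (measurableTypeR R)) x : R).
Proof.
rewrite indicE; have [xab|nxab] := boolP (x \in _).
  move: xab; rewrite inE/= in_itv/= => /andP[ax xb]; rewrite -[X in _ --> X](mulr1 1).
  by apply: cvgM; apply: eta1_cvg; rewrite subr_gt0.
rewrite (_ : (fun n => _) = fun=> 0); first exact: cvg_cst.
apply/funext => n; apply: bump_out.
by move: nxab; rewrite notin_setE/= in_itv/= => /negP.
Qed.

(* The derivative approximates the difference of the indicators of ]a, a + h[
   and ]b, b + h[. *)
Definition step_test (n : nat) h a b x : R := prim (bump n 0 h) (x - a) - prim (bump n 0 h) (x - b).

Lemma step_test_derive n h a b x : is_derive x 1 (step_test n h a b)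
  (bump n a (a + h) x - bump n b (b + h) x).
Proof.
have cb : continuous (bump n 0 h) by apply: smooth_continuous; exact: smooth_bump.
have tr c : is_derive x 1 (fun y => prim (bump n 0 h) (y - c)) (bump n c (c + h) x).
  have := is_derive_comp_affine (prim_continuous_derive cb (1 * x - c)).
  rewrite mulr1 mul1r (_ : bump n 0 h (x - c) = bump n c (c + h) x); last first.
    by rewrite /bump subr0 opprB addrA [h + c]addrC.
  by under eq_fun do rewrite mul1r.
exact: is_deriveB (tr a) (tr b).
Qed.

Lemma prim_bump_far n h x : 0 <= h -> h <= x -> prim (bump n 0 h) x = prim (bump n 0 h) h.
Proof.
move=> h0 hx; have cb : continuous (bump n 0 h) by apply: smooth_continuous; exact: smooth_bump.
apply/eqP; rewrite -subr_eq0 (primB (continuous_loc_integrable cb))//.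
apply/eqP; transitivity (\int[leb]_(t in `[h, x]) (0 : R)); last by rewrite Rintegral_cst ?mul0r.
apply: eq_Rintegral => t; rewrite inE/= in_itv/= => /andP[ht _].
by apply: bump_out; rewrite negb_and -!leNgt ht orbT.
Qed.

Lemma prim_bump_neg n h x : x <= 0 -> prim (bump n 0 h) x = prim (bump n 0 h) 0.
Proof.
move=> x0; have cb : continuous (bump n 0 h) by apply: smooth_continuous; exact: smooth_bump.
apply/esym/eqP; rewrite -subr_eq0 (primB (continuous_loc_integrable cb))//.
apply/eqP; transitivity (\int[leb]_(t in `[x, 0]) (0 : R)); last by rewrite Rintegral_cst ?mul0r.
apply: eq_Rintegral => t; rewrite inE/= in_itv/= => /andP[_ t0].
by apply: bump_out; rewrite negb_and -!leNgt t0.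
Qed.

(** Far to either side, both translates of the same primitive have reached a common constant, so
    their difference vanishes. *)
Lemma step_test_fun n h a b : 0 <= h -> test_fun (step_test n h a b).
Proof.
move=> h0; split.
  apply: smooth_antideriv (step_test_derive n h a b) _.
  have -> : (fun x => bump n a (a + h) x - bump n b (b + h) x) =
      fun x => bump n a (a + h) x + (-1) * bump n b (b + h) x.
    by apply/funext => x; rewrite mulN1r.
  by apply: smoothD; [|apply: smoothM; [exact: smooth_cst|]]; exact: smooth_bump.
exists (`|a| + `|b| + h) => x; rewrite lter_normr => /orP[] H.
  have ha : h <= x - a.
    by rewrite lerBrDr (le_trans _ (ltW H))// addrC lerD2r (le_trans (ler_norm _))// lerDl.
  have hb : h <= x - b.
    by rewrite lerBrDr (le_trans _ (ltW H))// addrC lerD2r (le_trans (ler_norm _))// lerDr.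
  by rewrite /step_test (prim_bump_far _ _ ha)// (prim_bump_far _ _ hb)// subrr.
have aa := ler_norm (- a); have bb := ler_norm (- b); rewrite !normrN in aa bb.
have a0 := normr_ge0 a; have b0 := normr_ge0 b.
have {H} H := ltW H.
rewrite /step_test (@prim_bump_neg _ _ (x - a)) ?(@prim_bump_neg _ _ (x - b)) ?subrr//; lra.
Qed.

(** The derivative of [step_test] tends boundedly to the difference of two window indicators, with
    supports in a fixed compact set. Dominated convergence then passes to the limit in the vanishing
    pairing. *)
Lemma integral_shift_eq Z : loc_integrable Z ->
  (forall psi, test_fun psi -> \int[leb]_x (Z x * derive1 psi x) = 0) ->
  forall a b h, 0 <= h ->
    \int[leb]_(x in `[a, a + h]) Z x = \int[leb]_(x in `[b, b + h]) Z x.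
Proof.
move=> lZ HZ a b h h0.
pose J c := `]c, c + h[%classic : set (measurableTypeR R).
pose f_ (n : nat) x := Z x * (bump n a (a + h) x - bump n b (b + h) x).
pose f x := Z x * (\1_(J a) x - \1_(J b) x).
pose M := `|a| + `|b| + h.
pose g x : R := (2 * `|Z x|) * \1_(`[- M, M]%classic : set (measurableTypeR R)) x.
have [mZ iZ] := lZ.
have mJ c : measurable (J c) by exact: measurable_itv.
have cb n c : continuous (bump n c (c + h)) by apply: smooth_continuous; exact: smooth_bump.
have JM c x : (c = a) \/ (c = b) -> c < x < c + h -> `|x| <= M.
  have aa := ler_norm a; have bb := ler_norm b.
  have a1 := ler_norm (- a); have b1 := ler_norm (- b); rewrite !normrN in a1 b1.
  have a0 := normr_ge0 a; have b0 := normr_ge0 b.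
  rewrite ler_norml /M => -[->|->] /andP[/ltW ? /ltW ?]; apply/andP; split; lra.
have iM : leb.-integrable setT (EFin \o g).
  have -> : g = (fun x => 2 * `|Z x|) \_ `[- M, M].
    apply/funext => x; rewrite patchE /g indicE.
    by case: (x \in _); rewrite ?mulr1 ?mulr0.
  rewrite -restrict_EFin; apply/integrable_restrict => //; rewrite setTI.
  rewrite (_ : _ \o _ = fun x => (2%:E * (`|Z x|%R)%:E)%E); last first.
    by apply/funext => x; rewrite /= EFinM.
  by apply: integrableZl => //; apply: (@integrable_norm _ _ _ leb); exact: iZ.
have [||||| _ fcvg] := @dominated_Rintegral leb f_ f g.
- move=> n; apply: measurable_funM => //; apply: measurable_funB;
    apply: continuous_measurable_fun; exact: cb.
- by apply: measurable_funM => //; apply: measurable_funB; exact: measurable_indic.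
- apply: aeW => x; apply: cvgM; first exact: cvg_cst.
  by apply: cvgB; exact: bump_cvg.
- exact: iM.
- apply: aeW => x n; rewrite /f_ /g indicE normrM [2 * _]mulrC -mulrA ler_wpM2l//.
  have [xM|xM] := boolP (x \in _).
    rewrite mulr1 (le_trans (ler_normB _ _))//.
    by rewrite (_ : (2 : R) = 1 + 1)// lerD// bump_norm.
  have nM : ~~ (`|x| <= M).
    by move: xM; rewrite notin_setE/= in_itv/= -ler_norml => /negP.
  rewrite mulr0 !bump_out ?subrr ?normr0//.
    by apply: contra nM => /JM; apply; right.
  by apply: contra nM => /JM; apply; left.
have f0 : \int[leb]_x f x = 0.
  apply/esym/(cvg_unique _ _ fcvg); first exact: Rhausdorff.
  rewrite (_ : (fun n => _) = fun=> 0); first exact: cvg_cst.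
  apply/funext => n; rewrite -(HZ _ (step_test_fun n a b h0)).
  apply: eq_Rintegral => x _; rewrite /f_.
  by have [_ ->] := is_derive_derive1 (step_test_derive n h a b x).
have iJ c : leb.-integrable (J c) (EFin \o Z).
  by apply: integrableS (iZ c (c + h)) => //; apply: subset_itv; rewrite bnd_simp.
have rJ c : \int[leb]_(x in `[c, c + h]) Z x = \int[leb]_x (Z x * \1_(J c) x).
  rewrite -Rintegral_itv_obnd_cbnd; last first.
    by apply: integrableS (iZ c (c + h)) => //; apply: subset_itvr; rewrite bnd_simp.
  rewrite -Rintegral_itv_bndo_bndc; last exact: iJ.
  rewrite Rintegral_mkcond; apply: eq_Rintegral => x _.
  by rewrite patchE indicE; case: (x \in _); rewrite ?mulr1 ?mulr0.
have iZJ c : leb.-integrable setT (EFin \o (fun x => Z x * \1_(J c) x)).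
  have -> : (fun x => Z x * \1_(J c) x) = Z \_ (J c).
    by apply/funext => x; rewrite patchE indicE; case: (x \in _); rewrite ?mulr1 ?mulr0.
  by rewrite -restrict_EFin; apply/integrable_restrict => //; rewrite setTI; exact: iJ.
apply/eqP; rewrite -subr_eq0 !rJ -RintegralB// -f0; apply/eqP.
by apply: eq_Rintegral => x _; rewrite /f mulrBr.
Qed.

Lemma ae_exists (Pr : R -> Prop) : {ae leb, forall x, Pr x} -> exists x, Pr x.
Proof.
move=> [A [mA A0 nA]]; apply: contrapT => nP.
have : leb A = +oo%E.
  have -> : A = [set` `]-oo, +oo[%R].
    by rewrite set_itvNyy; apply/seteqP; split => // x _; apply: nA => Px; apply: nP; exists x.
  by rewrite lebesgue_measure_itv.
by rewrite A0.
Qed.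

Lemma derive_zero_const Z : loc_integrable Z ->
  (forall psi, test_fun psi -> \int[leb]_x (Z x * derive1 psi x) = 0) ->
  exists c, {ae leb, forall x, Z x = c}.
Proof.
move=> lZ HZ; have sh := integral_shift_eq lZ HZ.
have [a [da Za]] := ae_exists (prim_derive lZ).
exists (Z a); move: (prim_derive lZ); apply: ae_mono => b [db Zb].
have q c : derivable (prim Z) c 1 ->
   (fun h => h^-1 * (prim Z (h + c) - prim Z c)) @ 0^'+ --> derive1 (prim Z) c.
  move=> dc; apply: cvg_dnbhs_at_right; exact: (derivable_quotient _ _).1.
rewrite -Za -Zb; apply: (@cvg_unique _ _ _ _ _ _ (q b db)); first exact: Rhausdorff.
apply: cvg_trans (q a da); apply: near_eq_cvg; near=> h.
have h0 : 0 <= h by apply: ltW; near: h; exact: nbhs_right_gt.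
rewrite ![h + _]addrC !(primB lZ) ?lerDl//; congr (_ * _); exact: sh.
Unshelve. all: by end_near. Qed.

Lemma loc_integrable_ac F : loc_ac_real F -> loc_integrable (derive1 F).
Proof.
move=> acF; split; first by apply: measurable_derive1; exact: loc_ac_continuous.
move=> a b; have [ab|ba] := leP a b; first by have [] := loc_ac_FTC acF ab.
by rewrite set_itv_ge ?bnd_simp -?ltNge//; exact: integrable_set0.
Qed.

Lemma integral_by_parts_cpt F G M : loc_ac_real F -> loc_ac_real G ->
  (forall x, M < `|x| -> G x = 0) ->
  [/\ leb.-integrable setT (EFin \o (fun x => derive1 F x * G x)),
      leb.-integrable setT (EFin \o (fun x => F x * derive1 G x)) &
      \int[leb]_x (F x * derive1 G x) = - \int[leb]_x (derive1 F x * G x)].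
Proof.
move=> acF acG G0.
have cF := loc_ac_continuous acF; have cG := loc_ac_continuous acG.
have i1 : leb.-integrable setT (EFin \o (fun x => derive1 F x * G x)).
  apply: (@loc_integrable_cpt _ M); first exact: loc_integrableM (loc_integrable_ac acF) cG.
  by move=> x /G0 ->; rewrite mulr0.
have i2 : leb.-integrable setT (EFin \o (fun x => F x * derive1 G x)).
  under eq_fun do rewrite mulrC.
  apply: (@loc_integrable_cpt _ M); first exact: loc_integrableM (loc_integrable_ac acG) cF.
  by move=> x /(derive1_eq0_cpt G0) ->; rewrite mul0r.
split => //; apply/eqP; rewrite -addr_eq0 addrC -RintegralD//.
have FG0 x : M < `|x| -> (F \* G) x = 0 by move=> /G0 /= ->; rewrite mulr0.
have [_ <-] := integral_derive1_cpt (loc_acM acF acG) FG0.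
apply/eqP; congr fine; apply: ae_eq_integral => //.
- by have /integrableP[] := integrableD measurableT i1 i2.
- have /integrableP[] := (integral_derive1_cpt (loc_acM acF acG) FG0).1; exact.
- move: (ae_and (loc_ac_derivable acF) (loc_ac_derivable acG)).
  by apply: ae_mono => x [dF dG] _ /=; rewrite derive1_mul.
Qed.

(** Integration by parts turns the P term into a pairing of [prim P] with psi', so that Q - [prim P]
    has vanishing weak derivative. *)
Lemma du_Bois_Reymond P Q : loc_integrable P -> loc_integrable Q ->
  (forall psi, test_fun psi ->
     \int[leb]_x (P x * psi x) + \int[leb]_x (Q x * derive1 psi x) = 0) ->
  exists c, {ae leb, forall x, Q x = c + prim P x}.
Proof.
move=> lP lQ H; have acP := prim_loc_ac lP.
have lp := continuous_loc_integrable (loc_ac_continuous acP).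
have [|psi tpsi|c hc] := @derive_zero_const (fun x => Q x + - prim P x).
- exact: loc_integrableD lQ (loc_integrableN lp).
- have [M psi0] := tpsi.2; have acpsi := test_fun_ac tpsi.
  have [i1 i2 ibp] := integral_by_parts_cpt acP acpsi psi0.
  have iQ : leb.-integrable setT (EFin \o (fun x => Q x * derive1 psi x)).
    apply: (@loc_integrable_cpt _ M).
      by apply: loc_integrableM lQ _; apply: smooth_continuous; exact: smooth_derive1 tpsi.1.
    by move=> x /(derive1_eq0_cpt psi0) ->; rewrite mulr0.
  under eq_Rintegral do rewrite mulrDl mulNr.
  rewrite RintegralB// ibp opprK addrC -(H _ tpsi); congr (_ + _).
  congr fine; apply: ae_eq_integral => //.
  + by have /integrableP[] := i1.
  + apply/measurable_EFinP/measurable_funM; first exact: lP.1.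
    by apply: continuous_measurable_fun; exact: loc_ac_continuous.
  + by move: (prim_derive lP); apply: ae_mono => x [_ e] _ /=; rewrite e.
by exists c; move: hc; apply: ae_mono => x <-; rewrite subrK.
Qed.

End DuBoisReymond.

(** * Unbounded operators in real Hilbert spaces *)

Section RealHilbert.
Context {R : realType}.

(** The axioms are a predicate on the form, so that one theory serves L^2, its square and products
    of products, where graphs live. Completeness is stated with squared distances, which are
    integrals in the intended model. *)
Record hilbert_axioms (H : lmodType R) (ip : H -> H -> R) : Prop := HilbertAxioms {
  hilbC : forall x y, ip x y = ip y x;
  hilbDl : forall x y z, ip (x + y) z = ip x z + ip y z;
  hilbZl : forall a x y, ip (a *: x) y = a * ip x y;
  hilb_ge0 : forall x, 0 <= ip x x;
  hilb_eq0 : forall x, ip x x = 0 -> x = 0;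
  hilb_complete : forall u : nat -> H,
    (forall e, 0 < e -> exists N, forall m n, (N <= m)%N -> (N <= n)%N ->
      ip (u m - u n) (u m - u n) < e) ->
    exists l, forall e, 0 < e -> exists N, forall n, (N <= n)%N ->
      ip (u n - l) (u n - l) < e }.

Section InnerProduct.
Variables (H : lmodType R) (ip : H -> H -> R) (hax : hilbert_axioms ip).
Implicit Types (x y z : H) (K : set H).

Lemma hilbDr x y z : ip x (y + z) = ip x y + ip x z.
Proof. by rewrite (hilbC hax) (hilbDl hax) !(hilbC hax x). Qed.

Lemma hilbZr a x y : ip x (a *: y) = a * ip x y.
Proof. by rewrite (hilbC hax) (hilbZl hax) (hilbC hax x). Qed.

Lemma hilbNl x y : ip (- x) y = - ip x y.
Proof. by rewrite -scaleN1r (hilbZl hax) mulN1r. Qed.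

Lemma hilbNr x y : ip x (- y) = - ip x y.
Proof. by rewrite (hilbC hax) hilbNl (hilbC hax). Qed.

Lemma hilbBl x y z : ip (x - y) z = ip x z - ip y z.
Proof. by rewrite (hilbDl hax) hilbNl. Qed.

Lemma hilbBr x y z : ip x (y - z) = ip x y - ip x z.
Proof. by rewrite hilbDr hilbNr. Qed.

Lemma hilb0l x : ip 0 x = 0.
Proof. by rewrite -(scale0r 0) (hilbZl hax) mul0r. Qed.

Lemma hilb0r x : ip x 0 = 0.
Proof. by rewrite (hilbC hax) hilb0l. Qed.

Lemma hilb_nondeg x : (forall y, ip x y = 0) -> x = 0.
Proof. by move=> /(_ x)/(hilb_eq0 hax). Qed.

Lemma hilb_CS x y : ip x y ^+ 2 <= ip x x * ip y y.
Proof.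
have [/(hilb_eq0 hax)->|y0] := eqVneq (ip y y) 0.
  by rewrite !hilb0r mulr0 expr0n.
have yp : 0 < ip y y by rewrite lt_def y0 (hilb_ge0 hax).
have := hilb_ge0 hax (ip y y *: x - ip x y *: y).
rewrite hilbBl !hilbBr !(hilbZl hax) !hilbZr (hilbC hax y x) => h.
have : 0 <= ip y y * (ip x x * ip y y - ip x y ^+ 2) by nra.
by rewrite pmulr_rge0// subr_ge0.
Qed.

Definition hnorm x : R := Num.sqrt (ip x x).

Lemma hnorm_ge0 x : 0 <= hnorm x. Proof. exact: sqrtr_ge0. Qed.

Lemma hnorm_sqr x : hnorm x ^+ 2 = ip x x.
Proof. by rewrite sqr_sqrtr// (hilb_ge0 hax). Qed.

Lemma hnorm0 : hnorm 0 = 0. Proof. by rewrite /hnorm hilb0l sqrtr0. Qed.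

Lemma hnorm_eq0 x : hnorm x = 0 -> x = 0.
Proof. by move=> x0; apply: (hilb_eq0 hax); rewrite -hnorm_sqr x0 expr0n. Qed.

Lemma hnormN x : hnorm (- x) = hnorm x.
Proof. by rewrite /hnorm hilbNl hilbNr opprK. Qed.

Lemma hnormBC x y : hnorm (x - y) = hnorm (y - x).
Proof. by rewrite -hnormN opprB. Qed.

Lemma hnormZ a x : hnorm (a *: x) = `|a| * hnorm x.
Proof. by rewrite /hnorm (hilbZl hax) hilbZr mulrA -expr2 sqrtrM ?sqr_ge0// sqrtr_sqr. Qed.

Lemma hnorm_CS x y : `|ip x y| <= hnorm x * hnorm y.
Proof.
rewrite -(@ler_pXn2r _ 2)// ?nnegrE ?mulr_ge0 ?hnorm_ge0//.
by rewrite exprMn !hnorm_sqr real_normK ?num_real// hilb_CS.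
Qed.

Lemma hnormD x y : hnorm (x + y) <= hnorm x + hnorm y.
Proof.
rewrite -(@ler_pXn2r _ 2)// ?nnegrE ?addr_ge0 ?hnorm_ge0//.
rewrite hnorm_sqr (hilbDl hax) !hilbDr (hilbC hax y x).
have := le_trans (ler_norm _) (hnorm_CS x y).
have := hnorm_sqr x; have := hnorm_sqr y; nra.
Qed.

Lemma hnormB_triangle z x y : hnorm (x - y) <= hnorm (x - z) + hnorm (z - y).
Proof. by rewrite -[X in hnorm X](subrKA z) hnormD. Qed.

Lemma hnorm_lt e x : 0 < e -> (ip x x < e ^+ 2) = (hnorm x < e).
Proof.
by move=> e0; rewrite -hnorm_sqr ltr_pXn2r// ?nnegrE ?hnorm_ge0// ltW.
Qed.

Lemma hnorm_sub_eq0 x y : (forall e, 0 < e -> hnorm (x - y) < e) -> x = y.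
Proof.
move=> h; apply/eqP; rewrite -subr_eq0; apply/eqP/hnorm_eq0/eqP.
rewrite eq_le hnorm_ge0 andbT; apply/ler_addgt0Pr => e e0; rewrite add0r ltW//.
exact: h.
Qed.

Definition hcvg (u : nat -> H) (l : H) : Prop :=
  forall e, 0 < e -> exists N, forall n, (N <= n)%N -> hnorm (u n - l) < e.

Definition hcauchy (u : nat -> H) : Prop :=
  forall e, 0 < e -> exists N, forall m n, (N <= m)%N -> (N <= n)%N ->
    hnorm (u m - u n) < e.

Lemma hcauchy_cvg u : hcauchy u -> exists l, hcvg u l.
Proof.
move=> cu; have [e e0|l hl] := @hilb_complete _ _ hax u.
  have se0 : 0 < Num.sqrt e by rewrite sqrtr_gt0.
  have [N hN] := cu _ se0.
  by exists N => m n Nm Nn; have := hN m n Nm Nn; rewrite -hnorm_lt ?sqrtr_gt0// sqr_sqrtr// ltW.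
exists l => e e0; have [N hN] := hl (e ^+ 2) (exprn_gt0 _ e0).
by exists N => n Nn; rewrite -hnorm_lt// hN.
Qed.

Lemma hcvg_cauchy u l : hcvg u l -> hcauchy u.
Proof.
move=> ul e e0; have [N hN] := ul (e / 2) (divr_gt0 e0 (ltr0Sn _ 1)).
exists N => m n Nm Nn; apply: le_lt_trans (hnormB_triangle l _ _) _.
by rewrite (splitr e) ltrD ?hN// hnormBC hN.
Qed.

Lemma hcvg_unique u l l' : hcvg u l -> hcvg u l' -> l = l'.
Proof.
move=> ul ul'; apply: hnorm_sub_eq0 => e e0.
have [N hN] := ul (e / 2) (divr_gt0 e0 (ltr0Sn _ 1)).
have [M hM] := ul' (e / 2) (divr_gt0 e0 (ltr0Sn _ 1)).
apply: le_lt_trans (hnormB_triangle (u (maxn N M)) _ _) _.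
by rewrite (splitr e) ltrD// 1?hnormBC ?hN ?hM ?leq_maxl ?leq_maxr// hnormBC hM ?leq_maxr.
Qed.

Lemma hcvgD u v l k : hcvg u l -> hcvg v k -> hcvg (fun n => u n + v n) (l + k).
Proof.
move=> ul vk e e0.
have [N hN] := ul (e / 2) (divr_gt0 e0 (ltr0Sn _ 1)).
have [M hM] := vk (e / 2) (divr_gt0 e0 (ltr0Sn _ 1)).
exists (maxn N M) => n; rewrite geq_max => /andP[Nn Mn].
rewrite opprD addrACA (splitr e); apply: le_lt_trans (hnormD _ _) _.
by rewrite ltrD ?hN ?hM.
Qed.

Lemma hcvgZ a u l : hcvg u l -> hcvg (fun n => a *: u n) (a *: l).
Proof.
move=> ul e e0; have a1 : 0 < `|a| + 1 by rewrite ltr_wpDl.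
have [N hN] := ul (e / (`|a| + 1)) (divr_gt0 e0 a1).
exists N => n Nn; rewrite -scalerBr hnormZ.
have := hN n Nn; rewrite ltr_pdivlMr//; apply: le_lt_trans.
by rewrite mulrC ler_wpM2l ?hnorm_ge0// lerDl.
Qed.

Lemma hcvg_cst l : hcvg (fun=> l) l.
Proof. by move=> e e0; exists 0%N => n _; rewrite subrr hnorm0. Qed.

Definition lin_subspace K : Prop :=
  [/\ K 0, forall x y, K x -> K y -> K (x + y) & forall a x, K x -> K (a *: x)].

Definition seq_closed K : Prop :=
  forall u l, (forall n, K (u n)) -> hcvg u l -> K l.

Definition hclosure K : set H := [set l | exists2 u, (forall n, K (u n)) & hcvg u l].

Lemma sub_hclosure K : K `<=` hclosure K.
Proof. by move=> x Kx; exists (fun=> x) => //; exact: hcvg_cst. Qed.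

Lemma hclosureP K x : hclosure K x <->
  forall e, 0 < e -> exists2 y, K y & hnorm (y - x) < e.
Proof.
split=> [[u Ku ux] e e0|h].
  by have [N hN] := ux e e0; exists (u N) => //; exact: hN.
have ex n : {y | K y & hnorm (y - x) < n.+1%:R^-1}.
  by apply/cid2; apply: h; rewrite invr_gt0.
exists (fun n => s2val (ex n)) => [n|e e0]; first exact: s2valP (ex n).
exists (Num.bound e^-1) => n Nn; apply: lt_trans (s2valP' (ex n)) _.
rewrite invf_plt ?posrE// (lt_trans (archi_boundP _)) ?invr_ge0 1?ltW//.
by rewrite ltr_nat ltnS.
Qed.

Lemma hclosure_closed K : seq_closed (hclosure K).
Proof.
move=> u l Ku ul; apply/hclosureP => e e0.
have [N hN] := ul (e / 2) (divr_gt0 e0 (ltr0Sn _ 1)).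
have /hclosureP/(_ (e / 2) (divr_gt0 e0 (ltr0Sn _ 1)))[y Ky yu] := Ku N.
exists y => //; apply: le_lt_trans (hnormB_triangle (u N) _ _) _.
by rewrite (splitr e) ltrD// hN.
Qed.

Lemma hclosure_subspace K : lin_subspace K -> lin_subspace (hclosure K).
Proof.
move=> [K0 KD KZ]; split.
- exact: sub_hclosure.
- move=> x y [u Ku ux] [v Kv vy]; exists (fun n => u n + v n).
    by move=> n; exact: KD.
  exact: hcvgD.
- by move=> a x [u Ku ux]; exists (fun n => a *: u n);
    [move=> n; exact: KZ|exact: hcvgZ].
Qed.

(** At t = b / (a + 1), where a + 1 excludes division by 0, the quadratic equals -(b / (a + 1))^2 (a
    + 2). *)
Lemma quad_ge0_eq0 (a b : R) : 0 <= a -> (forall t, 0 <= t ^+ 2 * a - t * b *+ 2) -> b = 0.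
Proof.
move=> a0 h; apply/eqP/negPn/negP => b0.
have a1 : 0 < a + 1 by rewrite ltr_wpDl.
have := h (b / (a + 1)).
rewrite (_ : _ - _ = - (b / (a + 1)) ^+ 2 * (a + 2)); last by field; lra.
rewrite mulNr oppr_ge0 leNgt mulr_gt0//; last by lra.
by rewrite exprn_even_gt0//= mulf_neq0// invr_eq0 gt_eqF.
Qed.

(* Parallelogram law: a minimising sequence for the distance to K is Cauchy. *)
Lemma hilbert_projection K : lin_subspace K -> seq_closed K ->
  forall v, exists2 k, K k & forall z, K z -> ip (v - k) z = 0.
Proof.
move=> [K0 KD KZ] Kcl v; pose S := [set ip (v - k) (v - k) | k in K].
have S0 : S !=set0 by exists (ip (v - 0) (v - 0)), 0.
have lS : has_lbound S by exists 0 => _ [k _ <-]; exact: (hilb_ge0 hax).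
pose d := inf S.
have dle k : K k -> d <= ip (v - k) (v - k) by move=> Kk; apply: ge_inf => //; exists k.
have ex n : {k | K k & ip (v - k) (v - k) < d + n.+1%:R^-1}.
  apply/cid2; have [] := @inf_adherent _ S n.+1%:R^-1 _ (conj S0 lS).
    by rewrite invr_gt0.
  by move=> _ [k Kk <-] h; exists k.
pose k n := s2val (ex n).
have Kk n : K (k n) by exact: s2valP (ex n).
have dk n : ip (v - k n) (v - k n) < d + n.+1%:R^-1 by exact: s2valP' (ex n).
have par m n : ip (k m - k n) (k m - k n) <= m.+1%:R^-1 *+ 2 + n.+1%:R^-1 *+ 2.
  have := dle (2^-1 *: (k m + k n)) (KZ _ _ (KD _ _ (Kk m) (Kk n))).
  rewrite (_ : v - _ = 2^-1 *: ((v - k m) + (v - k n))); last first.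
    rewrite addrACA -opprD scalerBr; congr (_ - _).
    by rewrite -[v + v]mulr2n -[v *+ 2]scaler_nat scalerA mulVf ?pnatr_eq0// scale1r.
  rewrite (_ : k m - k n = (v - k n) - (v - k m)); last first.
    by rewrite opprB [RHS]addrC subrKA.
  have := dk m; have := dk n; move: (v - k m) (v - k n) => x y.
  rewrite (hilbZl hax) hilbZr !(hilbDl hax) !hilbDr !hilbNl !hilbNr (hilbC hax y x).
  have aux (X Y Z s t c : R) : Y < c + t -> X < c + s ->
      c <= 2^-1 * (2^-1 * (X + Z + (Z + Y))) ->
      Y - Z + (- Z - - X) <= s *+ 2 + t *+ 2 by rewrite !mulr2n !ler_pdivlMl// => *; lra.
  exact: aux.
have ck : hcauchy k.
  move=> e e0; pose N := Num.bound ((e ^+ 2 / 4)^-1).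
  have e40 : 0 < e ^+ 2 / 4 by rewrite divr_gt0// exprn_gt0.
  have small m : (N <= m)%N -> m.+1%:R^-1 < e ^+ 2 / 4.
    move=> Nm; rewrite invf_plt ?posrE// (lt_trans (archi_boundP _)) ?invr_ge0 1?ltW//.
    by rewrite ltr_nat ltnS.
  exists N => m n /small hm /small hn; rewrite -hnorm_lt//.
  apply: le_lt_trans (par m n) _.
  by move: (m.+1%:R^-1) (n.+1%:R^-1) hm hn => s t hs ht; rewrite !mulr2n; lra.
have [l kl] := hcauchy_cvg ck; have Kl := Kcl _ _ Kk kl; exists l => //.
have dl : ip (v - l) (v - l) <= d.
  have d0 : 0 <= d by apply: lb_le_inf => // _ [x _ <-]; exact: (hilb_ge0 hax).
  rewrite -hnorm_sqr -[leRHS]sqr_sqrtr// ler_pXn2r// ?nnegrE ?hnorm_ge0 ?sqrtr_ge0//.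
  apply/ler_addgt0Pr => e e0; have [N hN] := kl (e / 2) (divr_gt0 e0 (ltr0Sn _ 1)).
  pose M := Num.bound ((e / 2) ^+ 2)^-1.
  have e20 : 0 < (e / 2) ^+ 2 by rewrite exprn_gt0// divr_gt0.
  pose n := maxn N M.
  have kn : hnorm (v - k n) <= Num.sqrt d + e / 2.
    rewrite -(@ler_pXn2r _ 2)// ?nnegrE ?hnorm_ge0 ?addr_ge0 ?sqrtr_ge0 ?divr_ge0 ?(ltW e0)//.
    rewrite hnorm_sqr sqrrD sqr_sqrtr//; apply: le_trans (ltW (dk n)) _.
    rewrite -addrA lerD2l; apply: ler_wpDl.
      by rewrite mulrn_wge0// mulr_ge0 ?sqrtr_ge0// divr_ge0// ltW.
    rewrite invf_ple ?posrE// (le_trans (ltW (archi_boundP _))) ?invr_ge0 1?ltW//.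
    by rewrite ltr_nat ltnS leq_maxr.
  apply: le_trans (hnormB_triangle (k n) _ _) _.
  by rewrite (splitr e) addrA lerD// ltW// hN// leq_maxl.
move=> z Kz; apply: (@quad_ge0_eq0 (ip z z)); first exact: (hilb_ge0 hax).
(* Minimality of l against l + t z for every real t leaves a quadratic in t whose linear coefficient
   must vanish. *)
move=> t; have := le_trans dl (dle (l + t *: z) (KD _ _ Kl (KZ t z Kz))).
rewrite opprD addrA; move: (v - l) => w.
rewrite hilbBl !hilbBr !(hilbZl hax) !hilbZr (hilbC hax z w).
move: (ip w w) (ip w z) (ip z z) => X Y Z; rewrite mulr2n expr2; lra.
Qed.

Definition lin_op (T : H -> H) : Prop :=
  (forall x y, T (x + y) = T x + T y) /\ (forall a x, T (a *: x) = a *: T x).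

Definition sym_op (T : H -> H) : Prop := forall x y, ip (T x) y = ip x (T y).

Definition bounded_op (c : R) (T : H -> H) : Prop :=
  forall x, hnorm (T x) <= c * hnorm x.

Lemma lin_opB T x y : lin_op T -> T (x - y) = T x - T y.
Proof. by move=> [TD TZ]; rewrite TD -scaleN1r TZ scaleN1r. Qed.

Lemma bounded_cvg T c u l : lin_op T -> bounded_op c T -> hcvg u l ->
  hcvg (T \o u) (T l).
Proof.
move=> lT bT ul e e0; have c1 : 0 < `|c| + 1 by rewrite ltr_wpDl.
have [N hN] := ul (e / (`|c| + 1)) (divr_gt0 e0 c1).
exists N => n /hN; rewrite /= -lin_opB// ltr_pdivlMr// mulrC; apply: le_lt_trans.
apply: le_trans (bT _) _; rewrite ler_wpM2r ?hnorm_ge0// (le_trans (ler_norm _))//.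
by rewrite lerDl.
Qed.

(** * Square root of a symmetric contraction by iteration *)

Section SquareRoot.
Variable A : H -> H.
Hypotheses (linA : lin_op A) (symA : sym_op A) (ctrA : bounded_op 1 A).

(* Polynomials in A with nonnegative coefficients, indexed by an upper bound of
   the sum of the coefficients, hence of the operator norm. *)
Inductive pos_poly : R -> (H -> H) -> Prop :=
| pos_poly0 : pos_poly 0 (fun=> 0)
| pos_polyA : pos_poly 1 A
| pos_polyD c d T U : pos_poly c T -> pos_poly d U ->
    pos_poly (c + d) (fun x => T x + U x)
| pos_polyZ a c T : 0 <= a -> pos_poly c T -> pos_poly (a * c) (fun x => a *: T x)
| pos_polyM c d T U : pos_poly c T -> pos_poly d U -> pos_poly (c * d) (T \o U).

Lemma pos_poly_ge0 c T : pos_poly c T -> 0 <= c.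
Proof. by elim=> // *; rewrite ?addr_ge0 ?mulr_ge0. Qed.

Lemma pos_poly_lin c T : pos_poly c T -> lin_op T.
Proof.
elim=> {c T} [||c d T U _ [TD TZ] _ [UD UZ]|a c T _ _ [TD TZ]|c d T U _ [TD TZ] _ [UD UZ]] //.
- by split=> *; rewrite ?addr0 ?scaler0.
- by split=> *; rewrite ?TD ?UD ?TZ ?UZ ?scalerDr// addrACA.
- by split=> *; rewrite ?TD ?scalerDr// TZ !scalerA mulrC.
- by split=> * /=; rewrite ?UD ?TD ?UZ ?TZ.
Qed.

Lemma pos_poly_comm c T (J : H -> H) : lin_op J -> (forall x, J (A x) = A (J x)) ->
  pos_poly c T -> forall x, J (T x) = T (J x).
Proof.
move=> lJ cJ; elim=> {c T} [||c d T U _ hT _ hU|a c T _ _ hT|c d T U _ hT _ hU] // x.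
- by rewrite -(scale0r 0) lJ.2 !scale0r.
- by rewrite lJ.1 hT hU.
- by rewrite lJ.2 hT.
- by rewrite /= hT hU.
Qed.

Lemma pos_poly_commute c d T U : pos_poly c T -> pos_poly d U ->
  forall x, T (U x) = U (T x).
Proof.
move=> pT pU; apply: (pos_poly_comm (pos_poly_lin pT) _ pU) => x.
by rewrite (pos_poly_comm linA _ pT).
Qed.

Lemma pos_poly_sym c T : pos_poly c T -> sym_op T.
Proof.
elim=> {c T} [||c d T U _ hT _ hU|a c T _ _ hT|c d T U pT hT pU hU] // x y.
- by rewrite hilb0l ?hilb0r.
- by rewrite (hilbDl hax) hilbDr hT hU.
- by rewrite (hilbZl hax) hilbZr hT.
- by rewrite /= hT hU (pos_poly_commute pU pT).
Qed.

Lemma pos_poly_bounded c T : pos_poly c T -> bounded_op c T.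
Proof.
elim=> {c T} [||c d T U _ hT _ hU|a c T a0 _ hT|c d T U pT hT pU hU] // x.
- by rewrite hnorm0 mul0r.
- by rewrite mulrDl (le_trans (hnormD _ _))// lerD.
- by rewrite hnormZ ger0_norm// -mulrA ler_wpM2l.
- by rewrite /= -mulrA (le_trans (hT _))// ler_wpM2l// (pos_poly_ge0 pT).
Qed.

(** The iteration Y := (A + Y^2) / 2; a fixed point satisfies (1 - Y)^2 = 1 - A. *)
Fixpoint sqrt_iter (n : nat) : H -> H :=
  if n is m.+1 then fun x => 2^-1 *: (A x + sqrt_iter m (sqrt_iter m x)) else fun=> 0.

(** The same iteration for the scalar A = 1. It bounds the norm of [sqrt_iter n], increases with n
    and never exceeds 1. *)
Fixpoint sqrt_mass (n : nat) : R :=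
  if n is m.+1 then 2^-1 * (1 + sqrt_mass m * sqrt_mass m) else 0.

Lemma sqrt_iter_pos n : pos_poly (sqrt_mass n) (sqrt_iter n).
Proof.
elim: n => [|n ih] /=; first exact: pos_poly0.
apply: pos_polyZ; first by rewrite invr_ge0.
by apply: pos_polyD; [exact: pos_polyA|exact: pos_polyM].
Qed.

Lemma sqrt_mass_le1 n : sqrt_mass n <= 1.
Proof.
elim: n => [|n ih] //=; have := pos_poly_ge0 (sqrt_iter_pos n).
move: (sqrt_mass n) ih => c *; nra.
Qed.

(** Polynomials in A commute, so the next increment is half of (Y_(n+1) - Y_n)(Y_(n+1) + Y_n).
    Nonnegativity of the coefficients is inherited, and the norm of an operator increment is at most
    the scalar one. *)
Lemma sqrt_iter_step n : pos_poly (sqrt_mass n.+1 - sqrt_mass n)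
  (fun x => sqrt_iter n.+1 x - sqrt_iter n x).
Proof.
elim: n => [|n ih].
  rewrite /= subr0 (_ : (fun x => _) = fun x => 2^-1 *: (A x + 0)).
    apply: pos_polyZ; first by rewrite invr_ge0.
    by apply: pos_polyD; [exact: pos_polyA|rewrite mulr0; exact: pos_poly0].
  by apply/funext => x; rewrite subr0.
have pn := sqrt_iter_pos n; have pn1 := sqrt_iter_pos n.+1.
rewrite (_ : (fun x => _) = fun x => 2^-1 *:
    ((fun x => sqrt_iter n.+1 x - sqrt_iter n x) \o
     (fun x => sqrt_iter n.+1 x + sqrt_iter n x)) x).
  rewrite (_ : _ - _ = 2^-1 * ((sqrt_mass n.+1 - sqrt_mass n) * (sqrt_mass n.+1 + sqrt_mass n))).
    apply: pos_polyZ; first by rewrite invr_ge0.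
    by apply: pos_polyM => //; exact: pos_polyD.
  have e1 : sqrt_mass n.+1 = 2^-1 * (1 + sqrt_mass n * sqrt_mass n) by [].
  have e2 : sqrt_mass n.+2 = 2^-1 * (1 + sqrt_mass n.+1 * sqrt_mass n.+1) by [].
  by rewrite e2 e1; field.
apply/funext => x.
have E2 : sqrt_iter n.+2 x = 2^-1 *: (A x + sqrt_iter n.+1 (sqrt_iter n.+1 x)) by [].
have E1 : sqrt_iter n.+1 x = 2^-1 *: (A x + sqrt_iter n (sqrt_iter n x)) by [].
transitivity (2^-1 *: (sqrt_iter n.+1 (sqrt_iter n.+1 x) - sqrt_iter n (sqrt_iter n x))).
  by rewrite E2 [X in _ - X]E1 -scalerBr opprD addrACA subrr add0r.
have [l1 _] := pos_poly_lin pn1; have [l0 _] := pos_poly_lin pn.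
have cm := pos_poly_commute pn1 pn; congr (_ *: _); rewrite /comp.
move: (sqrt_iter n.+1) (sqrt_iter n) l1 l0 cm => T1 T0 l1 l0 cm.
by rewrite l1 l0 cm opprD addrA addrK.
Qed.

Lemma sqrt_iter_dist n k x : hnorm (sqrt_iter (n + k) x - sqrt_iter n x) <=
  (sqrt_mass (n + k) - sqrt_mass n) * hnorm x.
Proof.
elim: k => [|k ih]; first by rewrite addn0 !subrr hnorm0 mul0r.
rewrite addnS; apply: le_trans (hnormB_triangle (sqrt_iter (n + k) x) _ _) _.
rewrite -[sqrt_mass (n + k).+1 - _](subrKA (sqrt_mass (n + k))) mulrDl lerD//.
exact: (pos_poly_bounded (sqrt_iter_step (n + k))).
Qed.

Lemma sqrt_mass_cauchy e : 0 < e -> exists N, forall n, (N <= n)%N ->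
  sqrt_mass n - sqrt_mass N < e.
Proof.
move=> e0; pose S := range sqrt_mass.
have hS : has_sup S.
  by split; [exists (sqrt_mass 0), 0%N|exists 1 => _ [n _ <-]; exact: sqrt_mass_le1].
have [_ [N _ <-] hN] := sup_adherent e0 hS; exists N => n _.
have : sqrt_mass n <= sup S by apply: (sup_upper_bound hS); exists n.
lra.
Qed.

Lemma sqrt_iter_cauchy x : hcauchy (sqrt_iter ^~ x).
Proof.
move=> e e0; have x1 : 0 < hnorm x + 1 by rewrite ltr_wpDl// hnorm_ge0.
have [N hN] := sqrt_mass_cauchy (divr_gt0 (divr_gt0 e0 (ltr0Sn _ 1)) x1).
have near n : (N <= n)%N -> hnorm (sqrt_iter n x - sqrt_iter N x) < e / 2.
  move=> Nn; have := hN n Nn; rewrite ltr_pdivlMr//; apply: le_lt_trans.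
  have := sqrt_iter_dist N (n - N) x; rewrite subnKC// => /le_trans; apply.
  rewrite ler_wpM2l ?lerDl//.
  have := sqrt_iter_dist N (n - N) x; rewrite subnKC// => h.
  (* The masses increase: for nonzero x this can be read off the norm bound just obtained, otherwise
     the nonnegative increments are added up. *)
  have [x0|x0] := eqVneq (hnorm x) 0; last first.
    by rewrite -(@pmulr_lge0 _ (hnorm x)) ?lt_def ?x0 ?hnorm_ge0// (le_trans _ h)// hnorm_ge0.
  elim: (n) Nn => [|m ih]; first by rewrite leqn0 => /eqP ->; rewrite subrr.
  rewrite leq_eqVlt => /predU1P[->|]; first by rewrite subrr.
  rewrite ltnS => /ih; have := pos_poly_ge0 (sqrt_iter_step m); lra.
exists N => m n /near hm /near hn.
apply: le_lt_trans (hnormB_triangle (sqrt_iter N x) _ _) _.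
by rewrite (splitr e) ltrD// hnormBC.
Qed.

(* Y is 1 - sqrt (1 - A). *)
Lemma sqrt_exists : exists Y : H -> H,
  [/\ lin_op Y, sym_op Y, bounded_op 1 Y,
      forall x, Y x + Y x = A x + Y (Y x) &
      forall J c, lin_op J -> bounded_op c J -> (forall x, J (A x) = A (J x)) ->
        forall x, J (Y x) = Y (J x)].
Proof.
have ex x := hcauchy_cvg (sqrt_iter_cauchy x).
pose Y x := projT1 (cid (ex x)).
have YP x : hcvg (sqrt_iter ^~ x) (Y x) by exact: projT2 (cid (ex x)).
have lY : lin_op Y.
  split=> [x y|a x]; apply: (hcvg_unique (YP _)).
    rewrite (_ : sqrt_iter ^~ (x + y) = fun n => sqrt_iter n x + sqrt_iter n y).
      exact: hcvgD.
    by apply/funext => n; exact: (pos_poly_lin (sqrt_iter_pos n)).1.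
  rewrite (_ : sqrt_iter ^~ (a *: x) = fun n => a *: sqrt_iter n x).
    exact: hcvgZ.
  by apply/funext => n; exact: (pos_poly_lin (sqrt_iter_pos n)).2.
have bY : bounded_op 1 Y.
  move=> x; rewrite mul1r; apply/ler_addgt0Pr => e e0.
  have [N hN] := YP x e e0; rewrite -(subrKC (sqrt_iter N x) (Y x)).
  apply: le_trans (hnormD _ _) _; rewrite lerD//.
    apply: le_trans (pos_poly_bounded (sqrt_iter_pos N) x) _.
    by rewrite ler_piMl ?hnorm_ge0// sqrt_mass_le1.
  by rewrite hnormBC ltW// hN.
(* All iterates are contractions, so the operator and its argument may converge along the same
   index. *)
have YY x : hcvg (fun n => sqrt_iter n (sqrt_iter n x)) (Y (Y x)).
  move=> e e0; have [N hN] := YP x (e / 2) (divr_gt0 e0 (ltr0Sn _ 1)).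
  have [M hM] := YP (Y x) (e / 2) (divr_gt0 e0 (ltr0Sn _ 1)).
  exists (maxn N M) => n; rewrite geq_max => /andP[Nn Mn].
  apply: le_lt_trans (hnormB_triangle (sqrt_iter n (Y x)) _ _) _.
  rewrite (splitr e) ltr_leD//; last by rewrite ltW// hM.
  rewrite -(lin_opB _ _ (pos_poly_lin (sqrt_iter_pos n))).
  apply: le_lt_trans (pos_poly_bounded (sqrt_iter_pos n) _) _.
  by apply: le_lt_trans (hN n Nn); rewrite ler_piMl ?hnorm_ge0// sqrt_mass_le1.
exists Y; split => //.
- move=> x y; apply/eqP; rewrite -subr_eq0; apply/eqP.
  have xn : hcvg (fun n => sqrt_iter n x) (Y x) by exact: YP.
  have yn : hcvg (fun n => sqrt_iter n y) (Y y) by exact: YP.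
  apply/eqP; rewrite -normr_le0; apply/ler_addgt0Pr => e e0; rewrite add0r.
  have y1 : 0 < hnorm y + 1 by rewrite ltr_wpDl// hnorm_ge0.
  have x1 : 0 < hnorm x + 1 by rewrite ltr_wpDl// hnorm_ge0.
  have [N hN] := xn (e / 2 / (hnorm y + 1)) (divr_gt0 (divr_gt0 e0 (ltr0Sn _ 1)) y1).
  have [M hM] := yn (e / 2 / (hnorm x + 1)) (divr_gt0 (divr_gt0 e0 (ltr0Sn _ 1)) x1).
  pose n := maxn N M.
  have := hN n (leq_maxl _ _); rewrite ltr_pdivlMr// => h1.
  have := hM n (leq_maxr _ _); rewrite ltr_pdivlMr// => h2.
  rewrite (_ : _ - _ = ip x (sqrt_iter n y - Y y) - ip (sqrt_iter n x - Y x) y).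
    apply: le_trans (ler_normB _ _) _; rewrite (splitr e) lerD//.
      apply: le_trans (hnorm_CS _ _) _; rewrite mulrC; apply: le_trans (ltW h2).
      by rewrite ler_wpM2l ?hnorm_ge0// lerDl.
    apply: le_trans (hnorm_CS _ _) _; apply: le_trans (ltW h1).
    by rewrite ler_wpM2l ?hnorm_ge0// lerDl.
  rewrite hilbBl hilbBr (pos_poly_sym (sqrt_iter_pos n)); lra.
- move=> x; have h1 := hcvgD (YP x) (YP x).
  suff h2 : hcvg (fun n => sqrt_iter n.+1 x + sqrt_iter n.+1 x) (A x + Y (Y x)).
    apply: (hcvg_unique _ h2) => e e0; have [N hN] := h1 e e0.
    by exists N => n Nn; apply: hN; rewrite (leq_trans Nn).
  rewrite (_ : (fun n => _) = fun n => A x + sqrt_iter n (sqrt_iter n x)).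
    by apply: hcvgD; [exact: hcvg_cst|exact: YY].
  apply/funext => n /=; rewrite -scalerDl (_ : 2^-1 + 2^-1 = 1) ?scale1r//; lra.
- move=> J c lJ bJ cJ x; have h1 := bounded_cvg lJ bJ (YP x).
  apply: (hcvg_unique h1).
  rewrite (_ : J \o _ = sqrt_iter ^~ (J x)); first exact: YP.
  by apply/funext => n /=; exact: (pos_poly_comm lJ cJ (sqrt_iter_pos n)).
Qed.

End SquareRoot.

Definition hdom (T : H -> H -> Prop) f : Prop := exists g, T f g.

(** A relation rather than a function: it is linear and closed for every T, and single-valued once
    the domain of T is dense. *)
Definition hadj (T : H -> H -> Prop) (g h : H) : Prop :=
  forall f k, T f k -> ip k g = ip f h.

Definition hcompose (S T : H -> H -> Prop) f h : Prop := exists2 g, T f g & S g h.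

Definition lin_graph (T : H -> H -> Prop) : Prop :=
  [/\ T 0 0, forall f g f' g', T f g -> T f' g' -> T (f + f') (g + g') &
      forall a f g, T f g -> T (a *: f) (a *: g)].

Definition closed_graph (T : H -> H -> Prop) : Prop := forall u v f g,
  (forall n, T (u n) (v n)) -> hcvg u f -> hcvg v g -> T f g.

Definition hdense (P : H -> Prop) : Prop :=
  forall f e, 0 < e -> exists2 g, P g & hnorm (f - g) < e.

Lemma lin_graphB T f g f' g' : lin_graph T -> T f g -> T f' g' ->
  T (f - f') (g - g').
Proof.
move=> [_ TD TZ] h h'; have := TD _ _ _ _ h (TZ (-1) _ _ h').
by rewrite !scaleN1r.
Qed.

Lemma hadj_lin T : lin_graph (hadj T).
Proof.
split=> [f k _|g h g' h' gh gh' f k fk|a g h gh f k fk].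
- by rewrite !hilb0r.
- by rewrite !hilbDr (gh _ _ fk) (gh' _ _ fk).
- by rewrite !hilbZr (gh _ _ fk).
Qed.

Lemma hadj_closed T : closed_graph (hadj T).
Proof.
move=> u v g h uv ug vh f k fk.
apply/eqP; rewrite -subr_eq0 -normr_le0; apply/ler_addgt0Pr => e e0; rewrite add0r.
have k1 : 0 < hnorm k + 1 by rewrite ltr_wpDl// hnorm_ge0.
have f1 : 0 < hnorm f + 1 by rewrite ltr_wpDl// hnorm_ge0.
have [N hN] := ug (e / 2 / (hnorm k + 1)) (divr_gt0 (divr_gt0 e0 (ltr0Sn _ 1)) k1).
have [M hM] := vh (e / 2 / (hnorm f + 1)) (divr_gt0 (divr_gt0 e0 (ltr0Sn _ 1)) f1).
pose n := maxn N M.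
have := hN n (leq_maxl _ _); rewrite ltr_pdivlMr// => h1.
have := hM n (leq_maxr _ _); rewrite ltr_pdivlMr// => h2.
rewrite (_ : _ - _ = ip f (v n - h) - ip k (u n - g)); last first.
  by rewrite !hilbBr (uv n _ _ fk); lra.
apply: le_trans (ler_normB _ _) _; rewrite (splitr e) lerD//.
  apply: le_trans (hnorm_CS _ _) _; rewrite mulrC; apply: le_trans (ltW h2).
  by rewrite ler_wpM2l ?hnorm_ge0// lerDl.
apply: le_trans (hnorm_CS _ _) _; rewrite mulrC; apply: le_trans (ltW h1).
by rewrite ler_wpM2l ?hnorm_ge0// lerDl.
Qed.

Lemma hdense_orth P f : hdense P -> (forall g, P g -> ip f g = 0) -> f = 0.
Proof.
move=> dP fP; apply: hnorm_eq0; apply/eqP; rewrite eq_le hnorm_ge0 andbT.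
apply/ler_addgt0Pr => e e0; rewrite add0r; have [g Pg fg] := dP f e e0.
have : hnorm f ^+ 2 <= hnorm f * e.
  rewrite hnorm_sqr -[X in ip f X](subrKC g) hilbDr (fP _ Pg) add0r.
  rewrite (le_trans (ler_norm _))// (le_trans (hnorm_CS _ _))// ler_wpM2l ?hnorm_ge0// ltW//.
have := hnorm_ge0 f; rewrite le_eqVlt => /predU1P[<- _|f0]; first exact: ltW.
by rewrite expr2 ler_pM2l.
Qed.

End InnerProduct.

(** * Graphs as subspaces of the product space *)

Section ProductSpace.
Variables (H : lmodType R) (ip : H -> H -> R) (hax : hilbert_axioms ip).

Definition ip2 (p q : H * H) : R := ip p.1 q.1 + ip p.2 q.2.

Lemma hilbert_axioms2 : hilbert_axioms ip2.
Proof.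
split.
- by move=> x y; rewrite /ip2 !(hilbC hax x.1) !(hilbC hax x.2).
- by move=> x y z; rewrite /ip2 /= !(hilbDl hax) addrACA.
- by move=> a x y; rewrite /ip2 /= !(hilbZl hax) mulrDr.
- by move=> x; rewrite /ip2 addr_ge0// (hilb_ge0 hax).
- move=> [x y]; rewrite /ip2 /= => /eqP; rewrite paddr_eq0 ?(hilb_ge0 hax)//.
  by move=> /andP[/eqP/(hilb_eq0 hax) -> /eqP/(hilb_eq0 hax) ->].
- move=> u cu.
  have [|l ul] := @hcauchy_cvg _ _ hax (fun n => (u n).1).
    move=> e e0; have [N hN] := cu _ (exprn_gt0 2 e0); exists N => m n Nm Nn.
    rewrite -(hnorm_lt hax)//; apply: le_lt_trans (hN m n Nm Nn).
    by rewrite /ip2 lerDl (hilb_ge0 hax).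
  have [|k uk] := @hcauchy_cvg _ _ hax (fun n => (u n).2).
    move=> e e0; have [N hN] := cu _ (exprn_gt0 2 e0); exists N => m n Nm Nn.
    rewrite -(hnorm_lt hax)//; apply: le_lt_trans (hN m n Nm Nn).
    by rewrite /ip2 lerDr (hilb_ge0 hax).
  exists (l, k) => e e0; have e20 : 0 < e / 2 by rewrite divr_gt0.
  have se : 0 < Num.sqrt (e / 2) by rewrite sqrtr_gt0.
  have [N hN] := ul _ se; have [M hM] := uk _ se.
  exists (maxn N M) => n; rewrite geq_max => /andP[/hN h1 /hM h2].
  move: h1 h2; rewrite -!(hnorm_lt hax)// sqr_sqrtr ?ltW// => h1 h2.
  by rewrite /ip2 /= (splitr e) ltrD.
Qed.

Lemma hcvg2 u p : hcvg ip2 u p -> hcvg ip (fun n => (u n).1) p.1 /\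
  hcvg ip (fun n => (u n).2) p.2.
Proof.
move=> up; split=> e e0; have [N hN] := up e e0; exists N => n /hN.
  rewrite -(hnorm_lt hilbert_axioms2)// -(hnorm_lt hax)//; apply: le_lt_trans.
  by rewrite /ip2 lerDl (hilb_ge0 hax).
rewrite -(hnorm_lt hilbert_axioms2)// -(hnorm_lt hax)//; apply: le_lt_trans.
by rewrite /ip2 lerDr (hilb_ge0 hax).
Qed.

Lemma graph_projection (T : H -> H -> Prop) : lin_graph T -> closed_graph ip T ->
  forall a b, exists f g, T f g /\
    forall f' g', T f' g' -> ip (a - f) f' + ip (b - g) g' = 0.
Proof.
move=> [T0 TD TZ] Tcl a b.
have [||[f g] Tfg fgP] := @hilbert_projection _ _ hilbert_axioms2 [set p | T p.1 p.2] _ _ (a, b).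
- by split=> //= [[f g] [f' g']|c [f g]] /=; [exact: TD|exact: TZ].
- move=> u l Tu /hcvg2[u1 u2]; exact: Tcl Tu u1 u2.
by exists f, g; split => // f' g' T'; exact: (fgP (f', g') T').
Qed.

(* The orthogonal complement of the graph of T is {(- T^* g, g)}. *)
Lemma adjT_surj (T : H -> H -> Prop) : lin_graph T -> closed_graph ip T ->
  forall a, exists f g, T f g /\ hadj ip T g (a - f).
Proof.
move=> lT cT a; have [f [g [fg fgP]]] := graph_projection lT cT a 0.
exists f, g; split => // f' k T'; have := fgP _ _ T'.
rewrite add0r (hilbNl hax) (hilbC hax k) (hilbC hax f') => /eqP.
by rewrite subr_eq0 => /eqP.
Qed.

Section Core.
Variables D S : H -> H -> Prop.
Hypotheses (linD : lin_graph D) (cloD : closed_graph ip D).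
Hypotheses (linS : lin_graph S) (cloS : closed_graph ip S).
Hypothesis sepS : forall k, S 0 k -> k = 0.
Hypothesis DS : forall f h,
  hcompose (hadj ip D) D f h <-> hcompose (hadj ip S) S f h.

(* The domain of S^* S is a core of S, and both graph norms agree on it. *)
Lemma hdom_sub f : hdom S f -> hdom D f.
Proof.
move=> [k fk].
(* [G] is the graph of S restricted to the domain of S^* S, and [M] is its closure; the aim is that
   [M] contains the given pair (f, k). *)
pose G f g := S f g /\ exists h, hadj ip S g h.
pose M := hclosure ip2 [set p : H * H | G p.1 p.2].
have sG : lin_subspace [set p : H * H | G p.1 p.2].
  have [S0 SD SZ] := linS; have [A0 AD AZ] := hadj_lin hax S.
  split; first by split => //; exists 0.
  - by move=> [? ?] [? ?] [/= ? [h1 ?]] [? [h2 ?]]; split; [exact: SD|exists (h1 + h2); exact: AD].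
  - by move=> a [? ?] [/= ? [h ?]]; split; [exact: SZ|exists (a *: h); exact: AZ].
have sM := hclosure_subspace hilbert_axioms2 sG.
have cM := hclosure_closed hilbert_axioms2 (K := [set p : H * H | G p.1 p.2]).
have MS p : M p -> S p.1 p.2.
  by move=> [u Gu /hcvg2[u1 u2]]; apply: (cloS _ u1 u2) => n; case: (Gu n).
have [[p q] Mpq pqP] := hilbert_projection hilbert_axioms2 sM cM (f, k).
have Srs : S (f - p) (k - q) by apply: lin_graphB => //; exact: (MS (p, q)).
(* The residual (r, s) = (f - p, k - q) is orthogonal to [G]. Solve u + S^* v = r with v = S u and
   test with (u, v): the result <r, u> + <s, v> = <r, u + S^* v> = <r, r> must be 0. *)
have r0 : f - p = 0.
  have [u [v [Suv vP]]] := adjT_surj linS cloS (f - p).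
  have Guv : G u v by split => //; exists (f - p - u).
  have Muv : M (u, v) by apply: sub_hclosure; [exact: hilbert_axioms2|exact: Guv].
  have := pqP _ Muv; rewrite /ip2 /=.
  rewrite (vP _ _ Srs) -(hilbDr hax) subrKC; exact: (hilb_eq0 hax).
have Mfk : M (f, k).
  move: Srs; rewrite r0 => /sepS/eqP; rewrite subr_eq0 => /eqP ->.
  by move/eqP : r0; rewrite subr_eq0 => /eqP ->.
have [x Gx /hcvg2[/= x1 x2]] := Mfk.
have ex n : exists wh : H * H, [/\ D (x n).1 wh.1, hadj ip D wh.1 wh.2 & hadj ip S (x n).2 wh.2].
  have [Sx [h xh]] := Gx n.
  have [w Dw wh] : hcompose (hadj ip D) D (x n).1 h by apply/DS; exists (x n).2.
  by exists (w, h).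
pose w n := (projT1 (cid (ex n))).1; pose h n := (projT1 (cid (ex n))).2.
have whP n : [/\ D (x n).1 (w n), hadj ip D (w n) (h n) & hadj ip S (x n).2 (h n)].
  exact: projT2 (cid (ex n)).
(* With h = D^* D x = S^* S x, both |D x|^2 and |S x|^2 equal <x, h>, so the Cauchy property passes
   from S x to D x. *)
have cw : hcauchy ip w.
  move=> e e0; have [N hN] := hcvg_cauchy hax x2 e0.
  exists N => m n Nm Nn; have := hN m n Nm Nn.
  rewrite -!(hnorm_lt hax)//; congr (_ < _).
  have [Dm am bm] := whP m; have [Dn an bn] := whP n.
  have Dmn := lin_graphB linD Dm Dn.
  have amn := lin_graphB (hadj_lin hax D) am an.
  have bmn := lin_graphB (hadj_lin hax S) bm bn.
  rewrite (amn _ _ Dmn); apply: bmn; apply: lin_graphB => //.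
    by have [] := Gx m.
  by have [] := Gx n.
have [l wl] := hcauchy_cvg hax cw; exists l; apply: (cloD _ x1 wl) => n.
by have [] := whP n.
Qed.

End Core.

(** * The positive square root of [D^* D] from its resolvent *)

Section SquareRootGraph.
Variable D : H -> H -> Prop.
Hypotheses (linD : lin_graph D) (cloD : closed_graph ip D).
Hypothesis denD : hdense ip (hdom D).

Let N := hcompose (hadj ip D) D.

Let resolvent_unique a f f' : N f (a - f) -> N f' (a - f') -> f = f'.
Proof.
move=> [g Dg ag] [g' Dg' ag'].
have Dgg := lin_graphB linD Dg Dg'.
have agg := lin_graphB (hadj_lin hax D) ag ag'.
have := agg _ _ Dgg; rewrite (_ : a - f - (a - f') = - (f - f')); last first.
  by rewrite !opprB [LHS]addrC subrKA.
rewrite (hilbNr hax) => h; apply/eqP; rewrite -subr_eq0; apply/eqP/(hilb_eq0 hax).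
have := hilb_ge0 hax (g - g'); have := hilb_ge0 hax (f - f'); lra.
Qed.

Let ex_resolvent a : exists f, N f (a - f).
Proof.
have [f [g [fg gh]]] := adjT_surj linD cloD a.
by exists f, g.
Qed.

Let B a := projT1 (cid (ex_resolvent a)).

Let BP a : N (B a) (a - B a). Proof. exact: projT2 (cid (ex_resolvent a)). Qed.

(** The unbounded relation is recovered from its bounded resolvent, so identities for [B] translate
    into statements about [N]. *)
Let BE f h : N f h <-> B (f + h) = f.
Proof.
split=> [Nfh|e].
  by apply: (@resolvent_unique (f + h)); [exact: BP|rewrite addrC addKr].
by have := BP (f + h); rewrite e [f + h]addrC addrK.
Qed.

Let resolvent_lin : lin_op B.
Proof.
have [A0 AD AZ] := hadj_lin hax D; have [D0 DD DZ] := linD.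
split=> [x y|a x].
  have [g Dg ag] := BP x; have [g' Dg' ag'] := BP y.
  rewrite -[x + y](subrKC (B x + B y)); apply/BE; exists (g + g'); first exact: DD.
  by rewrite opprD addrACA; exact: AD.
have [g Dg ag] := BP x.
rewrite -[a *: x](subrKC (a *: B x)); apply/BE; exists (a *: g); first exact: DZ.
by rewrite -scalerBr; exact: AZ.
Qed.

Let resolvent_sym : sym_op ip B.
Proof.
move=> a b; have [g Dg ag] := BP a; have [g' Dg' ag'] := BP b.
have := ag' _ _ Dg; have := ag _ _ Dg'.
rewrite !(hilbBr hax) (hilbC hax (B b) a) (hilbC hax (B b) (B a)) (hilbC hax g' g); lra.
Qed.

Let resolvent_ge0 a : 0 <= ip (B a) (a - B a).
Proof. by have [g Dg ag] := BP a; rewrite -(ag _ _ Dg) (hilb_ge0 hax). Qed.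

(** In the expansion of the norm of a = B a + (a - B a) the cross term is nonnegative. Hence B and 1
    - B are both contractions, and the root construction applies to each. *)
Let resolvent_sq a : ip (B a) (B a) <= ip a a /\ ip (a - B a) (a - B a) <= ip a a.
Proof.
have h := resolvent_ge0 a; have h1 := hilb_ge0 hax (B a); have h2 := hilb_ge0 hax (a - B a).
have -> : ip a a = ip (B a) (B a) + ip (a - B a) (a - B a) + ip (B a) (a - B a) *+ 2.
  transitivity (ip (B a + (a - B a)) (B a + (a - B a))); first by rewrite subrKC.
  move: (a - B a) => c; move: (B a) => b.
  by rewrite (hilbDl hax) !(hilbDr hax) (hilbC hax c b) mulr2n; lra.
rewrite mulr2n; lra.
Qed.

Let resolvent_ctr : bounded_op ip 1 B.
Proof.
move=> a; rewrite mul1r -(@ler_pXn2r _ 2)// ?nnegrE ?hnorm_ge0// !(hnorm_sqr hax).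
by have [] := resolvent_sq a.
Qed.

Let coB a := a - B a.

Let coB_lin : lin_op coB.
Proof.
have [BD BZ] := resolvent_lin; rewrite /coB; split=> [x y|a x].
  by rewrite BD opprD addrACA.
by rewrite BZ scalerBr.
Qed.

Let coB_sym : sym_op ip coB.
Proof. by move=> x y; rewrite /coB (hilbBl hax) (hilbBr hax) resolvent_sym. Qed.

Let coB_ctr : bounded_op ip 1 coB.
Proof.
move=> a; rewrite mul1r -(@ler_pXn2r _ 2)// ?nnegrE ?hnorm_ge0// !(hnorm_sqr hax).
by have [] := resolvent_sq a.
Qed.

(* With C = sqrt B, K = sqrt (1 - B) and Q = sqrt C, the square root of D^* D
   is K C^-1. *)
Let roots : exists C K Q : H -> H, [/\ [/\ lin_op C, lin_op K & lin_op Q],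
  [/\ sym_op ip C, sym_op ip K & sym_op ip Q],
  [/\ forall x, C (C x) = B x, forall x, K (K x) = x - B x & forall x, Q (Q x) = C x],
  (forall x, 0 <= ip (K x) x) &
  (forall x, C (K x) = K (C x)) /\ (forall x, Q (K x) = K (Q x))].
Proof.
(* [sqrt_exists] returns 1 minus a root: 1 - Y = sqrt(1 - B), 1 - Z = sqrt(B), and from Z itself 1 -
   X = sqrt(1 - Z), a fourth root of B. *)
have [Y [lY sY bY YE YJ]] := sqrt_exists hax resolvent_lin resolvent_sym resolvent_ctr.
have [Z [lZ sZ bZ ZE ZJ]] := sqrt_exists hax coB_lin coB_sym coB_ctr.
have [X [lX sX bX XE XJ]] := sqrt_exists hax lZ sZ bZ.
have sub_lin (T : H -> H) : lin_op T -> lin_op (fun x => x - T x).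
  by move=> [TD TZ]; split=> *; rewrite ?TD ?TZ ?scalerBr// opprD addrACA.
have sub_sym (T : H -> H) : sym_op ip T -> sym_op ip (fun x => x - T x).
  by move=> sT x y; rewrite (hilbBl hax) (hilbBr hax) sT.
have sub_sq (T U : H -> H) x : lin_op T -> T x + T x = U x + T (T x) ->
    x - T x - T (x - T x) = x - U x.
  move=> lT E; rewrite (lin_opB _ _ lT) opprB -!addrA; congr (_ + _).
  have -> : U x = T x + T x - T (T x) by rewrite E addrK.
  by rewrite !opprD opprK -addrA; congr (_ + _); exact: addrC.
have sub_sub (T U : H -> H) x : lin_op T -> lin_op U -> T (U x) = U (T x) ->
    x - T x - U (x - T x) = x - U x - T (x - U x).
  move=> lT lU E; rewrite (lin_opB _ _ lT) (lin_opB _ _ lU) E !opprB.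
  by rewrite addrACA [RHS]addrACA [- T x + _]addrC.
(* Commutation propagates along the chain: Y commutes with B, hence with 1 - B and the Z built from
   it, hence with the X built from Z. *)
have YcB x : Y (B x) = B (Y x).
  by symmetry; apply: (YJ B 1).
have YcZ x : Y (Z x) = Z (Y x).
  by apply: (ZJ Y 1) => // z; rewrite /coB (lin_opB _ _ lY) YcB.
have YcX x : Y (X x) = X (Y x) by apply: (XJ Y 1).
exists (fun x => x - Z x), (fun x => x - Y x), (fun x => x - X x); split.
- by split; exact: sub_lin.
- by split; exact: sub_sym.
- split=> x.
  + by rewrite (sub_sq Z coB)// /coB opprB addrC subrK.
  + exact: sub_sq.
  + exact: sub_sq.
- move=> x; rewrite (hilbBl hax) subr_ge0 (le_trans (ler_norm _))//.
  rewrite (le_trans (hnorm_CS hax _ _))// -(hnorm_sqr hax) expr2 ler_wpM2r ?hnorm_ge0//.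
  by rewrite -[leRHS]mul1r.
- by split=> x; exact: sub_sub.
Qed.

(** S is parametrised as the set of pairs (C g, K g), which avoids inverting C. Its properties
    reduce to C^2 + K^2 = 1, commutation and the positivity of K. *)
Theorem sqrt_graph_exists : exists S : H -> H -> Prop,
  [/\ forall u v, S u v <-> hadj ip S u v,
      hdense ip (hdom S),
      forall u v, S u v -> 0 <= ip v u &
      forall f h, hcompose S S f h <-> hcompose (hadj ip D) D f h].
Proof.
have [C [K [Q [[lC lK lQ] [sC sK sQ] [CC KK QQ] K0 [CK QK]]]]] := roots.
have CBK x : C (C x) + K (K x) = x by rewrite CC KK subrKC.
exists (fun u v => exists g, u = C g /\ v = K g); split.
- move=> u v; split=> [[g [-> ->]] _ _ [g' [-> ->]]|h].
    by rewrite sK -CK -sC.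
  have E : K u = C v.
    apply: (hnorm_sub_eq0 hax) => e e0; suff -> : K u - C v = 0 by rewrite (hnorm0 hax).
    apply: (hilb_nondeg hax) => g; rewrite (hilbBl hax) sK sC.
    rewrite (hilbC hax u) (hilbC hax v) (h (C g) (K g)) ?subrr//.
    by exists g.
  (* From K u = C v follows C (C u + K v) = C^2 u + K^2 u = u, and likewise K (C u + K v) = v. *)
  exists (C u + K v); split.
    by rewrite lC.1 CK -E CBK.
  by rewrite lK.1 -CK E CBK.
(* The range of B = C^2 lies in the domain of S. A vector r orthogonal to it has <r, B r> = 0, which
   forces B r = 0 because <B r, r - B r> is nonnegative; then r = D^* 0 is orthogonal to the dense
   domain of D. *)
- move=> f e e0; pose M := [set B a | a in [set: H]].
  have sM : lin_subspace M.
    have [BD BZ] := resolvent_lin.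
    have B0 : B 0 = 0 by rewrite -[in LHS](scale0r (0 : H)) BZ scale0r.
    split; first by exists 0.
      by move=> _ _ [a _ <-] [b _ <-]; exists (a + b).
    by move=> a _ [b _ <-]; exists (a *: b).
  have [k Mk kP] := hilbert_projection hax (hclosure_subspace hax sM) (hclosure_closed hax (K := M)) f.
  have fk : f - k = 0.
    have h0 : ip (f - k) (B (f - k)) = 0 by apply: kP; apply: (sub_hclosure hax); exists (f - k).
    have [g Dg ag] := BP (f - k).
    have Bfk : B (f - k) = 0.
      apply: (hilb_eq0 hax); have := resolvent_ge0 (f - k); rewrite (hilbBr hax).
      rewrite (hilbC hax _ (f - k)) h0; have := hilb_ge0 hax (B (f - k)); lra.
    rewrite Bfk subr0 in ag; rewrite Bfk in Dg.
    have g0 : g = 0 by apply: (hilb_eq0 hax); rewrite (ag _ _ Dg) (hilb0l hax).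
    apply: (hdense_orth hax denD) => x [y Dxy].
    by rewrite (hilbC hax) -(ag _ _ Dxy) g0 (hilb0r hax).
  have /hclosureP/(_ e e0)[_ [a _ <-] h] := Mk.
  exists (B a); first by exists (K (C a)), (C a); rewrite CC.
  by move/eqP : fk; rewrite subr_eq0 => /eqP ->; rewrite (hnormBC hax).
(* Writing C = Q^2 turns <K g, C g> into <K Q g, Q g>, to which positivity of K applies. *)
- by move=> _ _ [g [-> ->]]; rewrite -QQ -sQ QK; exact: K0.
- move=> f h; split=> [[_ [g [-> ->]] [g' [E ->]]]|/BE E].
    apply/BE; rewrite -CC lC.1 lC.1.
    by rewrite (CK g') -E -lC.1 CBK.
  exists (K (C (f + h))).
    by exists (C (f + h)); rewrite CC.
  exists (K (f + h)); rewrite CK KK; split => //.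
  by rewrite E [f + h]addrC addrK.
Qed.

End SquareRootGraph.

End ProductSpace.
End RealHilbert.

(** * The Hilbert space of square-integrable functions *)

Section Density.
Context d (T : measurableType d) (R : realType).
Variables (m m0 : {measure set T -> \bar R}) (w : T -> R).
Hypothesis mw : measurable_fun setT w.
Hypothesis w_ge0 : forall x, 0 <= w x.
Hypothesis mE : forall A, measurable A -> m A = (\int[m0]_(x in A) (w x)%:E)%E.

Let density_indic E : measurable E ->
  (\int[m]_x (\1_E x)%:E = \int[m0]_x ((\1_E x)%:E * (w x)%:E))%E.
Proof.
move=> mEE; rewrite integral_indic// setIT mE// [LHS]integral_mkcond/=.
apply: eq_integral => x _; rewrite patchE indicE.
by case: ifPn => _; rewrite ?mul1e ?mul0e.
Qed.

Import HBNNSimple.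

Let density_nnsfun (f : {nnsfun T >-> R}) :
  (\int[m]_x (f x)%:E = \int[m0]_x ((f x)%:E * (w x)%:E))%E.
Proof.
under [LHS]eq_integral do rewrite fimfunE -fsumEFin//.
rewrite [LHS]ge0_integral_fsum//; last 2 first.
  - by move=> r; exact/measurable_EFinP/measurableT_comp.
  - by move=> n x _; rewrite EFinM nnfun_muleindic_ge0.
under [RHS]eq_integral.
  move=> x xD; rewrite fimfunE -fsumEFin// muleC ge0_mule_fsumr; last first.
    by move=> r; rewrite EFinM nnfun_muleindic_ge0.
  over.
rewrite [RHS]ge0_integral_fsum//; last 2 first.
  - move=> r; apply: emeasurable_funM; first exact/measurable_EFinP.
    by apply/measurable_EFinP; do 2 apply/measurableT_comp => //.
  - move=> n x _; rewrite EFinM mule_ge0//; last by rewrite nnfun_muleindic_ge0.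
    by rewrite lee_fin.
apply: eq_fsbigr => r /set_mem [t _ ft].
have r0 : 0 <= r by rewrite -ft.
transitivity (\int[m0]_x (r%:E * ((\1_(f @^-1` [set r]) x)%:E * (w x)%:E)))%E; last first.
  by apply: eq_integral => x _; rewrite -!EFinM; congr EFin; ring.
rewrite [RHS]ge0_integralZl//.
- rewrite -density_indic// -ge0_integralZl//.
  by apply: measurableT_comp => //; exact: measurable_indic.
- by apply: emeasurable_funM; [apply: measurableT_comp => //; exact: measurable_indic|exact/measurable_EFinP].
- by move=> x _; rewrite mule_ge0// lee_fin.
Qed.

(** Known for indicators and simple functions, then extended along an increasing approximation by
    monotone convergence on both sides. *)
Lemma ge0_integral_density (f : T -> \bar R) :
  measurable_fun setT f -> (forall x, 0 <= f x)%E ->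
  (\int[m]_x f x = \int[m0]_x (f x * (w x)%:E))%E.
Proof.
move=> mf f0.
pose f_ := nnsfun_approx measurableT mf.
transitivity (lim (\int[m]_x (f_ n x)%:E @[n --> \oo])%E).
  rewrite -monotone_convergence//=.
  - apply: eq_integral => ? /[!inE] xD; apply/esym/cvg_lim => //=.
    exact: cvg_nnsfun_approx.
  - by move=> n; exact/measurable_EFinP/measurable_funTS.
  - by move=> n ? _; rewrite lee_fin.
  - by move=> ? _ ? ? mn; rewrite lee_fin; exact/lefP/nd_nnsfun_approx.
transitivity (lim (\int[m0]_x ((f_ n x)%:E * (w x)%:E) @[n --> \oo])%E).
  by apply: congr_lim; apply/funext => n /=; exact: density_nnsfun.
rewrite -monotone_convergence//=.
- apply: eq_integral => x /[!inE] xD; apply/cvg_lim => //=.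
  apply: cvgeZr => //; exact: cvg_nnsfun_approx.
- move=> n; apply: emeasurable_funM; exact/measurable_EFinP.
- by move=> n ? _; rewrite mule_ge0// lee_fin.
- move=> x _ ? ? mn; apply: lee_wpmul2r; first by rewrite lee_fin.
  by rewrite lee_fin; exact/lefP/nd_nnsfun_approx.
Qed.

Lemma integrable_density (f : T -> R) : measurable_fun setT f ->
  m.-integrable setT (EFin \o f) <->
  m0.-integrable setT (EFin \o (fun x => f x * w x)).
Proof.
move=> mf.
have mfw : measurable_fun setT (fun x => f x * w x) by exact: measurable_funM.
have e : (\int[m]_x `|(f x)%:E| = \int[m0]_x `|(f x * w x)%:E|)%E.
  rewrite ge0_integral_density//; last by apply: measurableT_comp => //; exact/measurable_EFinP.
  by apply: eq_integral => x _; rewrite EFinM abseM (gee0_abs (x := (w x)%:E))// lee_fin.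
by split=> /integrableP [_ h]; apply/integrableP; (split; first exact/measurable_EFinP);
  rewrite /= ?e// -e.
Qed.

Lemma Rintegral_density (f : T -> R) : measurable_fun setT f ->
  \int[m]_x f x = \int[m0]_x (f x * w x).
Proof.
move=> mf; rewrite /Rintegral; congr fine.
have mEf : measurable_fun setT (EFin \o f) by exact/measurable_EFinP.
rewrite integralE [RHS]integralE; congr (_ - _)%E.
  rewrite ge0_integral_density//; last exact: measurable_funepos.
  apply: eq_integral => x _; rewrite !funeposE /= EFinM.
  by rewrite -!EFin_max -EFinM maxr_pMl// mul0r.
rewrite ge0_integral_density//; last exact: measurable_funeneg.
apply: eq_integral => x _.
by rewrite !funenegE /= -!EFin_max -EFinM maxr_pMl// mul0r mulNr.
Qed.

End Density.

Lemma normr_sqr (R : realDomainType) (x : R) : `|x| ^+ 2 = x ^+ 2.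
Proof. by rewrite real_normK// num_real. Qed.

(** * Real square-integrable functions and their inner product *)

Section RealL2.
Context {R : realType} (m : {measure set (measurableTypeR R) -> \bar R}).
Implicit Types F G K : R -> R.

Definition l2 F : Prop := measurable_fun [set: measurableTypeR R] F /\
  m.-integrable setT (EFin \o (fun x => F x ^+ 2)).

Definition ip F G : R := \int[m]_x (F x * G x).

Lemma integrable_dom F G : measurable_fun [set: measurableTypeR R] F ->
  m.-integrable setT (EFin \o G) -> (forall x, `|F x| <= G x) ->
  m.-integrable setT (EFin \o F).
Proof.
move=> mF iG FG; apply: (le_integrable _ _ _ iG) => //; first exact/measurable_EFinP.
by move=> x _ /=; rewrite lee_fin (le_trans (FG x))// ler_norm.
Qed.

Lemma integrable_add F G : m.-integrable setT (EFin \o F) -> m.-integrable setT (EFin \o G) ->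
  m.-integrable setT (EFin \o (fun x => F x + G x)).
Proof.
move=> iF iG; have := integrableD measurableT iF iG.
by apply: eq_integrable => // x _.
Qed.

Lemma integrable_scale a F : m.-integrable setT (EFin \o F) ->
  m.-integrable setT (EFin \o (fun x => a * F x)).
Proof.
move=> iF; have := @integrableZl _ _ _ m _ measurableT a _ iF.
by apply: eq_integrable => // x _.
Qed.

Lemma l2_meas F : l2 F -> measurable_fun [set: measurableTypeR R] F.
Proof. by case. Qed.

Lemma l2M F G : l2 F -> l2 G -> m.-integrable setT (EFin \o (fun x => F x * G x)).
Proof.
move=> [mF iF] [mG iG]; apply: (integrable_dom (measurable_funM mF mG) (integrable_add iF iG)).
move=> x; rewrite normrM; have := sqr_ge0 (`|F x| - `|G x|); rewrite -(normr_sqr (F x)) -(normr_sqr (G x)).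
have := normr_ge0 (F x); have := normr_ge0 (G x); nra.
Qed.

Lemma l2Z a F : l2 F -> l2 (fun x => a * F x).
Proof.
move=> [mF iF]; split; first exact: measurable_funM.
have := integrable_scale (a ^+ 2) iF; apply: eq_integrable => // x _ /=.
by congr EFin; rewrite exprMn.
Qed.

Lemma l2D F G : l2 F -> l2 G -> l2 (fun x => F x + G x).
Proof.
move=> lF lG; split; first exact: (measurable_funD lF.1 lG.1).
have := integrable_add (integrable_add lF.2 lG.2) (integrable_scale 2 (l2M lF lG)).
by apply: eq_integrable => // x _ /=; congr EFin; ring.
Qed.

Lemma l2N F : l2 F -> l2 (fun x => - F x).
Proof.
by move=> /(l2Z (-1)) h; rewrite (_ : (fun x => _) = (fun x => -1 * F x))//; apply/funext => x; ring.
Qed.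

Lemma l2B F G : l2 F -> l2 G -> l2 (fun x => F x - G x).
Proof. by move=> lF lG; exact: l2D lF (l2N lG). Qed.

Lemma l2_0 : l2 (fun=> 0).
Proof.
split; first exact: measurable_cst.
by have := integrable0 m [set: measurableTypeR R]; apply: eq_integrable => // x _ /=; rewrite expr0n.
Qed.

Lemma ipC F G : ip F G = ip G F.
Proof. by rewrite /ip; congr Rintegral; apply/funext => x; rewrite mulrC. Qed.

Lemma Rintegral_add F G : m.-integrable setT (EFin \o F) -> m.-integrable setT (EFin \o G) ->
  \int[m]_x (F x + G x) = \int[m]_x F x + \int[m]_x G x.
Proof. by move=> iF iG; rewrite RintegralD. Qed.

Lemma Rintegral_scale a F : m.-integrable setT (EFin \o F) ->
  \int[m]_x (a * F x) = a * \int[m]_x F x.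
Proof. by move=> iF; rewrite RintegralZl. Qed.

Lemma ipDl F G K : l2 F -> l2 G -> l2 K -> ip (fun x => F x + G x) K = ip F K + ip G K.
Proof.
move=> lF lG lK; rewrite -Rintegral_add; [|exact: l2M|exact: l2M].
by rewrite /ip; congr Rintegral; apply/funext => x; ring.
Qed.

Lemma ipZl a F G : l2 F -> l2 G -> ip (fun x => a * F x) G = a * ip F G.
Proof.
move=> lF lG; rewrite -Rintegral_scale; last exact: l2M.
by rewrite /ip; congr Rintegral; apply/funext => x; ring.
Qed.

Lemma ipBl F G K : l2 F -> l2 G -> l2 K -> ip (fun x => F x - G x) K = ip F K - ip G K.
Proof.
move=> lF lG lK; rewrite -mulN1r -ipZl// -ipDl//; last exact: l2Z.
by rewrite /ip; congr Rintegral; apply/funext => x; ring.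
Qed.

Lemma ipDr F G K : l2 F -> l2 G -> l2 K -> ip K (fun x => F x + G x) = ip K F + ip K G.
Proof. by move=> lF lG lK; rewrite ipC ipDl// !(ipC K). Qed.

Lemma ipBr F G K : l2 F -> l2 G -> l2 K -> ip K (fun x => F x - G x) = ip K F - ip K G.
Proof. by move=> lF lG lK; rewrite ipC ipBl// !(ipC K). Qed.

Lemma ipZr a F G : l2 F -> l2 G -> ip G (fun x => a * F x) = a * ip G F.
Proof. by move=> lF lG; rewrite ipC ipZl// ipC. Qed.

Lemma ip_ge0 F : 0 <= ip F F.
Proof. by apply: Rintegral_ge0 => x _; rewrite -expr2 sqr_ge0. Qed.

Lemma ip_eq0 F : l2 F -> ip F F = 0 -> {ae m, forall x, F x = 0}.
Proof.
move=> lF F0.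
have i0 : (\int[m]_(x in setT) `|(F x * F x)%:E| = 0)%E.
  transitivity (\int[m]_x (F x * F x)%:E)%E.
    by apply: eq_integral => x _; rewrite gee0_abs// lee_fin -expr2 sqr_ge0.
  rewrite -(fineK (integrable_fin_num measurableT (l2M lF lF))).
  by move: F0; rewrite /ip /Rintegral => ->.
have mE : measurable_fun [set: measurableTypeR R] (fun x => (F x * F x)%:E).
  by apply/measurable_EFinP; exact: measurable_funM lF.1 lF.1.
have := (ae_eq_integral_abs m measurableT mE).1 i0.
apply: ae_mono => x /= /(_ Logic.I) [] /eqP.
by rewrite mulf_eq0 orbb => /eqP.
Qed.

Lemma Rintegral_ae F G : measurable_fun [set: measurableTypeR R] F ->
  measurable_fun [set: measurableTypeR R] G -> {ae m, forall x, F x = G x} ->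
  \int[m]_x F x = \int[m]_x G x.
Proof.
move=> mF mG FG; rewrite /Rintegral; congr fine; apply: ae_eq_integral => //.
- exact/measurable_EFinP.
- exact/measurable_EFinP.
- by apply: ae_mono FG => x -> _.
Qed.

Lemma integrable_ae_eq F G : measurable_fun [set: measurableTypeR R] G ->
  {ae m, forall x, F x = G x} -> m.-integrable setT (EFin \o F) -> m.-integrable setT (EFin \o G).
Proof.
move=> mG FG /integrableP[mF iF]; apply/integrableP; split; first exact/measurable_EFinP.
suff <- : (\int[m]_x `|(F x)%:E| = \int[m]_x `|(G x)%:E|)%E by [].
apply: ae_eq_integral => //.
- exact: measurableT_comp.
- by apply: measurableT_comp => //; exact/measurable_EFinP.
- by apply: ae_mono FG => x /= -> _.
Qed.

Lemma l2_ae F G : measurable_fun [set: measurableTypeR R] G ->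
  {ae m, forall x, F x = G x} -> l2 F -> l2 G.
Proof.
move=> mG FG [mF iF]; split=> //; apply: integrable_ae_eq iF; first exact: measurable_funX.
by apply: ae_mono FG => x ->.
Qed.

Lemma ip_ae F G K : l2 F -> l2 G -> l2 K -> {ae m, forall x, F x = G x} -> ip F K = ip G K.
Proof.
move=> [mF _] [mG _] [mK _] FG; apply: Rintegral_ae; [exact: measurable_funM|exact: measurable_funM|].
by apply: ae_mono FG => x ->.
Qed.

Lemma ip_sum_sqr F G : l2 F -> l2 G ->
  ip (fun x => F x + G x) (fun x => F x + G x) <= 2 * (ip F F + ip G G).
Proof.
move=> lF lG; have := ip_ge0 (fun x => F x - G x).
have lD := l2D lF lG; have lB := l2B lF lG.
rewrite (ipDl lF lG lD) (ipDr lF lG lF) (ipDr lF lG lG).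
rewrite (ipBl lF lG lB) (ipBr lF lG lF) (ipBr lF lG lG) (ipC G F); lra.
Qed.

End RealL2.

(** * Completeness of L^2 *)

Section RieszFischer.
Context {R : realType}.

(** With s = sqrt(g) the increments are at most s / 2^i, so adding and subtracting 2 s / 2^n gives
    monotone sequences enclosing v. The squared remainder is 4 g / 4^n. *)
Lemma geometric_increments_cvg (v : nat -> R) (g : R) :
  (forall i, 4 ^+ i * (v i.+1 - v i) ^+ 2 <= g) ->
  exists2 l, v @ \oo --> l & forall n, (l - v n) ^+ 2 <= 4 * g / 4 ^+ n.
Proof.
move=> vg; pose s := Num.sqrt g.
have g0 : 0 <= g by apply: le_trans (vg 0); rewrite mul1r sqr_ge0.
have s0 : 0 <= s by exact: sqrtr_ge0.
have sg : s ^+ 2 = g by exact: sqr_sqrtr.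
have p0 i : 0 < (2 : R) ^+ i by rewrite exprn_gt0.
have step i : `|v i.+1 - v i| <= s / 2 ^+ i.
  rewrite ler_pdivlMr// -(@ler_pXn2r _ 2)// ?nnegrE ?mulr_ge0 ?(ltW (p0 i))//.
  rewrite exprMn normr_sqr sg; apply: le_trans (vg i).
  by rewrite mulrC exprAC (_ : 2 ^+ 2 = 4 :> R)//; ring.
pose r n := 2 * s / 2 ^+ n.
have rS n : r n.+1 = s / 2 ^+ n.
  by rewrite /r exprS; field; rewrite gt_eqF.
have r2 n : r n = 2 * (s / 2 ^+ n) by rewrite /r mulrA.
pose a n := v n + r n.
have adec : {homo a : n k / (n <= k)%N >-> k <= n}.
  apply/nonincreasing_seqP => n; rewrite /a rS r2.
  have := step n; rewrite ler_norml => /andP[_]; lra.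
pose b n := v n - r n.
have binc : {homo b : n k / (n <= k)%N >-> n <= k}.
  apply/nondecreasing_seqP => n; rewrite /b rS r2.
  have := step n; rewrite ler_norml => /andP[+ _]; lra.
have r0 n : 0 <= r n by rewrite /r divr_ge0 ?mulr_ge0// ltW.
have ba n : b n <= a n by rewrite /a /b; have := r0 n; lra.
have acvg : cvgn a.
  apply: nonincreasing_is_cvgn => //; exists (b 0) => _ [n _ <-].
  by apply: le_trans (ba n); exact: binc.
have rcvg : r @ \oo --> 0.
  have /cvg_geometric : `|2^-1 : R| < 1 by rewrite gtr0_norm ?invr_gt0// invf_lt1// ltr1n.
  move=> /(_ (2 * s)); rewrite (_ : geometric _ _ = r)//; apply/funext => n.
  by rewrite /geometric /= /r exprVn.
have vcvg : v @ \oo --> limn a.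
  rewrite (_ : v = a \- r); last by apply/funext => n /=; rewrite /a addrK.
  by rewrite -[limn a]subr0; exact: cvgB.
exists (limn a) => // n.
have le1 : limn a <= a n by apply: nonincreasing_cvgn_ge.
have bcvg : b @ \oo --> limn a.
  by rewrite -[limn a]subr0; exact: cvgB.
have le2 : b n <= limn a.
  by rewrite -(cvg_lim _ bcvg)//; apply: nondecreasing_cvgn_le => //; apply/cvg_ex; exists (limn a).
have : `|limn a - v n| <= r n by rewrite ler_norml; apply/andP; split; move: le1 le2; rewrite /a /b; lra.
rewrite -(@ler_pXn2r _ 2)// ?nnegrE// normr_sqr => /le_trans; apply.
by rewrite /r !exprMn exprVn exprAC sg (_ : 2 ^+ 2 = 4 :> R)//; ring.
Qed.

Lemma sum_half_le2 n : \sum_(0 <= i < n) (2 : R) ^- i <= 2.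
Proof.
suff -> : \sum_(0 <= i < n) (2 : R) ^- i = 2 - 2 / 2 ^+ n.
  by rewrite gerBl divr_ge0// exprn_ge0.
elim: n => [|n IH]; first by rewrite big_geq// expr0 divr1 subrr.
rewrite big_nat_recr//= IH exprS.
by field; rewrite expf_neq0// pnatr_eq0.
Qed.

Context (m : {measure set (measurableTypeR R) -> \bar R}).

Let ipB_sym (F G : R -> R) : ip m (fun x => F x - G x) (fun x => F x - G x) =
  ip m (fun x => G x - F x) (fun x => G x - F x).
Proof. by rewrite /ip; congr Rintegral; apply/funext => x; ring. Qed.

(** The weights 4^i turn the mean square increments 8^-i into 2^-i, so the weighted sum g is
    integrable and finite almost everywhere. There the sequence converges geometrically and 4 g /
    4^n dominates the squared error. *)
Let fast_limit (v : nat -> R -> R) : (forall n, l2 m (v n)) ->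
  (forall i, ip m (fun x => v i.+1 x - v i x) (fun x => v i.+1 x - v i x) <= 8 ^- i) ->
  exists2 F, l2 m F & exists2 c : R, 0 <= c & forall n,
    ip m (fun x => F x - v n x) (fun x => F x - v n x) <= c / 4 ^+ n.
Proof.
move=> lv vfast.
pose t i x : R := 4 ^+ i * (v i.+1 x - v i x) ^+ 2.
have t0 i x : 0 <= t i x by rewrite mulr_ge0 ?sqr_ge0 ?exprn_ge0.
have ld i : l2 m (fun x => v i.+1 x - v i x) by exact: l2B.
have mt i : measurable_fun [set: measurableTypeR R] (t i).
  by apply: measurable_funM => //; apply: measurable_funX; exact: (ld i).1.
have it i : (\int[m]_x (t i x)%:E <= (2 ^- i)%:E)%E.
  have ii : m.-integrable setT (EFin \o t i) by apply: integrable_scale; exact: (ld i).2.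
  rewrite -(fineK (integrable_fin_num measurableT ii)) lee_fin -/(Rintegral m setT (t i)).
  rewrite Rintegral_scale; last exact: (ld i).2.
  have := vfast i; rewrite /ip (_ : (fun x => _ * _) = (fun x => (v i.+1 x - v i x) ^+ 2)); last first.
    by apply/funext => x; rewrite expr2.
  move=> h; apply: le_trans (ler_wpM2l _ h) _; first by rewrite exprn_ge0.
  by rewrite -[8 ^- i]exprVn -exprMn (_ : 4 / 8 = 2^-1 :> R) ?exprVn//; field.
pose g x : \bar R := (\sum_(0 <= i <oo) (t i x)%:E)%E.
have mg : measurable_fun [set: measurableTypeR R] g.
  by apply: ge0_emeasurable_sum => // [i x _ _|i _]; [rewrite lee_fin|exact/measurable_EFinP].
have g0 x : (0 <= g x)%E by apply: nneseries_ge0 => i _ _; rewrite lee_fin.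
have ig2 : (\int[m]_x g x <= 2%:E)%E.
  rewrite integral_nneseries//; last 2 first.
  - by move=> i; exact/measurable_EFinP.
  - by move=> i x _; rewrite lee_fin.
  apply: lime_le.
    apply: is_cvg_ereal_nneg_natsum_cond => n _ _.
    by apply: integral_ge0 => x _; rewrite lee_fin.
  apply: nearW => n; apply: (@le_trans _ _ (\sum_(0 <= i < n) (2 ^- i)%:E)%E).
    by apply: lee_sum => i _; exact: it.
  by rewrite sumEFin lee_fin; exact: sum_half_le2.
have ig2l : (\int[m]_x g x < +oo)%E by apply: le_lt_trans ig2 _; rewrite ltry.
have ig : m.-integrable setT g.
  apply/integrableP; split=> //; under eq_integral do rewrite gee0_abs//.
  by apply: le_lt_trans ig2 _; rewrite ltry.
have aeg : {ae m, forall x, forall i, 4 ^+ i * (v i.+1 x - v i x) ^+ 2 <= fine (g x)}.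
  have := integrable_ae measurableT ig; apply: ae_mono => x /= /(_ Logic.I) gf i.
  rewrite -lee_fin fineK//; apply: le_trans (nneseries_lim_ge i.+1 _); last by move=> n _ _; rewrite lee_fin.
  by rewrite big_nat_recr//= leeDr// sume_ge0// => j _; rewrite lee_fin.
(* An upper limit is measurable on the whole line and equals the limit almost everywhere. *)
pose F x := fine (limn_esup (fun n => (v n x)%:E)).
have mF : measurable_fun [set: measurableTypeR R] F.
  apply: measurableT_comp; first exact: fine_measurable.
  by apply: measurable_fun_limn_esup => n; apply/measurable_EFinP; exact: (lv n).1.
have aeF : {ae m, forall x, forall n, (F x - v n x) ^+ 2 <= 4 * fine (g x) / 4 ^+ n}.
  apply: ae_mono aeg => x /geometric_increments_cvg[l vl bl].
  suff -> : F x = l by [].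
  have h : (fun n => (v n x)%:E) @ \oo --> l%:E by apply: cvg_EFin => //; exact: nearW.
  by rewrite /F (cvg_limn_einf_sup h).2.
have ifg : m.-integrable setT (EFin \o (fun x => fine (g x))).
  apply/integrableP; split; first by apply/measurable_EFinP; apply: measurableT_comp mg; exact: fine_measurable.
  apply: le_lt_trans ig2l; apply: ge0_le_integral => //.
  - by apply: measurableT_comp => //; apply/measurable_EFinP; apply: measurableT_comp mg; exact: fine_measurable.
  - by move=> x _; rewrite /= ger0_norm ?fine_ge0//; case: (g x) (g0 x).
have ilim n : m.-integrable setT (EFin \o (fun x => (F x - v n x) ^+ 2)) /\
    \int[m]_x ((F x - v n x) ^+ 2) <= 4 * (\int[m]_x fine (g x)) / 4 ^+ n.
  have mq : measurable_fun [set: measurableTypeR R] (fun x => (F x - v n x) ^+ 2).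
    by apply: measurable_funX; apply: measurable_funB => //; exact: (lv n).1.
  pose c := 4 / 4 ^+ n : R.
  have icg := integrable_scale c ifg.
  have le : (\int[m]_x ((F x - v n x) ^+ 2)%:E <= \int[m]_x (c * fine (g x))%:E)%E.
    apply: ae_ge0_le_integral => //.
    - by move=> x _; rewrite lee_fin sqr_ge0.
    - exact/measurable_EFinP.
    - by move=> x _; rewrite lee_fin mulr_ge0 ?fine_ge0// divr_ge0// exprn_ge0.
    - by have /integrableP[] := icg.
    - apply: ae_mono aeF => x /(_ n) h _; rewrite lee_fin; apply: le_trans h _.
      by rewrite /c mulrAC.
  have fin := integrable_fin_num measurableT icg.
  have iq : m.-integrable setT (EFin \o (fun x => (F x - v n x) ^+ 2)).
    apply/integrableP; split; first exact/measurable_EFinP.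
    under eq_integral do rewrite /= ger0_norm ?sqr_ge0//.
    by apply: le_lt_trans le _; rewrite -(fineK fin) ltry.
  split=> //; rewrite (_ : 4 * _ / _ = c * \int[m]_x fine (g x)); last by rewrite /c mulrAC.
  rewrite -Rintegral_scale// -lee_fin /Rintegral fineK ?(integrable_fin_num measurableT iq)//.
  by rewrite fineK.
have lF : l2 m F.
  have h0 : l2 m (fun x => F x - v 0 x).
    by split; [apply: measurable_funB => //; exact: (lv 0).1|exact: (ilim 0).1].
  have := l2D h0 (lv 0); rewrite (_ : (fun x => _) = F)//.
  by apply/funext => x; rewrite subrK.
exists F => //; exists (4 * (\int[m]_x fine (g x))).
  by rewrite mulr_ge0//; apply: Rintegral_ge0 => x _; exact: fine_ge0.
move=> n; have [_] := ilim n; rewrite /ip.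
by rewrite (_ : (fun x => (F x - v n x) ^+ 2) = (fun x => (F x - v n x) * (F x - v n x)))//.
Qed.

Lemma l2_complete (u : nat -> R -> R) : (forall n, l2 m (u n)) ->
  (forall e, 0 < e -> exists N, forall p n, (N <= p)%N -> (N <= n)%N ->
    ip m (fun x => u p x - u n x) (fun x => u p x - u n x) < e) ->
  exists2 F, l2 m F & forall e, 0 < e -> exists N, forall n, (N <= n)%N ->
    ip m (fun x => u n x - F x) (fun x => u n x - F x) < e.
Proof.
move=> lu cu.
have h i : {N | forall p n, (N <= p)%N -> (N <= n)%N ->
    ip m (fun x => u p x - u n x) (fun x => u p x - u n x) < 8 ^- i}.
  by apply: cid; apply: cu; rewrite invr_gt0 exprn_gt0.
(* Summing the thresholds makes the indices nondecreasing and at least as large as each threshold;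
   the successors force k n > n. *)
pose k n := (\sum_(i < n.+1) (projT1 (h i)).+1)%N.
have kn n p : (k n <= p)%N -> (projT1 (h n) <= p)%N.
  by apply: leq_trans; rewrite /k big_ord_recr; apply: leq_trans (leq_addl _ _).
have kS n : (k n <= k n.+1)%N by rewrite /k [X in (_ <= X)%N]big_ord_recr leq_addr.
have [|i|F lF [c c0 Fc]] := @fast_limit (fun n => u (k n)).
- by move=> n; exact: lu.
- by apply/ltW/(projT2 (h i)); apply: kn.
exists F => // e e0.
have [N uN] := cu (e / 4) (divr_gt0 e0 (ltr0Sn _ 3)).
have [n [Nn cn]] : exists n, (N <= k n)%N /\ c / 4 ^+ n < e / 4.
  have cv : (fun n => c / 4 ^+ n) @ \oo --> (0 : R).
    have /cvg_geometric : `|4^-1 : R| < 1 by rewrite gtr0_norm ?invr_gt0// invf_lt1// ltr1n.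
    move=> /(_ c); rewrite (_ : geometric _ _ = (fun n => c / 4 ^+ n))//; apply/funext => n.
    by rewrite /geometric /= exprVn.
  have /cvgr0_norm_lt /(_ (e / 4)) := cv; case=> [|M _ cM]; first by rewrite divr_gt0.
  have nk n : (n < k n)%N.
    elim: n => [|n IH]; first by rewrite /k big_ord1.
    rewrite /k big_ord_recr /=; apply: (@leq_trans (k n).+1) => //.
    by rewrite -addn1 leq_add2l.
  exists (N + M)%N; split; first by apply: leq_trans (ltnW (nk _)); exact: leq_addr.
  by have := cM (N + M)%N (leq_addl _ _); apply: le_lt_trans; exact: ler_norm.
exists N => p Np.
have -> : (fun x => u p x - F x) = (fun x => (u p x - u (k n) x) + (u (k n) x - F x)).
  by apply/funext => x; ring.
apply: le_lt_trans (ip_sum_sqr _ _) _; [exact: l2B|exact: l2B|].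
have := uN p (k n) Np Nn; have := Fc n; rewrite ipB_sym => /le_lt_trans /(_ cn); lra.
Qed.

End RieszFischer.

(** * L^2 as a Hilbert space of classes *)

Section L2Space.
Context {R : realType} (m : {measure set (measurableTypeR R) -> \bar R}).
Implicit Types F G K : R -> R.

(* L^2(m)-classes are realized as the functionals [ip m F] on L^2(m), extended
   by 0: two functions give the same functional iff they are a.e. equal. *)
Definition l2_functional F : (R -> R) -> R := fun G => if pselect (l2 m G) then ip m F G else 0.

Definition l2_pred : {pred ((R -> R) -> R)} :=
  [pred phi | `[< exists2 F, l2 m F & phi = l2_functional F >]].

Lemma l2_functionalD F G : l2 m F -> l2 m G ->
  l2_functional (fun x => F x + G x) = l2_functional F + l2_functional G.
Proof.
move=> lF lG; apply/funext => K; rewrite /= fctE /l2_functional.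
by case: pselect => [lK|_] /=; rewrite ?addr0// ipDl.
Qed.

Lemma l2_functionalZ a F : l2 m F ->
  l2_functional (fun x => a * F x) = a *: l2_functional F.
Proof.
move=> lF; apply/funext => K; rewrite /= fctE /l2_functional /GRing.scale /=.
by case: pselect => [lK|_] /=; rewrite ?mulr0// ipZl.
Qed.

Lemma l2_functional0 : l2_functional (fun=> 0) = 0.
Proof.
apply/funext => K; rewrite /l2_functional; case: pselect => //= lK.
rewrite (_ : (fun=> 0) = (fun x : R => 0 * 0 : R)); last by apply/funext => x; rewrite mulr0.
by rewrite (ipZl 0 (l2_0 m) lK) mul0r.
Qed.

Lemma l2_pred_submod : GRing.submod_closed l2_pred.
Proof.
split=> [|a u v]; first by apply/asboolP; exists (fun=> 0); [exact: l2_0|rewrite l2_functional0].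
move=> /asboolP[F lF ->] /asboolP[G lG ->]; apply/asboolP.
exists (fun x => a * F x + G x); first by apply: l2D => //; exact: l2Z.
by rewrite l2_functionalD ?l2_functionalZ//; exact: l2Z.
Qed.

HB.instance Definition _ := GRing.isSubmodClosed.Build R ((R -> R) -> R) l2_pred l2_pred_submod.

Definition l2space := {phi : (R -> R) -> R | phi \in l2_pred}.
HB.instance Definition _ := SubType.on l2space.
HB.instance Definition _ := Choice.on l2space.
HB.instance Definition _ := [SubChoice_isSubLmodule of l2space by <:].

Definition l2_class F : l2space := insubd (0 : l2space) (l2_functional F).

Lemma l2_classK F : l2 m F -> val (l2_class F) = l2_functional F.
Proof.
by move=> lF; rewrite /l2_class val_insubd (_ : _ \in _ = true)//; apply/asboolP; exists F.
Qed.

Lemma l2_class_ex (u : l2space) : exists2 F, l2 m F & u = l2_class F.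
Proof.
by have /asboolP[F lF uF] := valP u; exists F => //; apply/val_inj; rewrite l2_classK.
Qed.

Definition l2_rep (u : l2space) : R -> R := projT1 (cid2 (l2_class_ex u)).

Lemma l2_repP u : l2 m (l2_rep u). Proof. by rewrite /l2_rep; case: cid2. Qed.

Lemma l2_repK u : l2_class (l2_rep u) = u. Proof. by rewrite /l2_rep; case: cid2. Qed.

Lemma l2_class_eq F G : l2 m F -> l2 m G ->
  l2_class F = l2_class G <-> {ae m, forall x, F x = G x}.
Proof.
move=> lF lG; split=> [FG|FG]; last first.
  apply/val_inj; rewrite !l2_classK//; apply/funext => K; rewrite /l2_functional.
  by case: pselect => //= lK; exact: ip_ae.
have FGK K : l2 m K -> ip m F K = ip m G K.
  move=> lK; have := congr1 (fun u => val u K) FG; rewrite /= !l2_classK// /l2_functional.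
  by case: pselect.
have lB := l2B lF lG.
have : ip m (fun x => F x - G x) (fun x => F x - G x) = 0 by rewrite ipBl// FGK// subrr.
by move=> /(ip_eq0 lB); apply: ae_mono => x /eqP; rewrite subr_eq0 => /eqP.
Qed.

Lemma l2_classD F G : l2 m F -> l2 m G ->
  l2_class (fun x => F x + G x) = l2_class F + l2_class G.
Proof.
move=> lF lG; apply/val_inj; rewrite raddfD /= !l2_classK//; last exact: l2D.
exact: l2_functionalD.
Qed.

Lemma l2_classZ a F : l2 m F -> l2_class (fun x => a * F x) = a *: l2_class F.
Proof.
move=> lF; apply/val_inj; rewrite linearZ /= !l2_classK//; last exact: l2Z.
exact: l2_functionalZ.
Qed.

Lemma l2_class0 : l2_class (fun=> 0) = 0.
Proof. by apply/val_inj; rewrite raddf0 l2_classK ?l2_functional0//; exact: l2_0. Qed.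

Lemma l2_classB F G : l2 m F -> l2 m G ->
  l2_class (fun x => F x - G x) = l2_class F - l2_class G.
Proof.
move=> lF lG; rewrite -scaleN1r -l2_classZ// -l2_classD//; last exact: l2Z.
by congr l2_class; apply/funext => x; rewrite mulN1r.
Qed.

Definition l2_ip (u v : l2space) : R := ip m (l2_rep u) (l2_rep v).

Lemma l2_rep_class F : l2 m F -> {ae m, forall x, l2_rep (l2_class F) x = F x}.
Proof. by move=> lF; apply/l2_class_eq => //; [exact: l2_repP|rewrite l2_repK]. Qed.

Lemma l2_ipE F G : l2 m F -> l2 m G -> l2_ip (l2_class F) (l2_class G) = ip m F G.
Proof.
move=> lF lG; have [rF rG] := (l2_repP (l2_class F), l2_repP (l2_class G)).
rewrite /l2_ip (ip_ae rF lF rG (l2_rep_class lF)) ipC (ip_ae rG lG lF (l2_rep_class lG)).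
exact: ipC.
Qed.

Lemma l2_hilbert : hilbert_axioms l2_ip.
Proof.
split.
- by move=> x y; rewrite /l2_ip ipC.
- move=> x y z; have [lx [ly lz]] := (l2_repP x, (l2_repP y, l2_repP z)).
  rewrite -[in LHS](l2_repK x) -[in LHS](l2_repK y) -[in LHS](l2_repK z).
  by rewrite -l2_classD// l2_ipE ?ipDl//; exact: l2D.
- move=> a x y; have [lx ly] := (l2_repP x, l2_repP y).
  rewrite -[in LHS](l2_repK x) -[in LHS](l2_repK y).
  by rewrite -l2_classZ// l2_ipE ?ipZl//; exact: l2Z.
- by move=> x; exact: ip_ge0.
- move=> x /(ip_eq0 (l2_repP x)) x0; rewrite -(l2_repK x) -l2_class0.
  by apply/l2_class_eq => //; [exact: l2_repP|exact: l2_0].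
- move=> u cu; pose U n := l2_rep (u n).
  have lU n : l2 m (U n) by exact: l2_repP.
  have uE a b F G : a = l2_class F -> b = l2_class G -> l2 m F -> l2 m G ->
    l2_ip (a - b) (a - b) = ip m (fun x => F x - G x) (fun x => F x - G x).
    by move=> -> -> lF lG; rewrite -l2_classB// l2_ipE//; exact: l2B.
  have [|e e0|F lF FU] := @l2_complete _ m U; [exact: lU| |].
    have [N uN] := cu e e0; exists N => p n Np Nn; have := uN p n Np Nn.
    by rewrite (uE _ _ (U p) (U n))// l2_repK.
  exists (l2_class F) => e e0; have [N uN] := FU e e0; exists N => n Nn.
  by rewrite (uE _ _ (U n) F) ?l2_repK//; exact: uN.
Qed.

End L2Space.

(** * The weak derivative in a weighted space *)

Section LocallyL2.
Context {R : realType}.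
Implicit Types (F G : R -> R) (a b : R).
Local Notation leb := (@lebesgue_measure R).

Lemma continuous_meas F : continuous F -> measurable_fun [set: measurableTypeR R] F.
Proof. by move=> /continuous_loc_integrable[]. Qed.

Lemma loc_integrable_dom F G : measurable_fun [set: measurableTypeR R] F -> loc_integrable G ->
  (forall x, `|F x| <= G x) -> loc_integrable F.
Proof.
move=> mF [mG iG] FG; split=> // a b; apply: (le_integrable _ _ _ (iG a b)) => //.
- by apply/measurable_EFinP; exact: measurable_funTS mF.
- by move=> x _ /=; rewrite lee_fin (le_trans (FG x))// ler_norm.
Qed.

Definition loc_l2 F : Prop := measurable_fun [set: measurableTypeR R] F /\
  loc_integrable (fun x => F x ^+ 2).

Lemma loc_l2_loc_integrable F : loc_l2 F -> loc_integrable F.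
Proof.
move=> [mF iF]; have i1 : loc_integrable (fun=> 1 : R).
  by apply: continuous_loc_integrable => x; exact: cvg_cst.
apply: (loc_integrable_dom mF (loc_integrableD iF i1)) => x.
rewrite -(normr_sqr (F x)); have := sqr_ge0 (`|F x| - 1); nra.
Qed.

Lemma loc_l2M F G : loc_l2 F -> loc_l2 G -> loc_integrable (fun x => F x * G x).
Proof.
move=> [mF iF] [mG iG]; apply: (loc_integrable_dom (measurable_funM mF mG) (loc_integrableD iF iG)) => x.
rewrite normrM -(normr_sqr (F x)) -(normr_sqr (G x)); have := sqr_ge0 (`|F x| - `|G x|).
have := normr_ge0 (F x); have := normr_ge0 (G x); nra.
Qed.

Lemma continuous_mul F G : continuous F -> continuous G -> continuous (fun x => F x * G x).
Proof. by move=> cF cG x; apply: cvgM; [exact: cF|exact: cG]. Qed.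

Lemma loc_l2_mul_continuous F G : loc_l2 F -> continuous G -> loc_l2 (fun x => F x * G x).
Proof.
move=> [mF iF] cG; split; first exact: measurable_funM mF (continuous_meas cG).
have := loc_integrableM iF (continuous_mul cG cG); congr loc_integrable.
by apply/funext => x; ring.
Qed.

Lemma continuous_loc_l2 F : continuous F -> loc_l2 F.
Proof.
move=> cF; split; first exact: continuous_meas.
rewrite (_ : (fun x => F x ^+ 2) = (fun x => F x * F x)) //.
exact: continuous_loc_integrable (continuous_mul cF cF).
Qed.

Lemma loc_l2D F G : loc_l2 F -> loc_l2 G -> loc_l2 (fun x => F x + G x).
Proof.
move=> lF lG; split; first exact: measurable_funD lF.1 lG.1.
have := loc_integrableD (loc_integrableD lF.2 lG.2) (loc_integrableD (loc_l2M lF lG) (loc_l2M lF lG)).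
by congr loc_integrable; apply/funext => x; ring.
Qed.

Lemma loc_l2_ae F G : measurable_fun [set: measurableTypeR R] G ->
  {ae leb, forall x, F x = G x} -> loc_l2 F -> loc_l2 G.
Proof.
move=> mG FG [mF [mF2 iF]]; split=> //; split; first exact: measurable_funX.
move=> a b; apply/integrableP; split.
  by apply/measurable_EFinP; apply: measurable_funTS; exact: measurable_funX.
have /integrableP[m1 h] := iF a b; apply: le_lt_trans h.
apply: ae_ge0_le_integral; first exact: measurable_itv.
- by move=> x _; exact: abse_ge0.
- by apply: measurableT_comp => //; apply/measurable_EFinP; apply: measurable_funTS; exact: measurable_funX.
- by move=> x _; exact: abse_ge0.
- exact: measurableT_comp.
- by apply: ae_mono FG => x /= -> _.
Qed.

(** The local Sobolev space, stated without a weight. It is stable under multiplication, in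
    particular by e and 1/e, and its compactly supported elements lie in W^{1,2} for every weight
    considered. *)
Definition wloc F : Prop := loc_ac_real F /\ loc_l2 (derive1 F).

Lemma wloc_continuous F : wloc F -> continuous F.
Proof. by move=> [/loc_ac_continuous]. Qed.

Lemma ae_derive1M F G : loc_ac_real F -> loc_ac_real G ->
  {ae leb, forall x, derive1 (fun y => F y * G y) x = derive1 F x * G x + F x * derive1 G x}.
Proof.
move=> aF aG; apply: ae_mono (ae_and (loc_ac_derivable aF) (loc_ac_derivable aG)) => x [dF dG].
exact: derive1_mul.
Qed.

Lemma ae_derive1D F G : loc_ac_real F -> loc_ac_real G ->
  {ae leb, forall x, derive1 (fun y => F y + G y) x = derive1 F x + derive1 G x}.
Proof.
move=> aF aG; apply: ae_mono (ae_and (loc_ac_derivable aF) (loc_ac_derivable aG)) => x [dF dG].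
exact: derive1_add.
Qed.

Lemma ae_derive1Z (c : R) F : loc_ac_real F ->
  {ae leb, forall x, derive1 (fun y => c * F y) x = c * derive1 F x}.
Proof.
move=> aF; apply: ae_mono (loc_ac_derivable aF) => x dF.
have [_ ->] := is_derive_derive1 (is_derive_mul (is_derive_const c x) (derivable_is_derive dF)).
by rewrite mul0r add0r.
Qed.

Lemma ae_sym_eq F G (m : {measure set (measurableTypeR R) -> \bar R}) :
  {ae m, forall x, F x = G x} -> {ae m, forall x, G x = F x}.
Proof. by apply: ae_mono => x ->. Qed.

Lemma meas_derive1 F : loc_ac_real F -> measurable_fun [set: measurableTypeR R] (derive1 F).
Proof. by move=> /loc_ac_continuous/measurable_derive1. Qed.

Lemma wlocM F G : wloc F -> wloc G -> wloc (fun x => F x * G x).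
Proof.
move=> [aF lF] [aG lG]; have aFG := loc_acM aF aG; split; first exact: aFG.
apply: (loc_l2_ae (meas_derive1 aFG) (ae_sym_eq (ae_derive1M aF aG))).
apply: loc_l2D; first exact: loc_l2_mul_continuous lF (loc_ac_continuous aG).
rewrite (_ : (fun x => _) = (fun x => derive1 G x * F x)); last by apply/funext => x; rewrite mulrC.
exact: loc_l2_mul_continuous lG (loc_ac_continuous aF).
Qed.

Lemma wloc_C1 F : (forall x, derivable F x 1) -> continuous (derive1 F) -> wloc F.
Proof. by move=> dF cF; split; [exact: loc_ac_C1|exact: continuous_loc_l2]. Qed.

Lemma test_fun_wloc F : test_fun F -> wloc F.
Proof.
move=> [sF _]; apply: wloc_C1; first exact: smooth_derivable.
exact: smooth_continuous (smooth_derive1 sF).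
Qed.

Lemma ae_eq_continuous F G : continuous F -> continuous G ->
  {ae leb, forall x, F x = G x} -> F = G.
Proof.
move=> cF cG FG; apply/funext => x; apply/eqP; rewrite -subr_eq0; apply/eqP; apply/not_notP => nz.
pose D y : R := F y - G y.
have cD : {for x, continuous D} by apply: cvgB; [exact: cF|exact: cG].
have : \forall y \near x, D y != 0.
  have n0 : 0 < `|D x| by rewrite normr_gt0; apply/eqP.
  have /cvgr_dist_lt /(_ _ n0) : D @ x --> D x := cD.
  apply: filterS => y; rewrite distrC; apply: contraTneq => ->; rewrite sub0r normrN; lra.
move=> /nbhs_ballP[e /= e0 De].
have h : leb.-negligible `]x, (x + e)%R[%classic.
  have [A [mA A0 sA]] := FG; exists A; split => // y /=; rewrite in_itv/= => /andP[xy ye].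
  apply: sA => /= E; have : D y != 0.
    by apply: De; rewrite /= /ball/= ltr_norml; apply/andP; split; lra.
  by rewrite /D E subrr eqxx.
have [A [mA A0 sA]] := h.
have : leb (`]x, (x + e)%R[%classic : set (measurableTypeR R)) = 0%E.
  by apply: (@subset_measure0 _ _ _ leb _ A) => //; exact: measurable_itv.
rewrite lebesgue_measure_itv /= lte_fin ltrDl e0 -EFinD => -[] /eqP; rewrite addrAC subrr add0r gt_eqF//.
Qed.

(** Trapezoids equal to 1 on [-n, n] and to 0 beyond n + 1. The unit slope bounds the derivative
    independently of n, and growth in n permits monotone convergence. *)
Definition cutoff (n : nat) (x : R) : R := Num.max 0 (Num.min 1 (n.+1%:R - `|x|)).

Lemma cutoff_ge0 n x : 0 <= cutoff n x. Proof. by rewrite /cutoff le_max lexx. Qed.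

Lemma cutoff_le1 n x : cutoff n x <= 1.
Proof. by rewrite /cutoff ge_max ler01 ge_min lexx. Qed.

Lemma cutoff_eq1 n x : `|x| <= n%:R -> cutoff n x = 1.
Proof.
move=> xn; rewrite /cutoff (@min_l _ _ 1); last by rewrite -natr1; lra.
by rewrite max_r.
Qed.

Lemma cutoff_eq0 n x : n.+1%:R < `|x| -> cutoff n x = 0.
Proof. by move=> xn; rewrite /cutoff max_l// ge_min; apply/orP; right; lra. Qed.

Lemma cutoff_homo n p x : (n <= p)%N -> cutoff n x <= cutoff p x.
Proof.
move=> np; rewrite /cutoff; apply: le_max2 => //; apply: le_min2 => //.
by rewrite lerD2r ler_nat.
Qed.

Let clamp_lip1 (k a b c : R) : b - a <= c -> a - b <= c ->
  `|Num.max 0 (Num.min 1 (k - b)) - Num.max 0 (Num.min 1 (k - a))| <= c.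
Proof.
move=> h1 h2; rewrite ler_norml; case: (leP 1 (k - b)) => ?; case: (leP 1 (k - a)) => ?.
- by case: (leP 0 1) => ?; apply/andP; split; lra.
- by case: (leP 0 1) => ?; case: (leP 0 (k - a)) => ?; apply/andP; split; lra.
- by case: (leP 0 1) => ?; case: (leP 0 (k - b)) => ?; apply/andP; split; lra.
- by case: (leP 0 (k - a)) => ?; case: (leP 0 (k - b)) => ?; apply/andP; split; lra.
Qed.

Lemma cutoff_lip n x y : `|cutoff n y - cutoff n x| <= `|y - x|.
Proof.
have := ler_dist_dist y x; rewrite ler_norml => /andP[h1 h2].
by apply: clamp_lip1; lra.
Qed.

(** At points without a derivative the default value 0 satisfies the bound as well. *)
Lemma lip_derive1 F (x : R) : (forall y z, `|F y - F z| <= `|y - z|) -> `|derive1 F x| <= 1.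
Proof.
move=> lipF; have [|/derive1_dvg ->] := pselect (derivable F x 1); last by rewrite normr0 ler01.
move=> dF; have /derivable_quotient c := dF.
have dE : h^-1 * (F (h + x) - F x) @[h --> 0^'] --> derive1 F x := c.
rewrite -(cvg_lim _ (cvg_norm dE))//; apply: limr_le; first by apply/cvg_ex; exists `|derive1 F x|; exact: cvg_norm.
apply: nearW => h; rewrite normrM normfV.
have [->|h0] := eqVneq h 0; first by rewrite normr0 invr0 mul0r ler01.
rewrite mulrC ler_pdivrMr ?normr_gt0// mul1r; apply: le_trans (lipF _ _) _.
by rewrite addrK.
Qed.

Lemma cutoff_derive1_le1 n x : `|derive1 (cutoff n) x| <= 1.
Proof. by apply: lip_derive1 => y z; exact: cutoff_lip. Qed.

Lemma cutoff_derive1_eq0 n x : `|x| < n%:R -> derive1 (cutoff n) x = 0.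
Proof.
move=> xn; rewrite (@near_derive1 _ _ (fun=> 1)); last first.
  have h : \forall y \near x, `|y| < n%:R by apply: (cvgr_lt _ (@norm_continuous _ _ x)).
  by apply: filterS h => y yn; exact/cutoff_eq1/ltW.
by rewrite derive1_cst.
Qed.

Lemma cutoff_wloc n : wloc (cutoff n).
Proof.
have ac : loc_ac_real (cutoff n).
  apply: loc_ac_lip => a b; exists 1 => x y _ xy _.
  by rewrite mul1r; apply: le_trans (cutoff_lip n x y) _; rewrite ger0_norm ?subr_ge0.
split=> //; split; first exact: meas_derive1.
have i1 : loc_integrable (fun=> 1 : R).
  by apply: continuous_loc_integrable => x; exact: cvg_cst.
apply: (loc_integrable_dom _ i1) => [|x]; first by apply: measurable_funX; exact: meas_derive1.
by rewrite normrX exprn_ile1// cutoff_derive1_le1.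
Qed.

Lemma cutoff_cvg (x : R) : cutoff n x @[n --> \oo] --> (1 : R).
Proof.
apply: cvg_near_cst; exists (Num.bound `|x|) => // n /= bn; apply: cutoff_eq1.
apply/ltW/(lt_le_trans (archi_boundP _)); rewrite ?ler_nat//.
Qed.

End LocallyL2.

(** * Weighted L^2 and the closure of the derivative *)

Section Weight.
Context {R : realType}.
Implicit Types (F G K : R -> R).
Local Notation leb := (@lebesgue_measure R).

(* The prefix r marks real-valued counterparts of the notions of Defs: [rD] is the
   closure of the derivative on test functions, [rW12] the Sobolev space. *)
Definition weight (m : {measure set (measurableTypeR R) -> \bar R}) (w : R -> R) : Prop :=
  [/\ forall x, 0 < w x, forall x, derivable w x 1, continuous (derive1 w) &
    forall A : set (measurableTypeR R), measurable A -> m A = (\int[leb]_(x in A) (w x)%:E)%E].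

Definition rD (m : {measure set (measurableTypeR R) -> \bar R}) F G : Prop :=
  [/\ l2 m F, l2 m G & forall e, 0 < e -> exists2 psi, test_fun psi &
    ip m (fun x => F x - psi x) (fun x => F x - psi x) < e /\
    ip m (fun x => G x - derive1 psi x) (fun x => G x - derive1 psi x) < e].

Definition rW12 (m : {measure set (measurableTypeR R) -> \bar R}) F : Prop :=
  [/\ loc_ac_real F, l2 m F & l2 m (derive1 F)].

Variables (m : {measure set (measurableTypeR R) -> \bar R}) (w : R -> R).
Hypothesis hw : weight m w.

Lemma weight_gt0 x : 0 < w x. Proof. by case: hw. Qed.

Lemma weight_wloc : wloc w.
Proof. by case: hw => _ dw cw _; exact: wloc_C1. Qed.

Lemma weight_continuous : continuous w. Proof. exact: wloc_continuous weight_wloc. Qed.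

Lemma weight_meas : measurable_fun [set: measurableTypeR R] w.
Proof. exact: continuous_meas weight_continuous. Qed.

Lemma weightV_continuous : continuous (fun x => (w x)^-1).
Proof. by move=> x; apply: cvgV; [rewrite gt_eqF// weight_gt0|exact: weight_continuous]. Qed.

Let w_ge0 x : 0 <= w x. Proof. exact/ltW/weight_gt0. Qed.

Lemma weight_ae (P : R -> Prop) : {ae m, forall x, P x} <-> {ae leb, forall x, P x}.
Proof.
case: hw => _ _ _ mE.
have mw (A : set (measurableTypeR R)) : measurable_fun A (EFin \o w).
  by apply/measurable_EFinP; exact: measurable_funTS weight_meas.
split=> -[A [mA A0 PA]].
  have : (\int[leb]_(x in A) `|(w x)%:E| = 0)%E.
    rewrite -A0 mE//; apply: eq_integral => x _.
    by rewrite gee0_abs// lee_fin.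
  move=> /(ae_eq_integral_abs leb mA (mw A)).1 => -[B [mB B0 AB]].
  exists B; split => // x /PA Ax; apply: AB => /= /(_ Ax) [] /eqP.
  by rewrite gt_eqF// weight_gt0.
exists A; split => //; rewrite mE//.
exact: null_set_integral.
Qed.

Lemma weight_integrable F : measurable_fun [set: measurableTypeR R] F ->
  m.-integrable setT (EFin \o F) <-> leb.-integrable setT (EFin \o (fun x => F x * w x)).
Proof.
by case: hw => _ _ _ mE mF; exact: (integrable_density weight_meas w_ge0 mE mF).
Qed.

Lemma weight_Rintegral F : measurable_fun [set: measurableTypeR R] F ->
  \int[m]_x F x = \int[leb]_x (F x * w x).
Proof.
by case: hw => _ _ _ mE mF; exact: (Rintegral_density weight_meas w_ge0 mE mF).
Qed.

Lemma weight_ip F G : measurable_fun [set: measurableTypeR R] F ->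
  measurable_fun [set: measurableTypeR R] G -> ip m F G = \int[leb]_x (F x * G x * w x).
Proof. by move=> mF mG; rewrite /ip weight_Rintegral//; exact: measurable_funM. Qed.

Lemma l2_loc F : l2 m F -> loc_l2 F.
Proof.
move=> [mF iF]; split=> //.
have mF2 : measurable_fun [set: measurableTypeR R] (fun x => F x ^+ 2) by exact: measurable_funX.
have lFw : loc_integrable (fun x => F x ^+ 2 * w x).
  split; first exact: measurable_funM mF2 weight_meas.
  by move=> a b; apply: integrableS ((weight_integrable mF2).1 iF) => //; exact: measurable_itv.
have := loc_integrableM lFw weightV_continuous; congr loc_integrable; apply/funext => x.
by rewrite mulfK// gt_eqF// weight_gt0.
Qed.

Lemma loc_l2_cpt F M : loc_l2 F -> (forall x, M < `|x| -> F x = 0) -> l2 m F.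
Proof.
move=> [mF lF] F0; split=> //; apply/weight_integrable; first exact: measurable_funX.
apply: (loc_integrable_cpt (M := M)); first exact: loc_integrableM lF weight_continuous.
by move=> x /F0 ->; rewrite expr0n/= mul0r.
Qed.

Lemma wloc_cpt_rW12 F M : wloc F -> (forall x, M < `|x| -> F x = 0) -> rW12 m F.
Proof.
move=> [aF lF] F0; split=> //.
  exact: loc_l2_cpt (continuous_loc_l2 (loc_ac_continuous aF)) F0.
by apply: (loc_l2_cpt (M := M) lF) => x; exact: derive1_eq0_cpt.
Qed.

Lemma test_fun_rW12 F : test_fun F -> rW12 m F.
Proof. by move=> tF; have [_ [M F0]] := tF; exact: wloc_cpt_rW12 (test_fun_wloc tF) F0. Qed.

Lemma ip_CS F G : l2 m F -> l2 m G -> ip m F G ^+ 2 <= ip m F F * ip m G G.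
Proof.
move=> lF lG; have := hilb_CS (l2_hilbert m) (l2_class m F) (l2_class m G).
by rewrite !l2_ipE.
Qed.

(** By Cauchy-Schwarz, replacing (F, G) by a test pair at squared distances below e changes the left
    side by at most sqrt(2 C e). Identities known on test functions thus pass to the closure. *)
Lemma rD_ip_limit F G A B c : rD m F G -> l2 m A -> l2 m B ->
  (forall psi, test_fun psi -> ip m A psi + ip m B (derive1 psi) = c) ->
  ip m A F + ip m B G = c.
Proof.
move=> [lF lG FG] lA lB AB; apply/eqP; rewrite -subr_eq0; apply/eqP.
pose C := ip m A A + ip m B B + 1.
have C0 : 0 < C by rewrite /C; have := ip_ge0 m A; have := ip_ge0 m B; lra.
suff h e : 0 < e -> (ip m A F + ip m B G - c) ^+ 2 <= 2 * C * e.
  apply/eqP; rewrite -sqrf_eq0 eq_le sqr_ge0 andbT; apply/ler_addgt0Pr => e e0.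
  rewrite add0r; have C2 : 0 < 2 * C by rewrite mulr_gt0.
  by have := h (e / (2 * C)) (divr_gt0 e0 C2); rewrite mulrC divfK// gt_eqF.
move=> e0; have [psi tp [p1 p2]] := FG e e0.
have [_ lp lp'] := test_fun_rW12 tp.
rewrite -(AB psi tp).
have -> : ip m A F + ip m B G - (ip m A psi + ip m B (derive1 psi)) =
  ip m A (fun x => F x - psi x) + ip m B (fun x => G x - derive1 psi x).
  by rewrite !ipBr//; ring.
have := ip_CS lA (l2B lF lp); have := ip_CS lB (l2B lG lp').
move: p1 p2 (ip_ge0 m A) (ip_ge0 m B).
rewrite /C; move: (ip m A _) (ip m B _) (ip m A A) (ip m B B) (ip m _ _) (ip m _ _) => u v a b f g.
move=> fe ge a0 b0 hv hu.
have : u ^+ 2 <= a * e by apply: le_trans hu _; rewrite ler_wpM2l// ltW.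
have : v ^+ 2 <= b * e by apply: le_trans hv _; rewrite ler_wpM2l// ltW.
have := sqr_ge0 (u - v); nra.
Qed.

(** Pairing with phi' / w and phi / w, which are compactly supported and continuous, cancels the
    weight; integration by parts on test functions then passes to the closure. *)
Lemma rD_weak F G phi : rD m F G -> test_fun phi ->
  \int[leb]_x (G x * phi x) + \int[leb]_x (F x * derive1 phi x) = 0.
Proof.
move=> FG tp; have [lF lG _] := FG; have [sp [M p0]] := tp.
have cp := smooth_continuous sp; have cp' := smooth_continuous (smooth_derive1 sp).
have lA : l2 m (fun x => derive1 phi x * (w x)^-1).
  apply: (loc_l2_cpt (M := M)); first exact: continuous_loc_l2 (continuous_mul cp' weightV_continuous).
  by move=> x Mx; rewrite (derive1_eq0_cpt p0)// mul0r.
have lB : l2 m (fun x => phi x * (w x)^-1).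
  apply: (loc_l2_cpt (M := M)); first exact: continuous_loc_l2 (continuous_mul cp weightV_continuous).
  by move=> x Mx; rewrite p0// mul0r.
have wE (f g : R -> R) : measurable_fun [set: measurableTypeR R] f -> continuous g ->
   ip m (fun x => g x * (w x)^-1) f = \int[leb]_x (f x * g x).
  move=> mf cg; rewrite weight_ip//; last by apply: continuous_meas; exact: continuous_mul cg weightV_continuous.
  congr Rintegral; apply/funext => x; have := weight_gt0 x; move=> w0; field; exact: lt0r_neq0.
rewrite addrC -!wE//; [|exact: l2_meas lG|exact: l2_meas lF].
apply: (rD_ip_limit FG lA lB) => psi tpsi.
have [aps _ _] := test_fun_rW12 tpsi; have aph := test_fun_ac tp.
have mps : measurable_fun [set: measurableTypeR R] psi.
  by apply: continuous_meas; exact: loc_ac_continuous.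
rewrite !wE//; last exact: meas_derive1.
by have [_ _ ->] := integral_by_parts_cpt aps aph p0; rewrite addNr.
Qed.

Lemma l2_ae_leb F G : measurable_fun [set: measurableTypeR R] G ->
  {ae leb, forall x, F x = G x} -> l2 m F -> l2 m G.
Proof. by move=> mG FG; apply: l2_ae => //; exact/weight_ae. Qed.

Lemma rD_ac F G : rD m F G -> exists2 F1, rW12 m F1 &
  {ae leb, forall x, F x = F1 x} /\ {ae leb, forall x, G x = derive1 F1 x}.
Proof.
move=> FG; have [lF lG _] := FG.
have LF := loc_l2_loc_integrable (l2_loc lF); have LG := loc_l2_loc_integrable (l2_loc lG).
have [c Fc] := du_Bois_Reymond LG LF (fun psi tp => rD_weak FG tp).
have aF1 : loc_ac_real ((fun=> c) \+ prim G) by apply: loc_acD; [exact: loc_ac_cst|exact: prim_loc_ac].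
have GF1 : {ae leb, forall x, G x = derive1 ((fun=> c) \+ prim G) x}.
  apply: ae_mono (ae_and (ae_derive1D (loc_ac_cst c) (prim_loc_ac LG)) (prim_derive LG)) => x [].
  by rewrite derive1_cst add0r => <- [_ ->].
exists ((fun=> c) \+ prim G) => //; split=> //.
- apply: l2_ae_leb Fc lF; exact: continuous_meas (loc_ac_continuous aF1).
- exact: l2_ae_leb (meas_derive1 aF1) GF1 lG.
Qed.

(** The du Bois-Reymond lemma with P = K w and Q = 0 makes the primitive of K w constant; its
    derivative K w vanishes a.e., and w is positive. *)
Lemma test_fun_dense K : l2 m K -> (forall psi, test_fun psi -> ip m K psi = 0) ->
  {ae leb, forall x, K x = 0}.
Proof.
move=> lK K0.
have LK : loc_integrable (fun x => K x * w x).
  exact: loc_integrableM (loc_l2_loc_integrable (l2_loc lK)) weight_continuous.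
have L0 : loc_integrable (fun=> 0 : R) by apply: continuous_loc_integrable => x; exact: cvg_cst.
have [|c c0] := du_Bois_Reymond LK L0.
  move=> psi tp; rewrite [X in _ + X](_ : _ = 0); last first.
    by under eq_Rintegral do rewrite mul0r; rewrite Rintegral_cst// mul0r.
  have [aps _ _] := test_fun_rW12 tp.
  rewrite addr0 -(K0 _ tp) weight_ip; first by congr Rintegral; apply/funext => x; ring.
    exact: lK.1.
  exact: continuous_meas (loc_ac_continuous aps).
have pc : prim (fun x => K x * w x) = (fun=> - c).
  apply: ae_eq_continuous; first exact: loc_ac_continuous (prim_loc_ac LK).
    by move=> x; exact: cvg_cst.
  by apply: ae_mono c0 => x h; apply/eqP; rewrite -addr_eq0 addrC -h.
apply: ae_mono (prim_derive LK) => x [_]; rewrite pc derive1_cst => /esym/eqP.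
by rewrite mulf_eq0 (gt_eqF (weight_gt0 x)) orbF => /eqP.
Qed.

Lemma rD_test psi : test_fun psi -> rD m psi (derive1 psi).
Proof.
move=> tp; have [_ lp lp'] := test_fun_rW12 tp; split=> // e e0; exists psi => //.
by rewrite /ip; split; under eq_Rintegral do rewrite subrr mul0r; rewrite Rintegral_cst// mul0r.
Qed.

Lemma ipD_lt4 F G e : l2 m F -> l2 m G -> ip m F F < e / 4 -> ip m G G < e / 4 ->
  ip m (fun x => F x + G x) (fun x => F x + G x) < e.
Proof.
move=> lF lG; have := ip_sum_sqr lF lG.
by move: (ip _ _ _) (ip _ _ _) (ip _ _ _) => u v z; clear; move=> h1 h2 h3; lra.
Qed.

Lemma ipB_lt4 (F G K : R -> R) e : l2 m F -> l2 m G -> l2 m K ->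
  ip m (fun x => F x - G x) (fun x => F x - G x) < e / 4 ->
  ip m (fun x => G x - K x) (fun x => G x - K x) < e / 4 ->
  ip m (fun x => F x - K x) (fun x => F x - K x) < e.
Proof.
move=> lF lG lK h1 h2.
have -> : (fun x => F x - K x) = (fun x => (F x - G x) + (G x - K x)) by apply/funext => x; ring.
by apply: ipD_lt4 => //; exact: l2B.
Qed.

Lemma rD_limit F G : l2 m F -> l2 m G ->
  (forall e, 0 < e -> exists F' G', [/\ rD m F' G',
    ip m (fun x => F x - F' x) (fun x => F x - F' x) < e &
    ip m (fun x => G x - G' x) (fun x => G x - G' x) < e]) -> rD m F G.
Proof.
move=> lF lG h; split=> // e e0; have e40 : 0 < e / 4 by rewrite divr_gt0.
have [F' [G' [[lF' lG' FG'] h1 h2]]] := h _ e40.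
have [psi tp [p1 p2]] := FG' _ e40; have [_ lp lp'] := test_fun_rW12 tp; exists psi => //.
by split; [exact: ipB_lt4 lF lF' lp h1 p1|exact: ipB_lt4 lG lG' lp' h2 p2].
Qed.

Let ip_sub_ae F G : l2 m F -> l2 m G -> {ae m, forall x, F x = G x} ->
  ip m (fun x => F x - G x) (fun x => F x - G x) = 0.
Proof.
move=> lF lG FG; have lB := l2B lF lG.
rewrite (ip_ae (G := fun=> 0) lB (l2_0 m) lB); last by apply: ae_mono FG => x ->; rewrite subrr.
by rewrite /ip; under eq_Rintegral do rewrite mul0r; rewrite Rintegral_cst// mul0r.
Qed.

Lemma rD_ae F G F' G' : rD m F G -> l2 m F' -> l2 m G' ->
  {ae m, forall x, F x = F' x} -> {ae m, forall x, G x = G' x} -> rD m F' G'.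
Proof.
move=> FG lF' lG' FF GG; have [lF lG _] := FG; apply: rD_limit => // e e0; exists F, G; split=> //.
- by rewrite ip_sub_ae//; exact: ae_sym_eq.
- by rewrite ip_sub_ae//; exact: ae_sym_eq.
Qed.

Lemma rDD F G F' G' : rD m F G -> rD m F' G' -> rD m (fun x => F x + F' x) (fun x => G x + G' x).
Proof.
move=> [lF lG FG] [lF' lG' FG']; split; [exact: l2D|exact: l2D|move=> e e0].
have e40 : 0 < e / 4 by rewrite divr_gt0.
have [p tp [p1 p2]] := FG _ e40; have [q tq [q1 q2]] := FG' _ e40.
have [_ lp lp'] := test_fun_rW12 tp; have [_ lq lq'] := test_fun_rW12 tq.
exists (fun x => p x + q x).
  have [[sp [M pM]] [sq [N qN]]] := (tp, tq); split; first exact: smoothD.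
  exists (Num.max M N) => x; rewrite gt_max => /andP[Mx Nx]; by rewrite pM// qN// addr0.
have dE : derive1 (fun x => p x + q x) = (fun x => derive1 p x + derive1 q x).
  by apply/funext => x; rewrite derive1_add//; apply: smooth_derivable; [case: tp|case: tq].
rewrite dE; split.
- rewrite (_ : (fun x => _ + _ - _) = (fun x => (F x - p x) + (F' x - q x))); last by apply/funext => x; ring.
  exact: (ipD_lt4 (l2B lF lp) (l2B lF' lq) p1 q1).
- rewrite (_ : (fun x => _ + _ - _) = (fun x => (G x - derive1 p x) + (G' x - derive1 q x))); last by apply/funext => x; ring.
  exact: (ipD_lt4 (l2B lG lp') (l2B lG' lq') p2 q2).
Qed.

Lemma rDZ a F G : rD m F G -> rD m (fun x => a * F x) (fun x => a * G x).
Proof.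
move=> [lF lG FG]; split; [exact: l2Z|exact: l2Z|move=> e e0].
have a0 : 0 < a ^+ 2 + 1 by have := sqr_ge0 a; lra.
have [p tp [p1 p2]] := FG _ (divr_gt0 e0 a0); have [_ lp lp'] := test_fun_rW12 tp.
have h K : l2 m K -> ip m K K < e / (a ^+ 2 + 1) -> ip m (fun x => a * K x) (fun x => a * K x) < e.
  move=> lK; rewrite ltr_pdivlMr// => hK; rewrite ipZl//; last exact: l2Z.
  by rewrite ipZr//; have := ip_ge0 m K; nra.
have dE : derive1 (fun x => a * p x) = (fun x => a * derive1 p x).
  apply/funext => x; have dp : derivable p x 1 by apply: smooth_derivable; case: tp.
  have [_ ->] := is_derive_derive1 (is_derive_mul (is_derive_const a x) (derivable_is_derive dp)).
  by rewrite mul0r add0r.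
exists (fun x => a * p x).
  have [sp [M pM]] := tp; split.
    by apply: (@smoothM _ (fun=> a) p); [exact: smooth_cst|exact: sp].
  by exists M => x /pM ->; rewrite mulr0.
rewrite dE; split.
- by rewrite (_ : (fun x => _ - _) = (fun x => a * (F x - p x)));
    [apply: h => //; exact: l2B|apply/funext => x; ring].
- by rewrite (_ : (fun x => _ - _) = (fun x => a * (G x - derive1 p x)));
    [apply: h => //; exact: l2B|apply/funext => x; ring].
Qed.

(** The closure acting on classes through chosen representatives; [hD_class] gives independence of
    the choice. *)
Definition hD (u v : l2space m) : Prop := rD m (l2_rep u) (l2_rep v).

Lemma hD_class F G : l2 m F -> l2 m G -> hD (l2_class m F) (l2_class m G) <-> rD m F G.
Proof.
move=> lF lG; have [rF rG] := (l2_rep_class lF, l2_rep_class lG).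
split=> h; first exact: rD_ae h lF lG rF rG.
by apply: (rD_ae h); [exact: l2_repP|exact: l2_repP|exact: ae_sym_eq|exact: ae_sym_eq].
Qed.

Lemma hD_lin : lin_graph hD.
Proof.
split.
- rewrite -!(l2_class0 m); apply/hD_class; [exact: l2_0|exact: l2_0|].
  have t0 : test_fun (fun=> 0 : R) by split; [exact: smooth_cst|exists 0].
  have := rD_test t0; congr rD; apply/funext => x; exact: derive1_cst.
- move=> f g f' g' h h'; rewrite -(l2_repK f) -(l2_repK g) -(l2_repK f') -(l2_repK g').
  by rewrite -!l2_classD; try exact: l2_repP; apply/hD_class;
    [apply: l2D; exact: l2_repP|apply: l2D; exact: l2_repP|exact: rDD].
- move=> a f g h; rewrite -(l2_repK f) -(l2_repK g) -!l2_classZ; try exact: l2_repP.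
  by apply/hD_class; [apply: l2Z; exact: l2_repP|apply: l2Z; exact: l2_repP|exact: rDZ].
Qed.

Lemma l2_hnormB (u v : l2space m) e : 0 < e -> hnorm (@l2_ip _ m) (u - v) < Num.sqrt e ->
  ip m (fun x => l2_rep u x - l2_rep v x) (fun x => l2_rep u x - l2_rep v x) < e.
Proof.
move=> e0; rewrite -(hnorm_lt (l2_hilbert m)) ?sqrtr_gt0// sqr_sqrtr ?ltW//.
by rewrite -{1 2}(l2_repK u) -{1 2}(l2_repK v) -l2_classB ?l2_ipE//;
  try (apply: l2B); exact: l2_repP.
Qed.

Lemma hD_closed : closed_graph (@l2_ip _ m) hD.
Proof.
move=> u v f g uv uf vg; apply: rD_limit; [exact: l2_repP|exact: l2_repP|move=> e e0].
have s0 : 0 < Num.sqrt e by rewrite sqrtr_gt0.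
have [N1 h1] := uf _ s0; have [N2 h2] := vg _ s0.
exists (l2_rep (u (N1 + N2)%N)), (l2_rep (v (N1 + N2)%N)); split; first exact: uv.
- by apply: l2_hnormB => //; rewrite (hnormBC (l2_hilbert m)) h1// leq_addr.
- by apply: l2_hnormB => //; rewrite (hnormBC (l2_hilbert m)) h2// leq_addl.
Qed.

End Weight.

(** * Density of test functions in W^{1,2}, the adjoint and its regularity *)

Section WeightedDerivative.
Context {R : realType}.
Implicit Types (F G H K U f g : R -> R).
Local Notation leb := (@lebesgue_measure R).

Lemma integrable_meas (m : {measure set (measurableTypeR R) -> \bar R}) f :
  m.-integrable setT (EFin \o f) -> measurable_fun [set: measurableTypeR R] f.
Proof. by move=> /integrableP[/measurable_EFinP]. Qed.

Lemma ae_le_Rintegral (m : {measure set (measurableTypeR R) -> \bar R}) f g :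
  m.-integrable setT (EFin \o f) -> m.-integrable setT (EFin \o g) ->
  {ae m, forall x, f x <= g x} -> \int[m]_x f x <= \int[m]_x g x.
Proof.
move=> i_f ig fg; rewrite -subr_ge0 -mulN1r -Rintegral_scale// -Rintegral_add//; last exact: integrable_scale.
have mh : measurable_fun [set: measurableTypeR R] (fun x => g x + -1 * f x).
  exact: integrable_meas (integrable_add ig (integrable_scale (-1) i_f)).
rewrite (Rintegral_ae mh (G := fun x => `|g x + -1 * f x|)).
- exact: Rintegral_ge0.
- exact: measurableT_comp.
- by apply: ae_mono fg => x xy; rewrite ger0_norm// mulN1r subr_ge0.
Qed.

Lemma unit_cvg_integral (m : {measure set (measurableTypeR R) -> \bar R}) (k : nat -> R -> R) f :
  (forall n, measurable_fun [set: measurableTypeR R] (k n)) ->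
  (forall n x, `|k n x| <= 1) -> (forall x, k n x @[n --> \oo] --> (1 : R)) ->
  m.-integrable setT (EFin \o f) ->
  (forall n, m.-integrable setT (EFin \o (fun x => k n x * f x))) /\
  \int[m]_x (k n x * f x) @[n --> \oo] --> \int[m]_x f x.
Proof.
move=> mk k1 kc iF; have mf := integrable_meas iF.
have iaf : m.-integrable setT (EFin \o (fun x => `|f x|)) by exact: integrable_norm.
have kf n x : `|k n x * f x| <= `|f x| by rewrite normrM ler_piMl.
have mkf n : measurable_fun [set: measurableTypeR R] (fun x => k n x * f x) by exact: measurable_funM.
split=> [n|]; first exact: integrable_dom (mkf n) iaf (kf n).
apply: (dominated_Rintegral mkf mf _ iaf _).2; apply: aeW => x //.
by rewrite -[X in _ --> X]mul1r; apply: cvgM => //; exact: cvg_cst.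
Qed.

Lemma cutoff_sqr_cvg (x : R) : cutoff n x ^+ 2 @[n --> \oo] --> (1 : R).
Proof.
rewrite (_ : (fun n => cutoff n x ^+ 2) = (fun n => cutoff n x * cutoff n x))//.
by rewrite -[X in _ --> X](mulr1 1); apply: cvgM; exact: cutoff_cvg.
Qed.

Lemma cutoff_derive_cvg (x : R) : derive1 (cutoff n) x @[n --> \oo] --> (0 : R).
Proof.
apply: cvg_near_cst; exists (Num.bound `|x|) => // n /= bn; apply: cutoff_derive1_eq0.
by apply: (lt_le_trans (archi_boundP _)); rewrite ?ler_nat.
Qed.

Lemma meas_cutoff n : measurable_fun [set: measurableTypeR R] (cutoff n : R -> R).
Proof. exact: continuous_meas (wloc_continuous (cutoff_wloc n)). Qed.

Lemma meas_dcutoff n : measurable_fun [set: measurableTypeR R] (derive1 (cutoff n : R -> R)).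
Proof. exact: meas_derive1 (cutoff_wloc n).1. Qed.

Lemma cutoff_sqr_le1 n (x : R) : 0 <= cutoff n x ^+ 2 <= 1.
Proof. by rewrite sqr_ge0 exprn_ile1// ?cutoff_ge0// cutoff_le1. Qed.

Lemma dcutoff_sqr_le1 n (x : R) : 0 <= derive1 (cutoff n) x ^+ 2 <= 1.
Proof. by rewrite sqr_ge0 -normr_sqr exprn_ile1// cutoff_derive1_le1. Qed.

(** The cutoffs increase to 1, so by monotone convergence a uniform bound on the truncated integrals
    bounds the full one. *)
Lemma cutoff_bounded_integrable f C : measurable_fun [set: measurableTypeR R] f ->
  (forall x, 0 <= f x) ->
  (forall n, leb.-integrable setT (EFin \o (fun x => cutoff n x ^+ 2 * f x))) ->
  (forall n, \int[leb]_x (cutoff n x ^+ 2 * f x) <= C) ->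
  leb.-integrable setT (EFin \o f).
Proof.
move=> mf f0 i_n le_n; apply/integrableP; split; first exact/measurable_EFinP.
apply: (@le_lt_trans _ _ C%:E); last exact: ltry.
have -> : (\int[leb]_x `|(EFin \o f) x| = \int[leb]_x (limn (fun n => (cutoff n x ^+ 2 * f x)%:E)))%E.
  apply: eq_integral => x _ /=; rewrite ger0_norm//; apply/esym/cvg_lim => //.
  apply: cvg_EFin; first exact: nearW.
  rewrite -[X in _ --> X]mul1r; apply: cvgM; [exact: cutoff_sqr_cvg|exact: cvg_cst].
have mn n : measurable_fun [set: measurableTypeR R] (fun x => (cutoff n x ^+ 2 * f x)%:E).
  by have /integrableP[] := i_n n.
have pos n x : (0 <= (cutoff n x ^+ 2 * f x)%:E)%E by rewrite lee_fin mulr_ge0// sqr_ge0.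
have mono x : {homo (fun n => (cutoff n x ^+ 2 * f x)%:E) : n p / (n <= p)%N >-> (n <= p)%E}.
  move=> n p np; rewrite lee_fin ler_wpM2r// ler_pXn2r ?nnegrE ?cutoff_ge0//.
  exact: cutoff_homo.
rewrite monotone_convergence//.
apply: lime_le.
  apply: ereal_nondecreasing_is_cvgn => n p np; apply: ge0_le_integral => //.
  by move=> x _; exact: mono.
apply: nearW => n; rewrite -(fineK (integrable_fin_num measurableT (i_n n))) lee_fin.
exact: le_n.
Qed.

Lemma loc_ac_prim U g : loc_ac_real U -> loc_integrable g ->
  {ae leb, forall x, derive1 U x = g x} -> exists c, forall x, U x = c + prim g x.
Proof.
move=> aU lg Ug; exists (U 0 - prim g 0).
have h a b : a <= b -> U b - U a = prim g b - prim g a.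
  move=> ab; rewrite primB//; have [iU <-] := loc_ac_FTC aU ab.
  rewrite /Rintegral; congr fine; apply: ae_eq_integral; first exact: measurable_itv.
  - by have /integrableP[] := iU.
  - by have /integrableP[] := lg.2 a b.
  - by apply: ae_mono Ug => x /= -> _.
move=> x; have [x0|/ltW x0] := leP 0 x; have := h _ _ x0; lra.
Qed.

Variables (m : {measure set (measurableTypeR R) -> \bar R}) (w : R -> R).
Hypothesis hw : weight m w.

Lemma weight_ip_l2 F G : l2 m F -> l2 m G -> ip m F G = \int[leb]_x (F x * G x * w x).
Proof. by move=> [mF _] [mG _]; exact: weight_ip. Qed.

(** r' w has an absolutely continuous version q with q' = r w. The derivative of q chi^2 r
    integrates to 0 and dominates (chi^2 - chi'^2) r^2 w, whose factor chi^2 - chi'^2 stays in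
    [-1, 1] and tends to 1. *)
Lemma W12_orth_eq0 r : rW12 m r ->
  (forall psi, test_fun psi -> ip m r psi + ip m (derive1 r) (derive1 psi) = 0) ->
  {ae leb, forall x, r x = 0}.
Proof.
move=> [ar lr lr'] orth.
have mr := l2_meas lr; have mr' := l2_meas lr'.
have wc := weight_continuous hw.
have LP : loc_integrable (fun x => r x * w x) by exact: loc_integrableM (loc_l2_loc_integrable (l2_loc hw lr)) wc.
have LQ : loc_integrable (fun x => derive1 r x * w x) by exact: loc_integrableM (loc_l2_loc_integrable (l2_loc hw lr')) wc.
have [|c qE] := du_Bois_Reymond LP LQ.
  move=> psi tp; rewrite -(orth psi tp).
  have [aps _ _] := test_fun_rW12 hw tp.
  rewrite !(weight_ip hw)//; [|exact: meas_derive1|exact: continuous_meas (loc_ac_continuous aps)].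
  by congr (_ + _); congr Rintegral; apply/funext => x; ring.
pose q := (fun=> c) \+ prim (fun x => r x * w x).
have aq : loc_ac_real q by apply: loc_acD; [exact: loc_ac_cst|exact: prim_loc_ac].
have q'E : {ae leb, forall x, derive1 q x = r x * w x}.
  apply: ae_mono (ae_and (ae_derive1D (loc_ac_cst c) (prim_loc_ac LP)) (prim_derive LP)) => x [].
  by rewrite derive1_cst add0r => -> [].
pose k n x : R := cutoff n x ^+ 2 - derive1 (cutoff n) x ^+ 2.
have mk n : measurable_fun [set: measurableTypeR R] (k n).
  by apply: measurable_funB; apply: measurable_funX; [exact: meas_cutoff|exact: meas_dcutoff].
have k1 n x : `|k n x| <= 1.
  rewrite /k ler_norml; have /andP[? ?] := cutoff_sqr_le1 n x; have /andP[? ?] := dcutoff_sqr_le1 n x.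
  by apply/andP; split; lra.
have kc x : k n x @[n --> \oo] --> (1 : R).
  rewrite -[X in _ --> X]subr0; apply: cvgB; first exact: cutoff_sqr_cvg.
  by rewrite -(mulr0 0); apply: cvgM; exact: cutoff_derive_cvg.
have ir : leb.-integrable setT (EFin \o (fun x => r x ^+ 2 * w x)).
  by apply/(weight_integrable hw); [exact: measurable_funX|exact: lr.2].
have [ik kcv] := unit_cvg_integral mk k1 kc ir.
have kle n : \int[leb]_x (k n x * (r x ^+ 2 * w x)) <= 0.
  have avn : loc_ac_real (fun x => cutoff n x * cutoff n x * r x).
    by apply: (@loc_acM _ (fun x => cutoff n x * cutoff n x) r) => //; apply: (@loc_acM _ (cutoff n) (cutoff n)); exact: (cutoff_wloc n).1.
  have vn0 x : n.+1%:R < `|x| -> cutoff n x * cutoff n x * r x = 0.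
    by move=> /cutoff_eq0 ->; rewrite !mul0r.
  have [i1 i2 e12] := integral_by_parts_cpt aq avn vn0.
  have := Rintegral_add i1 i2; rewrite e12 addrN => <-.
  apply: ae_le_Rintegral => //; first exact: integrable_add.
  have acc : loc_ac_real (fun x : R => cutoff n x * cutoff n x).
    by apply: (@loc_acM R (cutoff n) (cutoff n)); exact: (cutoff_wloc n).1.
  apply: ae_mono (ae_and (ae_and qE q'E) (ae_and (ae_derive1M acc ar) (ae_derive1M (cutoff_wloc n).1 (cutoff_wloc n).1))).
  move=> x [[h1 ->] [-> ->]]; rewrite -[q x]h1 /k.
  have := weight_gt0 hw x; move: (cutoff n x) (derive1 (cutoff n) x) (r x) (derive1 r x) (w x) => C C' a a' W W0.
  (* The surplus is exactly w ((chi r)')^2. *)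
  rewrite -subr_ge0 (_ : _ - _ = W * (C * a' + C' * a) ^+ 2); last by ring.
  by rewrite mulr_ge0 ?sqr_ge0// ltW.
have r0 : \int[leb]_x (r x ^+ 2 * w x) <= 0.
  rewrite -(cvg_lim _ kcv)//; apply: limr_le; first by apply/cvg_ex; eexists; exact: kcv.
  exact: nearW.
apply/(weight_ae hw); apply: ip_eq0 => //; apply/eqP; rewrite eq_le ip_ge0 andbT.
by rewrite (weight_ip hw)//; move: r0; under eq_Rintegral do rewrite expr2.
Qed.

Lemma W12_rD F : rW12 m F -> rD m F (derive1 F).
Proof.
move=> [aF lF lF'].
have [f [g [fg orth]]] := graph_projection (l2_hilbert m) (hD_lin hw) (hD_closed hw) (l2_class m F) (l2_class m (derive1 F)).
have [F1 [aF1 lF1 lF1'] [fF1 gF1]] := rD_ac hw fg.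
have fE : f = l2_class m F1.
  by rewrite -(l2_repK f); apply/l2_class_eq => //; [exact: l2_repP|exact/(weight_ae hw)].
have gE : g = l2_class m (derive1 F1).
  by rewrite -(l2_repK g); apply/l2_class_eq => //; [exact: l2_repP|exact/(weight_ae hw)].
pose r x := F x + -1 * F1 x.
have aN : loc_ac_real (fun x => -1 * F1 x) by apply: (@loc_acM _ (fun=> -1) F1) => //; exact: loc_ac_cst.
have ar : loc_ac_real r by apply: (@loc_acD _ F (fun x => -1 * F1 x)).
have r'E : {ae leb, forall x, derive1 F x - derive1 F1 x = derive1 r x}.
  apply: ae_mono (ae_and (ae_derive1D aF aN) (ae_derive1Z (-1) aF1)) => x [-> ->].
  by rewrite mulN1r.
have lr : l2 m r by apply: l2D => //; exact: l2Z.
have lB := l2B lF' lF1'.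
have lr' : l2 m (derive1 r) by apply: (l2_ae_leb hw) r'E lB; exact: meas_derive1.
have FF1 : F = F1.
  apply: ae_eq_continuous; [exact: loc_ac_continuous|exact: loc_ac_continuous|].
  suff : {ae leb, forall x, r x = 0}.
    by apply: ae_mono => x; rewrite /r mulN1r => /eqP; rewrite subr_eq0 => /eqP.
  apply: W12_orth_eq0 => // psi tp; have [_ lp lp'] := test_fun_rW12 hw tp.
  have := orth (l2_class m psi) (l2_class m (derive1 psi)).
  rewrite (hD_class hw)// => /(_ (rD_test hw tp)).
  rewrite fE gE -!l2_classB// !l2_ipE//; last exact: l2B.
  move=> <-; congr (_ + _); first by congr ip; apply/funext => x; rewrite /r mulN1r.
  by apply/esym; apply: ip_ae => //; exact/(weight_ae hw).
apply: (rD_ae hw fg lF lF'); first by apply/(weight_ae hw); move: fF1; rewrite FF1.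
by apply/(weight_ae hw); move: gF1; rewrite FF1.
Qed.

Definition radj G H : Prop := [/\ l2 m G, l2 m H & forall F K, rD m F K -> ip m K G = ip m F H].

Lemma radj_test G H : l2 m G -> l2 m H ->
  (forall psi, test_fun psi -> ip m (derive1 psi) G = ip m psi H) -> radj G H.
Proof.
move=> lG lH GH; split=> // F K FK; have [lF lK _] := FK.
have : ip m (fun x => -1 * H x) F + ip m G K = 0.
  apply: (rD_ip_limit hw FK (l2Z (-1) lH) lG) => psi tp; have [_ lp lp'] := test_fun_rW12 hw tp.
  by rewrite ipZl// ipC -(GH _ tp) (ipC _ G) mulN1r addNr.
by rewrite ipZl// ipC (ipC _ G) mulN1r => /eqP; rewrite addrC subr_eq0 => /eqP.
Qed.

(** This is -(G w)' / w expanded, the formal adjoint of the derivative in the space with weight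
    w. *)
Definition divw G x : R := - derive1 G x - derive1 w x / w x * G x.

Lemma divw_ae G : loc_ac_real G ->
  {ae leb, forall x, derive1 (fun y => G y * w y) x = - divw G x * w x}.
Proof.
move=> aG; apply: ae_mono (ae_derive1M aG (weight_wloc hw).1) => x ->.
rewrite /divw; have := weight_gt0 hw x => w0; field; exact: lt0r_neq0.
Qed.

Lemma radj_divw G : loc_ac_real G -> l2 m G -> l2 m (divw G) -> radj G (divw G).
Proof.
move=> aG lG ld; apply: radj_test => // psi tp.
have aGw : loc_ac_real (fun x => G x * w x) by apply: (@loc_acM _ G w) => //; exact: (weight_wloc hw).1.
have [aps lp lp'] := test_fun_rW12 hw tp; have [_ [M p0]] := tp.
have [i1 i2 e12] := integral_by_parts_cpt aGw aps p0.
rewrite !weight_ip_l2//.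
rewrite (_ : (fun x => derive1 psi x * G x * w x) = (fun x => G x * w x * derive1 psi x)); last by apply/funext => x; ring.
rewrite e12 -mulN1r -Rintegral_scale//.
apply: Rintegral_ae.
- exact: integrable_meas (integrable_scale (-1) i1).
- by apply: measurable_funM (weight_meas hw); exact: measurable_funM (l2_meas lp) (l2_meas ld).
- by apply: ae_mono (divw_ae aG) => x ->; ring.
Qed.

Lemma radj_unique G H H' : radj G H -> radj G H' -> {ae leb, forall x, H x = H' x}.
Proof.
move=> [lG lH GH] [_ lH' GH'].
suff : {ae leb, forall x, H x - H' x = 0}.
  by apply: ae_mono => x /eqP; rewrite subr_eq0 => /eqP.
apply: (test_fun_dense hw); first exact: l2B.
move=> psi tp; have [_ lp lp'] := test_fun_rW12 hw tp.
by rewrite ipBl// !(ipC _ _ psi) -(GH _ _ (rD_test hw tp)) -(GH' _ _ (rD_test hw tp)) subrr.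
Qed.

Lemma is_derive_inv F (x d : R) : F x != 0 -> is_derive x 1 F d ->
  is_derive x 1 (fun y => (F y)^-1) (- (F x ^- 2 * d)).
Proof.
by move=> F0 h; rewrite -mulNr; exact: is_deriveV F0 h.
Qed.

Lemma inv_C1_wloc F : (forall x, F x != 0) -> (forall x, derivable F x 1) ->
  continuous (derive1 F) -> wloc (fun x => (F x)^-1).
Proof.
move=> F0 dF cF'.
have d (x : R) : is_derive x 1 (fun y => (F y)^-1) (- (F x ^- 2 * derive1 F x)).
  by apply: is_derive_inv => //; exact: derivable_is_derive.
have cF : continuous F by move=> x; apply: differentiable_continuous; exact/derivable1_diffP.
apply: wloc_C1 => x; first by have [] := is_derive_derive1 (d x).
rewrite (_ : derive1 _ = (fun y => - (F y ^- 2 * derive1 F y))); last first.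
  by apply/funext => y; have [_ ->] := is_derive_derive1 (d y).
apply: cvgN; apply: cvgM; last exact: cF'.
apply: cvgV; first by rewrite expf_neq0.
by apply: cvgM; exact: cF.
Qed.

(** The weak equation reads (U' w)' = -H w. Hence U' w has an absolutely continuous version q, and
    dividing by the C^1 weight gives an absolutely continuous version g of U'. *)
Lemma radj_strong U H : rW12 m U -> radj (derive1 U) H ->
  [/\ forall x, derivable U x 1, loc_ac_real (derive1 U) &
    {ae leb, forall x, divw (derive1 U) x = H x}].
Proof.
move=> [aU lU lU'] [_ lH UH]; have wc := weight_continuous hw.
have LP : loc_integrable (fun x => - (H x * w x)).
  by apply: loc_integrableN; exact: loc_integrableM (loc_l2_loc_integrable (l2_loc hw lH)) wc.
have LQ : loc_integrable (fun x => derive1 U x * w x) by exact: loc_integrableM (loc_l2_loc_integrable (l2_loc hw lU')) wc.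
have [|c qE] := du_Bois_Reymond LP LQ.
  move=> psi tp; have [aps lp lp'] := test_fun_rW12 hw tp.
  have := UH _ _ (rD_test hw tp).
  rewrite !weight_ip_l2// => E.
  have iH : leb.-integrable setT (EFin \o (fun x => psi x * H x * w x)).
    by apply/(weight_integrable hw); [exact: measurable_funM (l2_meas lp) (l2_meas lH)|exact: l2M].
  rewrite (_ : (fun x => - (H x * w x) * psi x) = (fun x => -1 * (psi x * H x * w x))); last by apply/funext => x; ring.
  rewrite Rintegral_scale// -E mulN1r.
  rewrite (_ : (fun x => derive1 psi x * derive1 U x * w x) = (fun x => derive1 U x * w x * derive1 psi x)) ?addNr//.
  by apply/funext => x; ring.
pose q := (fun=> c) \+ prim (fun x => - (H x * w x)).
have aq : loc_ac_real q by apply: loc_acD; [exact: loc_ac_cst|exact: prim_loc_ac].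
have q'E : {ae leb, forall x, derive1 q x = - (H x * w x)}.
  apply: ae_mono (ae_and (ae_derive1D (loc_ac_cst c) (prim_loc_ac LP)) (prim_derive LP)) => x [].
  by rewrite derive1_cst add0r => -> [].
pose g x := q x * (w x)^-1.
have w0 x : w x != 0 by rewrite gt_eqF// (weight_gt0 hw).
have ag : loc_ac_real g.
  apply: (@loc_acM _ q (fun x => (w x)^-1)) => //.
  by case: hw => _ dw cw _; exact: (inv_C1_wloc w0 dw cw).1.
have Ug : {ae leb, forall x, derive1 U x = g x}.
  by apply: ae_mono qE => x h; rewrite /g -[q x]h mulfK.
have cg := loc_ac_continuous ag.
(* U is a primitive of the continuous g, hence differentiable everywhere with [derive1 U] equal to g
   at every point; equality almost everywhere would not carry absolute continuity over to
   [derive1 U]. *)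
have [c' UE] := loc_ac_prim aU (continuous_loc_integrable cg) Ug.
have dU (x : R) : is_derive x 1 U (g x).
  rewrite (_ : U = (fun y => c' + prim g y)); last by apply/funext.
  have pd : is_derive x 1 (prim g) (g x) by exact: prim_continuous_derive.
  by have := is_derive_add (is_derive_const c' x) pd; rewrite add0r.
have U'g : derive1 U = g by apply/funext => x; have [] := is_derive_derive1 (dU x).
split; first by move=> x; have [] := is_derive_derive1 (dU x).
  by rewrite U'g.
rewrite U'g; apply: ae_mono (ae_and (divw_ae ag) q'E) => x [].
rewrite (_ : (fun y => g y * w y) = q); last by apply/funext => y; rewrite /g mulfVK.
move=> -> /eqP; rewrite mulNr eqr_opp => /eqP; exact: mulIf.
Qed.

End WeightedDerivative.

(** * The ground state transform *)

Section GroundState.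
Context {R : realType}.
Implicit Types (F G H K U W f : R -> R).
Local Notation leb := (@lebesgue_measure R).

Lemma mul_le_sqrD (a b : R) : 0 <= a -> 0 <= b -> a * b <= a ^+ 2 + b ^+ 2.
Proof. by move=> a0 b0; have := sqr_ge0 (a - b); nra. Qed.

Lemma cutoff_product_bound (k d u u' P : R) : d ^+ 2 <= 1 -> k ^+ 2 <= 1 -> 0 < P ->
  (d * u + k * u') * (d * u + k * u') * P <= 2 * (u ^+ 2 * P) + 2 * (u' ^+ 2 * P).
Proof.
move=> d1 k1 P0; rewrite -subr_ge0.
have -> : 2 * (u ^+ 2 * P) + 2 * (u' ^+ 2 * P) - (d * u + k * u') * (d * u + k * u') * P =
  P * ((d * u - k * u') ^+ 2 + 2 * (1 - d ^+ 2) * u ^+ 2 + 2 * (1 - k ^+ 2) * u' ^+ 2) by ring.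
have q1 : 0 <= 1 - d ^+ 2 by rewrite subr_ge0.
have q2 : 0 <= 1 - k ^+ 2 by rewrite subr_ge0.
by rewrite (mulr_ge0 (ltW P0))// !addr_ge0 ?sqr_ge0// mulr_ge0 ?sqr_ge0// mulr_ge0.
Qed.

(** In the application t1 and t2 are the kinetic and potential energy of e chi U, t3 and t4 the
    weighted square integrals of chi U and its derivative, u and u' those of U and U'. The potential
    energy is discarded. *)
Lemma cutoff_energy_bound (t1 t2 t3 t4 u u' al : R) : t1 + t2 = al * t3 + t4 -> 0 <= t2 ->
  t3 <= u -> 0 <= t3 -> t4 <= 2 * u + 2 * u' ->
  2 * t1 + 2 * u <= (2 * `|al| + 6) * u + 4 * u'.
Proof.
move=> E t20 t3u t30 t4u.
have : al * t3 <= `|al| * u.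
  by apply: (@le_trans _ _ (`|al| * t3)); [rewrite ler_wpM2r// ler_norm|rewrite ler_wpM2l].
lra.
Qed.

(* Below p is the Gaussian density and V = c_mu x^2 1_{x < 0}. *)
Variables (gam nu : {measure set (measurableTypeR R) -> \bar R}) (p e V : R -> R) (al c : R).
Hypothesis hgam : weight gam p.
Hypothesis p'E : forall x, derive1 p x = - x * p x.
Hypothesis e_gt0 : forall x, 0 < e x.
Hypothesis de : forall x, derivable e x 1.
Hypothesis ce' : continuous (derive1 e).
Hypothesis hnu : weight nu (fun x => e x ^+ 2 * p x).
Hypothesis cV : continuous V.
Hypothesis V_bnd : forall x, 0 <= V x <= c * x ^+ 2.
Hypothesis weak_e : forall psi, test_fun psi ->
  \int[leb]_x (derive1 e x * derive1 psi x * p x) + \int[leb]_x (V x * e x * psi x * p x) =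
  al * \int[leb]_x (e x * psi x * p x).

Let e_neq0 x : e x != 0. Proof. by rewrite gt_eqF. Qed.
Let p_gt0 x : 0 < p x. Proof. exact: weight_gt0 hgam x. Qed.
Let cp : continuous p. Proof. exact: weight_continuous hgam. Qed.
Let wp : wloc p. Proof. exact: weight_wloc hgam. Qed.
Let we : wloc e. Proof. exact: wloc_C1. Qed.
Let ce : continuous e. Proof. exact: wloc_continuous. Qed.
Let wie : wloc (fun x => (e x)^-1). Proof. exact: inv_C1_wloc. Qed.

(** [q_form], [rA] and [rN] are the real counterparts of [a_form], [A_] and [N_], for abstract
    density and potential. The form is written with Lebesgue integrals, ready for integration by
    parts. *)
Definition q_form F G : R :=
  \int[leb]_x (derive1 F x * derive1 G x * p x) + \int[leb]_x (V x * F x * G x * p x).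

Definition rA F H : Prop := [/\ l2 gam F, l2 gam H & exists F1, [/\ rW12 gam F1,
  {ae leb, forall x, F x = F1 x} & forall G, rW12 gam G -> q_form F1 G = ip gam H G]].

Definition rN F H : Prop := [/\ l2 nu F, l2 nu H &
  rA (fun x => e x * F x) (fun x => e x * H x + al * (e x * F x))].

Lemma l2_gam_nu F : l2 nu F <-> l2 gam (fun x => e x * F x).
Proof.
have E : (fun x => (e x * F x) ^+ 2 * p x) = (fun x => F x ^+ 2 * (e x ^+ 2 * p x)).
  by apply/funext => x; ring.
split=> [[mF iF]|[mF iF]].
  have meF : measurable_fun [set: measurableTypeR R] (fun x => e x * F x).
    exact: measurable_funM (continuous_meas ce) mF.
  split=> //; apply/(weight_integrable hgam); first exact: measurable_funX.
  by rewrite E; apply/(weight_integrable hnu) => //; exact: measurable_funX.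
have mF' : measurable_fun [set: measurableTypeR R] F.
  rewrite (_ : F = (fun x => e x * F x * (e x)^-1)).
    exact: measurable_funM mF (continuous_meas (wloc_continuous wie)).
  by apply/funext => x; rewrite mulrAC mulfV// mul1r.
split=> //; apply/(weight_integrable hnu); first exact: measurable_funX.
by rewrite -E; apply/(weight_integrable hgam) => //; exact: measurable_funX.
Qed.

Lemma W12_wloc F : rW12 gam F -> wloc F.
Proof. by move=> [aF _ lF']; split=> //; exact: (l2_loc hgam lF'). Qed.

(* Integrate the derivative of chi^2 G^2 x p, where p' = - x p. *)
Lemma gaussian_moment G : rW12 gam G ->
  leb.-integrable setT (EFin \o (fun x => x ^+ 2 * G x ^+ 2 * p x)).
Proof.
move=> WG; have [aG lG lG'] := WG; have wG := W12_wloc WG.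
have cG := wloc_continuous wG.
have cid : continuous (fun x : R => x) by move=> x; exact: cvg_id.
have wid : wloc (fun x : R => x).
  have dE : derive1 (fun x : R => x) = (fun=> 1) by apply/funext => y; rewrite derive1E derive_id.
  by apply: wloc_C1 => x; [exact: derivable_id|rewrite dE; exact: cvg_cst].
have cf : continuous (fun x : R => x ^+ 2 * G x ^+ 2 * p x).
  exact: (continuous_mul (continuous_mul (continuous_mul cid cid) (continuous_mul cG cG)) cp).
(* With h = chi G the derivative of h^2 x p is 2 h h' x p + h^2 (1 - x^2) p. Bound 2 h h' x by h^2
   x^2 / 2 + 2 h'^2 and h'^2 by 2 G^2 + 2 G'^2: this leaves -h^2 x^2 / 2 and the constants 1 + 4 = 5
   and 4. *)
pose g x := (5 * G x ^+ 2 + 4 * derive1 G x ^+ 2) * p x.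
have ig : leb.-integrable setT (EFin \o g).
  have i1 := (weight_integrable hgam (measurable_funX 2 (l2_meas lG))).1 lG.2.
  have i2 := (weight_integrable hgam (measurable_funX 2 (l2_meas lG'))).1 lG'.2.
  have := integrable_add (integrable_scale 5 i1) (integrable_scale 4 i2).
  by apply: eq_integrable => // x _ /=; congr EFin; rewrite /g; ring.
have iF n : leb.-integrable setT (EFin \o (fun x => cutoff n x ^+ 2 * (x ^+ 2 * G x ^+ 2 * p x))).
  have cc : continuous (cutoff n : R -> R) := wloc_continuous (cutoff_wloc n).
  apply: (loc_integrable_cpt (M := n.+1%:R)) => [|x /cutoff_eq0 ->]; last by rewrite expr0n mul0r.
  apply: continuous_loc_integrable.
  exact: (continuous_mul (continuous_mul cc cc) cf).
apply: (cutoff_bounded_integrable (C := 2 * \int[leb]_x g x)) => // [|x|n].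
- exact: continuous_meas.
- by rewrite mulr_ge0 ?(ltW (p_gt0 x))// mulr_ge0 ?sqr_ge0.
pose h x := cutoff n x * G x; have wh : wloc h by exact: wlocM (cutoff_wloc n) wG.
have [ih h0] : leb.-integrable setT (EFin \o (derive1 (fun x => h x * h x * (x * p x)))) /\
    \int[leb]_x (derive1 (fun x => h x * h x * (x * p x)) x) = 0.
  apply: (@integral_derive1_cpt _ _ n.+1%:R).
    exact: (wlocM (wlocM wh wh) (wlocM wid wp)).1.
  by move=> x /cutoff_eq0; rewrite /h => ->; rewrite !mul0r.
have iS := integrable_add (integrable_scale (- 2^-1) (iF n)) ig.
have := ae_le_Rintegral ih iS; rewrite h0 Rintegral_add ?Rintegral_scale//; last exact: integrable_scale.
suff ae : {ae leb, forall x, derive1 (fun x => h x * h x * (x * p x)) x <=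
    - 2^-1 * (cutoff n x ^+ 2 * (x ^+ 2 * G x ^+ 2 * p x)) + g x}.
  by move=> /(_ ae); rewrite mulNr addrC subr_ge0 => le; rewrite -ler_pdivrMl.
have xpE x : derive1 (fun x => x * p x) x = p x - x ^+ 2 * p x.
  rewrite derive1_mul; [|exact: derivable_id|by case: hgam].
  by rewrite p'E derive1E derive_id; ring.
apply: ae_mono (ae_and (ae_and (ae_derive1M (wlocM wh wh).1 (wlocM wid wp).1) (ae_derive1M wh.1 wh.1))
  (ae_derive1M (cutoff_wloc n).1 aG)) => x [[-> ->] hE].
rewrite hE xpE /h /g.
have := p_gt0 x; have /andP[C0 C1] := cutoff_sqr_le1 n x; have /andP[D0 D1] := dcutoff_sqr_le1 n x.
move: C0 C1 D0 D1; move: (cutoff n x) (derive1 (cutoff n) x) (G x) (derive1 G x) (p x) => C D a a' P C0 C1 D0 D1 P0.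
rewrite -subr_ge0.
have -> : - 2^-1 * (C ^+ 2 * (x ^+ 2 * a ^+ 2 * P)) + (5 * a ^+ 2 + 4 * a' ^+ 2) * P -
   (((D * a + C * a') * (C * a) + C * a * (D * a + C * a')) * (x * P) +
    C * a * (C * a) * (P - x ^+ 2 * P)) =
   P * (2^-1 * (C * a * x - 2 * (D * a + C * a')) ^+ 2 + 2 * (D * a - C * a') ^+ 2 +
        4 * a ^+ 2 * (1 - D ^+ 2) + 4 * a' ^+ 2 * (1 - C ^+ 2) + a ^+ 2 * (1 - C ^+ 2)) by field.
have q1 : 0 <= 1 - D ^+ 2 by rewrite subr_ge0.
have q2 : 0 <= 1 - C ^+ 2 by rewrite subr_ge0.
have h2 : 0 <= 2^-1 :> R by rewrite invr_ge0.
apply: (mulr_ge0 (ltW P0)); apply: addr_ge0; last exact: mulr_ge0 (sqr_ge0 _) q2.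
apply: addr_ge0; last exact: mulr_ge0 (mulr_ge0 (ler0n _ 4) (sqr_ge0 _)) q2.
apply: addr_ge0; last exact: mulr_ge0 (mulr_ge0 (ler0n _ 4) (sqr_ge0 _)) q1.
by apply: addr_ge0; [exact: mulr_ge0 h2 (sqr_ge0 _)|exact: mulr_ge0 (ler0n _ 2) (sqr_ge0 _)].
Qed.

Lemma integrable_V F G : rW12 gam F -> rW12 gam G ->
  leb.-integrable setT (EFin \o (fun x => V x * F x * G x * p x)).
Proof.
move=> WF WG; have iF := gaussian_moment WF; have iG := gaussian_moment WG.
have [aF _ _] := WF; have [aG _ _] := WG.
apply: (integrable_dom _ (integrable_scale `|c| (integrable_add iF iG))).
  apply: continuous_meas; apply: (continuous_mul _ cp); apply: continuous_mul; last exact: loc_ac_continuous.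
  by apply: (continuous_mul cV); exact: loc_ac_continuous.
move=> x; have /andP[V0 V1] := V_bnd x; have p0 := p_gt0 x.
rewrite !normrM (ger0_norm V0) (gtr0_norm p0).
have Vc : V x <= `|c| * x ^+ 2 by apply: le_trans V1 _; rewrite ler_wpM2r ?sqr_ge0// ler_norm.
apply: (@le_trans _ _ (`|c| * x ^+ 2 * (`|F x| * `|G x|) * p x)).
  by rewrite ler_wpM2r ?(ltW p0)// -mulrA ler_wpM2r// mulr_ge0.
have -> : `|c| * (x ^+ 2 * F x ^+ 2 * p x + x ^+ 2 * G x ^+ 2 * p x) =
  `|c| * x ^+ 2 * (F x ^+ 2 + G x ^+ 2) * p x by ring.
have cx : 0 <= `|c| * x ^+ 2 by apply: mulr_ge0 => //; exact: sqr_ge0.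
rewrite ler_wpM2r ?(ltW p0)// ler_wpM2l//.
rewrite -(normr_sqr (F x)) -(normr_sqr (G x)); move: (normr_ge0 (F x)) (normr_ge0 (G x)).
exact: mul_le_sqrD.
Qed.

Let q x := derive1 e x * p x.

(** The weak equation is the hypothesis of the du Bois-Reymond lemma for P = (V - al) e p and Q = e'
    p. As Q is continuous, the resulting a.e. identity for Q holds everywhere. *)
Lemma ground_state_ode : loc_ac_real q /\
  {ae leb, forall x, derive1 q x = (V x - al) * e x * p x}.
Proof.
have cQ : continuous q by exact: continuous_mul.
have cP : continuous (fun x => (V x - al) * e x * p x).
  apply: (continuous_mul _ cp); apply: (continuous_mul _ ce) => x.
  by apply: cvgB; [exact: cV|exact: cvg_cst].
have [|c0 qE] := du_Bois_Reymond (continuous_loc_integrable cP) (continuous_loc_integrable cQ).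
  move=> psi tp; have := weak_e tp; have [sp [M p0]] := tp.
  have cps := smooth_continuous sp.
  have i1 : leb.-integrable setT (EFin \o (fun x => V x * e x * psi x * p x)).
    apply: (loc_integrable_cpt (M := M)) => [|x /p0 ->]; last by rewrite mulr0 mul0r.
    apply: continuous_loc_integrable.
    exact: (continuous_mul (continuous_mul (continuous_mul cV ce) cps) cp).
  have i2 : leb.-integrable setT (EFin \o (fun x => e x * psi x * p x)).
    apply: (loc_integrable_cpt (M := M)) => [|x /p0 ->]; last by rewrite mulr0 mul0r.
    apply: continuous_loc_integrable.
    exact: (continuous_mul (continuous_mul ce cps) cp).
  rewrite (_ : (fun x => (V x - al) * e x * p x * psi x) =
    (fun x => V x * e x * psi x * p x + - al * (e x * psi x * p x))); last by apply/funext => x; ring.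
  rewrite Rintegral_add//; last exact: integrable_scale.
  rewrite Rintegral_scale// mulNr => <-.
  rewrite (_ : (fun x => q x * derive1 psi x) = (fun x => derive1 e x * derive1 psi x * p x)); first by ring.
  by apply/funext => x; rewrite /q; ring.
have aP := prim_loc_ac (continuous_loc_integrable cP).
have aS : loc_ac_real ((fun=> c0) \+ prim (fun x => (V x - al) * e x * p x)).
  by apply: loc_acD; [exact: loc_ac_cst|].
have -> : q = ((fun=> c0) \+ prim (fun x => (V x - al) * e x * p x)).
  exact: ae_eq_continuous cQ (loc_ac_continuous aS) qE.
split=> //.
apply: ae_mono (ae_and (ae_derive1D (loc_ac_cst c0) aP) (prim_derive (continuous_loc_integrable cP))) => x [].
by rewrite derive1_cst add0r => -> [].
Qed.

Let int_loc F G W (M : R) : loc_l2 F -> loc_l2 G -> continuous W -> (forall x, M < `|x| -> G x = 0) ->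
  leb.-integrable setT (EFin \o (fun x => F x * G x * W x)).
Proof.
move=> lF lG cW G0; apply: (loc_integrable_cpt (M := M)) => [|x /G0 ->]; last by rewrite mulr0 mul0r.
exact: loc_integrableM (loc_l2M lF lG) cW.
Qed.

(* Both sides differ by the integral of the derivative of e' p e U W. *)
Lemma ground_state_identity U W (M : R) : wloc U -> wloc W -> (forall x, M < `|x| -> W x = 0) ->
  [/\ leb.-integrable setT (EFin \o (fun x => derive1 (fun y => e y * U y) x * derive1 (fun y => e y * W y) x * p x)),
      leb.-integrable setT (EFin \o (fun x => V x * (e x * U x) * (e x * W x) * p x)),
      leb.-integrable setT (EFin \o (fun x => derive1 U x * derive1 W x * (e x ^+ 2 * p x))) &
      q_form (fun x => e x * U x) (fun x => e x * W x) =
      al * \int[leb]_x (U x * W x * (e x ^+ 2 * p x)) + \int[leb]_x (derive1 U x * derive1 W x * (e x ^+ 2 * p x))].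
Proof.
move=> wU wW W0; have cU := wloc_continuous wU; have cW := wloc_continuous wW.
have weU := wlocM we wU; have weW := wlocM we wW.
have ce2p : continuous (fun x => e x ^+ 2 * p x) by exact: weight_continuous hnu.
have W'0 x : M < `|x| -> derive1 W x = 0 by exact: derive1_eq0_cpt.
have eW0 x : M < `|x| -> e x * W x = 0 by move=> /W0 ->; rewrite mulr0.
have eW'0 x : M < `|x| -> derive1 (fun y => e y * W y) x = 0 by exact: derive1_eq0_cpt.
have i1 := int_loc weU.2 weW.2 cp eW'0.
have i2 : leb.-integrable setT (EFin \o (fun x => V x * (e x * U x) * (e x * W x) * p x)).
  apply: (int_loc _ _ cp eW0); last exact: continuous_loc_l2 (wloc_continuous weW).
  exact: continuous_loc_l2 (continuous_mul cV (wloc_continuous weU)).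
have i3 := int_loc (continuous_loc_l2 cU) (continuous_loc_l2 cW) ce2p W0.
have i4 := int_loc wU.2 wW.2 ce2p W'0.
split=> //; have [aq q'E] := ground_state_ode.
have wUW := wlocM wU wW; have weUW := wlocM we wUW.
have [|j1 j2 j12] := @integral_by_parts_cpt _ q (fun x => e x * (U x * W x)) M aq weUW.1.
  by move=> x /W0 ->; rewrite !mulr0.
have := Rintegral_add j1 j2; rewrite j12 addrN.
have -> : \int[leb]_x (derive1 q x * (e x * (U x * W x)) + q x * derive1 (fun y => e y * (U y * W y)) x) =
  \int[leb]_x ((derive1 (fun y => e y * U y) x * derive1 (fun y => e y * W y) x * p x +
     V x * (e x * U x) * (e x * W x) * p x) + (- al * (U x * W x * (e x ^+ 2 * p x)) +
     -1 * (derive1 U x * derive1 W x * (e x ^+ 2 * p x)))).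
  apply: Rintegral_ae.
  - exact: integrable_meas (integrable_add j1 j2).
  - exact: integrable_meas (integrable_add (integrable_add i1 i2) (integrable_add (integrable_scale _ i3) (integrable_scale _ i4))).
  - apply: ae_mono (ae_and (ae_and (ae_derive1M we.1 wU.1) (ae_derive1M we.1 wW.1))
      (ae_and q'E (ae_and (ae_derive1M we.1 wUW.1) (ae_derive1M wU.1 wW.1)))).
    by move=> x [[-> ->] [-> [-> ->]]]; rewrite /q; ring.
rewrite Rintegral_add; [|exact: integrable_add|by apply: integrable_add; exact: integrable_scale].
rewrite Rintegral_add// Rintegral_add; [|exact: integrable_scale|exact: integrable_scale].
rewrite !Rintegral_scale// -/(q_form (fun x => e x * U x) (fun x => e x * W x)).
move: (q_form _ _) (\int[_]_x _) (\int[_]_x _) => a b d /esym h; lra.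
Qed.

(** By the ground state identity the defects of the two equations are the same number for each W,
    the [al] terms cancelling. *)
Lemma rA_cpt_form U H : wloc U -> l2 gam (fun x => e x * U x) -> l2 gam (fun x => e x * H x) ->
  (forall W M, wloc W -> (forall x, M < `|x| -> W x = 0) ->
     q_form (fun x => e x * U x) (fun x => e x * W x) =
     ip gam (fun x => e x * H x + al * (e x * U x)) (fun x => e x * W x)) <->
  (forall W M, wloc W -> (forall x, M < `|x| -> W x = 0) ->
     \int[leb]_x (derive1 U x * derive1 W x * (e x ^+ 2 * p x)) =
     \int[leb]_x (H x * W x * (e x ^+ 2 * p x))).
Proof.
move=> wU lU lH.
suff h W M : wloc W -> (forall x, M < `|x| -> W x = 0) ->
    q_form (fun x => e x * U x) (fun x => e x * W x) -
      ip gam (fun x => e x * H x + al * (e x * U x)) (fun x => e x * W x) =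
    \int[leb]_x (derive1 U x * derive1 W x * (e x ^+ 2 * p x)) -
     \int[leb]_x (H x * W x * (e x ^+ 2 * p x)).
  split=> E W M wW W0; have := h W M wW W0; have := E W M wW W0 => -> /eqP.
    by rewrite subrr eq_sym subr_eq0 => /eqP.
  by rewrite subrr subr_eq0 => /eqP.
move=> wW W0; have [_ _ _ ->] := ground_state_identity wU wW W0.
have [_ leW _] : rW12 gam (fun x => e x * W x).
  by apply: (wloc_cpt_rW12 hgam (wlocM we wW) (M := M)) => x /W0 ->; rewrite mulr0.
rewrite ipDl//; last exact: l2Z.
rewrite ipZl// !(weight_ip_l2 hgam)//.
rewrite (_ : (fun x => e x * U x * (e x * W x) * p x) = (fun x => U x * W x * (e x ^+ 2 * p x))); last by apply/funext => x; ring.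
rewrite (_ : (fun x => e x * H x * (e x * W x) * p x) = (fun x => H x * W x * (e x ^+ 2 * p x))); last by apply/funext => x; ring.
by ring.
Qed.

(* Test with W = chi^2 U for a cutoff chi. *)
Lemma caccioppoli U H : wloc U -> l2 nu U -> l2 nu H ->
  (forall W M, wloc W -> (forall x, M < `|x| -> W x = 0) ->
     \int[leb]_x (derive1 U x * derive1 W x * (e x ^+ 2 * p x)) =
     \int[leb]_x (H x * W x * (e x ^+ 2 * p x))) ->
  l2 nu (derive1 U).
Proof.
move=> wU lU lH UH; have mU' := meas_derive1 wU.1; split=> //.
have mU'2 : measurable_fun [set: measurableTypeR R] (fun x => derive1 U x ^+ 2) by exact: measurable_funX.
apply/(weight_integrable hnu) => //.
have w0 x : 0 < e x ^+ 2 * p x by exact: weight_gt0 hnu x.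
have ce2p : continuous (fun x => e x ^+ 2 * p x) by exact: weight_continuous hnu.
pose w x := e x ^+ 2 * p x.
have iU := (weight_integrable hnu (measurable_funX 2 (l2_meas lU))).1 lU.2.
have iH := (weight_integrable hnu (measurable_funX 2 (l2_meas lH))).1 lH.2.
(* Under the integral chi^2 U'^2 = H chi^2 U - 2 chi chi' U U'. Bound the first term by (H^2 + U^2)
   / 2 and the second by chi^2 U'^2 / 2 + 2 U^2, absorb, and double: H^2 + 5 U^2. *)
pose C := \int[leb]_x (H x ^+ 2 * w x) + 5 * \int[leb]_x (U x ^+ 2 * w x).
have iF n : leb.-integrable setT (EFin \o (fun x => cutoff n x ^+ 2 * (derive1 U x ^+ 2 * w x))).
  apply: (loc_integrable_cpt (M := n.+1%:R)) => [|x /cutoff_eq0 ->]; last by rewrite expr0n mul0r.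
  have cc : continuous (cutoff n : R -> R) := wloc_continuous (cutoff_wloc n).
  have := loc_integrableM wU.2.2 (continuous_mul (continuous_mul cc cc) ce2p).
  by congr loc_integrable; apply/funext => x; rewrite /w; ring.
apply: (@cutoff_bounded_integrable _ _ C) => // [|x|n].
- exact: measurable_funM mU'2 (weight_meas hnu).
- by rewrite mulr_ge0 ?sqr_ge0// ltW.
pose W x : R := cutoff n x * cutoff n x * U x.
have wc : wloc (fun x : R => cutoff n x * cutoff n x) by exact: (wlocM (cutoff_wloc n) (cutoff_wloc n)).
have wW : wloc W by exact: wlocM wc wU.
have W0 x : n.+1%:R < `|x| -> W x = 0 by move=> /cutoff_eq0; rewrite /W => ->; rewrite !mul0r.
have [_ _ i1 _] := ground_state_identity wU wW W0.
have i2 : leb.-integrable setT (EFin \o (fun x => H x * W x * w x)).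
  apply/(weight_integrable hnu); last by apply: l2M => //; have [] := wloc_cpt_rW12 hnu wW W0.
  by apply: measurable_funM; [exact: l2_meas lH|exact: continuous_meas (wloc_continuous wW)].
have iS := integrable_add (integrable_scale (2^-1) iH) (integrable_scale (5 / 2) iU).
have iL := integrable_add (integrable_scale (2^-1) (iF n)) (integrable_add i2 (integrable_scale (-1) i1)).
have := ae_le_Rintegral iL iS.
rewrite !Rintegral_add//; try exact: integrable_scale; last first.
  by apply: integrable_add => //; exact: integrable_scale.
rewrite !Rintegral_scale// (UH W _ wW W0) mulN1r addrN addr0.
suff ae : {ae leb, forall x, 2^-1 * (cutoff n x ^+ 2 * (derive1 U x ^+ 2 * w x)) +
   (H x * W x * w x + -1 * (derive1 U x * derive1 W x * (e x ^+ 2 * p x))) <=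
   2^-1 * (H x ^+ 2 * (e x ^+ 2 * p x)) + 5 / 2 * (U x ^+ 2 * (e x ^+ 2 * p x))}.
  move=> /(_ ae); rewrite /C /w.
  by move: (\int[_]_x _) (\int[_]_x _) (\int[_]_x _) => a b d; lra.
apply: ae_mono (ae_and (ae_derive1M wc.1 wU.1) (ae_derive1M (cutoff_wloc n).1 (cutoff_wloc n).1)).
move=> x [-> ->]; rewrite /W /w -subr_ge0.
have := w0 x; have /andP[] := cutoff_sqr_le1 n x; have /andP[] := dcutoff_sqr_le1 n x.
move: (cutoff n x) (derive1 (cutoff n) x) (U x) (derive1 U x) (H x) (e x ^+ 2 * p x).
move=> k d u u' h P D0 D1 K0 K1 P0.
have -> : 2^-1 * (h ^+ 2 * P) + 5 / 2 * (u ^+ 2 * P) -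
  (2^-1 * (k ^+ 2 * (u' ^+ 2 * P)) + (h * (k * k * u) * P +
   -1 * (u' * ((d * k + k * d) * u + k * k * u') * P))) =
  P * (2^-1 * (h - k ^+ 2 * u) ^+ 2 + 2^-1 * (k * u' + 2 * d * u) ^+ 2 +
    2 * (1 - d ^+ 2) * u ^+ 2 + 2^-1 * (1 - k ^+ 2) * (1 + k ^+ 2) * u ^+ 2) by field.
have q1 : 0 <= 1 - d ^+ 2 by rewrite subr_ge0.
have q2 : 0 <= 1 - k ^+ 2 by rewrite subr_ge0.
have q3 : 0 <= 1 + k ^+ 2 by rewrite addr_ge0 ?sqr_ge0.
have h2 : 0 <= 2^-1 :> R by rewrite invr_ge0.
rewrite (mulr_ge0 (ltW P0))// !addr_ge0//.
- by rewrite mulr_ge0 ?sqr_ge0.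
- by rewrite mulr_ge0 ?sqr_ge0.
- by rewrite mulr_ge0 ?sqr_ge0// mulr_ge0.
- by rewrite mulr_ge0 ?sqr_ge0// mulr_ge0// mulr_ge0.
Qed.

(** U = F1 / e is at first only locally Sobolev. Compactly supported W put e W into the form domain
    and give the weak equation for U; [caccioppoli] then yields U' in L^2(nu), and testing with
    smooth functions identifies the adjoint. *)
Lemma rN_DstarD F H : rN F H ->
  exists2 U, rW12 nu U & {ae leb, forall x, F x = U x} /\ radj nu (derive1 U) H.
Proof.
move=> [lF lH [leF leH [F1 [WF1 FF1 F1E]]]].
have wF1 := W12_wloc WF1; pose U x := F1 x * (e x)^-1.
have wU : wloc U by exact: wlocM wF1 wie.
have eU : (fun x => e x * U x) = F1 by apply/funext => x; rewrite /U mulrC divfK.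
have FU : {ae leb, forall x, F x = U x}.
  by apply: ae_mono FF1 => x h; rewrite /U -h mulrC mulKf.
have mU := continuous_meas (wloc_continuous wU).
have lU : l2 nu U by apply: (l2_ae_leb hnu) FU lF.
have leU := (l2_gam_nu U).1 lU; have leHg := (l2_gam_nu H).1 lH.
have UH := (rA_cpt_form wU leU leHg).1.
have key : forall W M, wloc W -> (forall x, M < `|x| -> W x = 0) ->
     \int[leb]_x (derive1 U x * derive1 W x * (e x ^+ 2 * p x)) =
     \int[leb]_x (H x * W x * (e x ^+ 2 * p x)).
  apply: UH => W M wW W0.
  have WeW : rW12 gam (fun x => e x * W x).
    by apply: (wloc_cpt_rW12 hgam (wlocM we wW) (M := M)) => x /W0 ->; rewrite mulr0.
  rewrite eU F1E//; have [_ leW _] := WeW.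
  apply: ip_ae => //; first by apply: l2D => //; exact: l2Z.
  by apply/(weight_ae hgam); apply: ae_mono FU => x ->.
have lU' := caccioppoli wU lU lH key.
exists U; first by split=> //; exact: wU.1.
split=> //; apply: (radj_test hnu) => // psi tp.
have [_ lp lp'] := test_fun_rW12 hnu tp; have [_ [M p0]] := tp.
rewrite ipC !(weight_ip_l2 hnu)// (key _ M (test_fun_wloc tp) p0).
by congr Rintegral; apply/funext => x; ring.
Qed.

(** Cutoffs enter twice: the energies of e chi U bound (e U)' in L^2(gamma), and the form equation,
    valid for compactly supported functions, is extended to every G1 in W^{1,2}(gamma) through chi
    G1. *)
Lemma DstarD_rN F G H : rD nu F G -> radj nu G H -> rN F H.
Proof.
move=> FG [lG lH GH].
have [U WU [FU GU]] := rD_ac hnu FG; have [aU lU lU'] := WU; have [lF _ _] := FG.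
have wU : wloc U by split=> //; exact: (l2_loc hnu lU').
have leU := (l2_gam_nu U).1 lU; have leH := (l2_gam_nu H).1 lH; have leF := (l2_gam_nu F).1 lF.
have key : forall W M, wloc W -> (forall x, M < `|x| -> W x = 0) ->
     \int[leb]_x (derive1 U x * derive1 W x * (e x ^+ 2 * p x)) =
     \int[leb]_x (H x * W x * (e x ^+ 2 * p x)).
  move=> W M wW W0; have WW := wloc_cpt_rW12 hnu wW W0; have [_ lW lW'] := WW.
  have := GH _ _ (W12_rD hnu WW).
  rewrite ipC (ip_ae lG lU' lW') ?(weight_ip_l2 hnu)//; last exact/(weight_ae hnu).
  by move=> ->; congr Rintegral; apply/funext => x; ring.
have form := (rA_cpt_form wU leU leH).2 key.
have weU := wlocM we wU.
have meU' := meas_derive1 weU.1.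
have meU'2 : measurable_fun [set: measurableTypeR R] (fun x => derive1 (fun y => e y * U y) x ^+ 2) by exact: measurable_funX.
have iU := (weight_integrable hnu (measurable_funX 2 (l2_meas lU))).1 lU.2.
have iU' := (weight_integrable hnu (measurable_funX 2 (l2_meas lU'))).1 lU'.2.
have w0 x : 0 < e x ^+ 2 * p x by exact: weight_gt0 hnu x.
pose w x := e x ^+ 2 * p x.
have leU' : l2 gam (derive1 (fun y => e y * U y)).
  split=> //; apply/(weight_integrable hgam) => //.
  (* [b1] compares chi (e U)' with (e chi U)' at the cost of 2 u, where u and u' are the weighted
     square integrals of U and U'. The ground state identity adds 2 |al| u, and the product rule for
     chi U adds 4 u + 4 u'. *)
  pose C := (2 * `|al| + 6) * \int[leb]_x (U x ^+ 2 * w x) + 4 * \int[leb]_x (derive1 U x ^+ 2 * w x).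
  have iF n : leb.-integrable setT (EFin \o (fun x => cutoff n x ^+ 2 * (derive1 (fun y => e y * U y) x ^+ 2 * p x))).
    apply: (loc_integrable_cpt (M := n.+1%:R)) => [|x /cutoff_eq0 ->]; last by rewrite expr0n mul0r.
    have cc : continuous (cutoff n : R -> R) := wloc_continuous (cutoff_wloc n).
    have := loc_integrableM weU.2.2 (continuous_mul (continuous_mul cc cc) cp).
    by congr loc_integrable; apply/funext => x; ring.
  apply: (@cutoff_bounded_integrable _ _ C) => // [|x|n].
  - exact: measurable_funM meU'2 (weight_meas hgam).
  - by rewrite mulr_ge0 ?sqr_ge0// ltW.
  pose K x : R := cutoff n x * U x.
  have wK : wloc K by exact: wlocM (cutoff_wloc n) wU.
  have K0 x : n.+1%:R < `|x| -> K x = 0 by move=> /cutoff_eq0; rewrite /K => ->; rewrite mul0r.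
  have weK := wlocM we wK.
  have [i1 i2 i4 E] := ground_state_identity wK wK K0.
  have i3 : leb.-integrable setT (EFin \o (fun x => K x * K x * w x)).
    apply/(weight_integrable hnu).
      by apply: measurable_funM; exact: continuous_meas (wloc_continuous wK).
    by have [_ lK _] := wloc_cpt_rW12 hnu wK K0; exact: l2M.
  have b2 : 0 <= \int[leb]_x (V x * (e x * K x) * (e x * K x) * p x).
    apply: Rintegral_ge0 => x _; have /andP[V0 _] := V_bnd x.
    by rewrite -[V x * _ * _]mulrA -expr2 mulr_ge0 ?(ltW (p_gt0 x))// mulr_ge0 ?sqr_ge0.
  have b3 : \int[leb]_x (K x * K x * w x) <= \int[leb]_x (U x ^+ 2 * w x).
    apply: le_Rintegral => // x _; rewrite ler_wpM2r ?(ltW (w0 x))//.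
    have /andP[_ k1] := cutoff_sqr_le1 n x.
    by rewrite /K (_ : _ * _ = cutoff n x ^+ 2 * U x ^+ 2) ?ler_piMl ?sqr_ge0//; ring.
  have b30 : 0 <= \int[leb]_x (K x * K x * w x).
    by apply: Rintegral_ge0 => x _; rewrite -expr2 mulr_ge0 ?sqr_ge0 ?(ltW (w0 x)).
  have b4 : \int[leb]_x (derive1 K x * derive1 K x * w x) <=
      2 * \int[leb]_x (U x ^+ 2 * w x) + 2 * \int[leb]_x (derive1 U x ^+ 2 * w x).
    rewrite -!Rintegral_scale// -Rintegral_add; try exact: integrable_scale.
    apply: ae_le_Rintegral => //; first by apply: integrable_add; exact: integrable_scale.
    apply: ae_mono (ae_derive1M (cutoff_wloc n).1 aU) => x ->; rewrite /w.
    have := w0 x; have /andP[_] := cutoff_sqr_le1 n x; have /andP[_] := dcutoff_sqr_le1 n x.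
    move: (cutoff n x) (derive1 (cutoff n) x) (U x) (derive1 U x) (e x ^+ 2 * p x) => k d u u' P.
    exact: cutoff_product_bound.
  have b1 : \int[leb]_x (cutoff n x ^+ 2 * (derive1 (fun y => e y * U y) x ^+ 2 * p x)) <=
      2 * \int[leb]_x (derive1 (fun y => e y * K y) x * derive1 (fun y => e y * K y) x * p x) +
      2 * \int[leb]_x (U x ^+ 2 * w x).
    rewrite -!Rintegral_scale// -Rintegral_add; try exact: integrable_scale.
    apply: ae_le_Rintegral => //; first by apply: integrable_add; exact: integrable_scale.
    have eKE : (fun y => e y * K y) = (fun y => cutoff n y * (e y * U y)).
      by apply/funext => y; rewrite /K; ring.
    rewrite eKE; apply: ae_mono (ae_derive1M (cutoff_wloc n).1 weU.1) => x ->; rewrite /w.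
    have := p_gt0 x; have /andP[_] := dcutoff_sqr_le1 n x.
    move: (cutoff n x) (derive1 (cutoff n) x) (U x) (e x) (p x) (derive1 (fun y => e y * U y) x) => k d u a P f D1 P0.
    rewrite -subr_ge0.
    have -> : 2 * ((d * (a * u) + k * f) * (d * (a * u) + k * f) * P) + 2 * (u ^+ 2 * (a ^+ 2 * P)) -
      k ^+ 2 * (f ^+ 2 * P) = P * ((k * f + 2 * d * a * u) ^+ 2 + 2 * (1 - d ^+ 2) * (a * u) ^+ 2) by ring.
    have q1 : 0 <= 1 - d ^+ 2 by rewrite subr_ge0.
    by rewrite (mulr_ge0 (ltW P0))// addr_ge0 ?sqr_ge0// mulr_ge0 ?sqr_ge0// mulr_ge0.
  apply: le_trans b1 _; move: E b2 b3 b30 b4; rewrite /q_form -/(w _) /C.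
  exact: cutoff_energy_bound.
have WeU : rW12 gam (fun x => e x * U x) by split=> //; exact: weU.1.
split=> //; split=> //; first by apply: l2D => //; exact: l2Z.
exists (fun x => e x * U x); split=> //; first by apply: ae_mono FU => x ->.
move=> G1 WG1; have [aG1 lG1 lG1'] := WG1; have wG1 := W12_wloc WG1.
rewrite (@ip_ae _ _ _ (fun x => e x * H x + al * (e x * U x)))//; first last.
- by apply/(weight_ae hgam); apply: ae_mono FU => x ->.
- by apply: l2D => //; exact: l2Z.
- by apply: l2D => //; exact: l2Z.
have lS : l2 gam (fun x => e x * H x + al * (e x * U x)) by apply: l2D => //; exact: l2Z.
pose f1 n x := derive1 (fun y => e y * U y) x * derive1 (fun y => cutoff n y * G1 y) x * p x.
have cGn n : wloc (fun x => cutoff n x * G1 x) by exact: wlocM (cutoff_wloc n) wG1.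
(* Only the kinetic term sees the derivative of the cutoff; chi' G1 tends to 0 and is dominated by
   |G1|. *)
have c1 : \int[leb]_x f1 n x @[n --> \oo] --> \int[leb]_x (derive1 (fun y => e y * U y) x * derive1 G1 x * p x).
  have iG1 := l2M leU' lG1; have iG1' := l2M leU' lG1'.
  have mG1 := l2_meas lG1; have mG1' := l2_meas lG1'.
  have j1 := (weight_integrable hgam (measurable_funM meU' mG1)).1 iG1.
  have j2 := (weight_integrable hgam (measurable_funM meU' mG1')).1 iG1'.
  have jn f : leb.-integrable setT (EFin \o f) -> leb.-integrable setT (EFin \o (fun x => `|f x|)).
    by move=> i_f; exact: integrable_norm.
  have aeP : {ae leb, forall x, forall n, derive1 (fun y => cutoff n y * G1 y) x =
      derive1 (cutoff n) x * G1 x + cutoff n x * derive1 G1 x}.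
    by apply/ae_foralln => n; exact: ae_derive1M (cutoff_wloc n).1 aG1.
  apply: (dominated_Rintegral _ _ _ (integrable_add (jn _ j1) (jn _ j2)) _).2.
  - move=> n; apply: measurable_funM (weight_meas hgam); apply: measurable_funM meU' _.
    exact: meas_derive1 (cGn n).1.
  - exact: measurable_funM (measurable_funM meU' mG1') (weight_meas hgam).
  - apply: ae_mono aeP => x E; rewrite /f1; apply: cvgM; last exact: cvg_cst.
    apply: cvgM; first exact: cvg_cst.
    rewrite (_ : (fun n => _) = (fun n => derive1 (cutoff n) x * G1 x + cutoff n x * derive1 G1 x)); last exact/funext.
    rewrite -[X in _ --> X]add0r -[X in _ --> X + _](mul0r (G1 x)) -[X in _ --> _ + X]mul1r.
    by apply: cvgD; apply: cvgM; [exact: cutoff_derive_cvg|exact: cvg_cst|exact: cutoff_cvg|exact: cvg_cst].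
  - apply: ae_mono aeP => x E n; rewrite /f1 E.
    have -> : derive1 (fun y => e y * U y) x * (derive1 (cutoff n) x * G1 x + cutoff n x * derive1 G1 x) * p x =
       derive1 (cutoff n) x * (derive1 (fun y => e y * U y) x * G1 x * p x) +
       cutoff n x * (derive1 (fun y => e y * U y) x * derive1 G1 x * p x) by ring.
    apply: le_trans (ler_normD _ _) _; rewrite !(normrM _ (_ * p x)); apply: lerD; apply: ler_piMl => //.
      exact: cutoff_derive1_le1.
    by rewrite ger0_norm ?cutoff_ge0// cutoff_le1.
have mc n : measurable_fun [set: measurableTypeR R] (cutoff n : R -> R) by exact: meas_cutoff.
have mc1 n (x : R) : `|cutoff n x| <= 1 by rewrite ger0_norm ?cutoff_ge0// cutoff_le1.
(* The potential may be unbounded; its term is integrable by the Gaussian moment bound for e U and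
   G1. *)
have [_ c2] := unit_cvg_integral mc mc1 (@cutoff_cvg R) (integrable_V WeU WG1).
have iS := (weight_integrable hgam (measurable_funM (l2_meas lS) (l2_meas lG1))).1 (l2M lS lG1).
have [_ c3] := unit_cvg_integral mc mc1 (@cutoff_cvg R) iS.
rewrite (weight_ip_l2 hgam)//; apply: (cvg_unique _ _ c3) => //.
rewrite /q_form; apply: cvg_trans (cvgD c1 c2); apply: near_eq_cvg; apply: nearW => n.
pose W x := cutoff n x * G1 x * (e x)^-1.
have wW : wloc W by exact: wlocM (cGn n) wie.
have W0 x : n.+1%:R < `|x| -> W x = 0 by move=> /cutoff_eq0; rewrite /W => ->; rewrite !mul0r.
have eW : (fun x => e x * W x) = (fun x => cutoff n x * G1 x).
  by apply/funext => x; rewrite /W mulrC divfK.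
have := form W _ wW W0; rewrite eW /q_form (weight_ip_l2 hgam)//; last first.
  have [|] := @wloc_cpt_rW12 _ _ _ hgam _ n.+1%:R (cGn n) => //.
  by move=> x /cutoff_eq0 ->; rewrite mul0r.
move=> E; transitivity (\int[leb]_x f1 n x + \int[leb]_x (cutoff n x * (V x * (e x * U x) * G1 x * p x))) => //.
rewrite /f1.
rewrite (_ : (fun x => cutoff n x * (V x * (e x * U x) * G1 x * p x)) =
  (fun x => V x * (e x * U x) * (cutoff n x * G1 x) * p x)); last by apply/funext => x; ring.
by rewrite E; congr Rintegral; apply/funext => x /=; ring.
Qed.

End GroundState.

(** * Complexification *)

Section ComplexL2.
Context {R : realType}.
Variable m : {measure set (measurableTypeR R) -> \bar R}.
Implicit Types (f g h k : R -> R[i]) (F G H K : R -> R) (T : graph R).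

Definition re f : R -> R := fun x => complex.Re (f x).
Definition im f : R -> R := fun x => complex.Im (f x).
Definition cplx F G : R -> R[i] := fun x => Complex (F x) (G x).

Lemma re_sub f g : re (f \- g) = (fun x => re f x - re g x).
Proof. by apply/funext => x; rewrite /re /=; case: (f x) (g x) => [? ?] [? ?]. Qed.

Lemma im_sub f g : im (f \- g) = (fun x => im f x - im g x).
Proof. by apply/funext => x; rewrite /im /=; case: (f x) (g x) => [? ?] [? ?]. Qed.

Lemma re_mul_conj f g x : complex.Re (f x * conjc (g x)) = re f x * re g x + im f x * im g x.
Proof. by rewrite /re /im; case: (f x) (g x) => [? ?] [? ?] /=; ring. Qed.

Lemma im_mul_conj f g x : complex.Im (f x * conjc (g x)) = im f x * re g x - re f x * im g x.
Proof. by rewrite /re /im; case: (f x) (g x) => [? ?] [? ?] /=; ring. Qed.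

Lemma L2P f : L2 m f <-> l2 m (re f) /\ l2 m (im f).
Proof.
split=> [[mr mi fin]|[lr li]].
  have isum : m.-integrable setT (EFin \o (fun x => re f x ^+ 2 + im f x ^+ 2)).
    apply/integrableP; split.
      by apply/measurable_EFinP; apply: measurable_funD; exact: measurable_funX.
    by under eq_integral do rewrite /= ger0_norm ?addr_ge0 ?sqr_ge0//.
  by split; split=> //; apply: (integrable_dom _ isum) => [|x]; (try exact: measurable_funX);
    rewrite ger0_norm ?sqr_ge0// ?lerDl ?lerDr sqr_ge0.
split; [exact: l2_meas lr|exact: l2_meas li|].
have := integrable_fin_num measurableT (integrable_add lr.2 li.2).
by move=> /fineK => h; rewrite /L2sq -[X in (X < _)%E]h ltry.
Qed.

Lemma L2sqE f : L2 m f -> L2sq m f = (ip m (re f) (re f) + ip m (im f) (im f))%:E.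
Proof.
move=> /L2P[lr li]; rewrite /L2sq -(fineK (integrable_fin_num measurableT (integrable_add lr.2 li.2))).
congr EFin; transitivity (\int[m]_x (re f x ^+ 2 + im f x ^+ 2)) => //.
rewrite (Rintegral_add lr.2 li.2).
by congr (_ + _); congr Rintegral; apply/funext => x; rewrite expr2.
Qed.

Lemma innerE f g : L2 m f -> L2 m g -> inner m f g =
  Complex (ip m (re f) (re g) + ip m (im f) (im g)) (ip m (im f) (re g) - ip m (re f) (im g)).
Proof.
move=> /L2P[lr li] /L2P[lr' li']; rewrite /inner /cintegral; congr Complex.
  rewrite -Rintegral_add; [|exact: l2M|exact: l2M].
  by congr Rintegral; apply/funext => x; exact: re_mul_conj.
rewrite -mulN1r -Rintegral_scale; last exact: l2M.
rewrite -Rintegral_add; [|exact: l2M|by apply: integrable_scale; exact: l2M].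
by congr Rintegral; apply/funext => x; rewrite mulN1r; exact: im_mul_conj.
Qed.

Lemma aeqP f g : aeq m f g <->
  {ae m, forall x, re f x = re g x} /\ {ae m, forall x, im f x = im g x}.
Proof.
split=> [h|[h1 h2]].
  by split; apply: ae_mono h => x /(_ Logic.I); rewrite /re /im => ->.
apply: ae_mono (ae_and h1 h2) => x [h3 h4] _.
by move: h3 h4; rewrite /re /im; case: (f x) (g x) => [? ?] [? ?] /= -> ->.
Qed.

Lemma l2_cplx F G : l2 m F -> l2 m G -> L2 m (cplx F G).
Proof. by move=> lF lG; apply/L2P. Qed.

(* [T] is the complexification of a real operator [rT]. *)
Definition split_graph T (rT : (R -> R) -> (R -> R) -> Prop) : Prop :=
  (forall f g, T f g <-> rT (re f) (re g) /\ rT (im f) (im g)) /\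
  (rT (fun=> 0) (fun=> 0) /\ forall F G, rT F G -> l2 m F /\ l2 m G).

Definition radjoint (rT : (R -> R) -> (R -> R) -> Prop) G H : Prop :=
  [/\ l2 m G, l2 m H & forall F K, rT F K -> ip m K G = ip m F H].

Definition rcompose (rS rT : (R -> R) -> (R -> R) -> Prop) F H : Prop :=
  exists2 G, rT F G & rS G H.

Lemma ip0l G : l2 m G -> ip m (fun=> 0) G = 0.
Proof. by move=> lG; rewrite /ip; under eq_Rintegral do rewrite mul0r; rewrite Rintegral_cst// mul0r. Qed.

(** T contains the pairs with vanishing imaginary part, and testing with them separates the real and
    imaginary parts of the adjoint identity. *)
Lemma split_adjoint T rT : split_graph T rT -> forall g h,
  adjoint m T g h <-> radjoint rT (re g) (re h) /\ radjoint rT (im g) (im h).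
Proof.
move=> [TE [T0 Tl]] g h; split=> [[Lg Lh gh]|[[lg lh GH] [lg' lh' GH']]].
  have [/L2P[lg lg'] /L2P[lh lh']] := (Lg, Lh).
  have key F K : rT F K -> ip m K (re g) = ip m F (re h) /\ ip m K (im g) = ip m F (im h).
    move=> FK; have [lF lK] := Tl _ _ FK; have l0 := l2_0 m.
    have Tc : T (cplx F (fun=> 0)) (cplx K (fun=> 0)) by apply/TE; split.
    have := gh _ _ Tc; rewrite !innerE//; try exact: l2_cplx.
    by move=> [] /=; rewrite !ip0l// !addr0 !sub0r => -> /oppr_inj ->.
  by split; split=> // F K /key[].
split=> [||f k /TE[fk fk']]; [exact/L2P|exact/L2P|].
have [lf lk] := Tl _ _ fk; have [lf' lk'] := Tl _ _ fk'.
rewrite !innerE//; try exact/L2P.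
by rewrite (GH _ _ fk) (GH _ _ fk') (GH' _ _ fk) (GH' _ _ fk').
Qed.

Lemma split_radjoint T rT : split_graph T rT -> split_graph (adjoint m T) (radjoint rT).
Proof.
move=> sT; split=> [g h|]; first exact: split_adjoint.
split=> [|F G []//]; split; [exact: l2_0|exact: l2_0|move=> F K /(sT.2.2)[lF lK]].
by rewrite !(ipC _ _ (fun=> 0)) !ip0l.
Qed.

Lemma split_compose S T rS rT : split_graph S rS -> split_graph T rT ->
  split_graph (compose S T) (rcompose rS rT).
Proof.
move=> [SE [S0 Sl]] [TE [T0 Tl]]; split=> [f h|]; last first.
  by split=> [|F H [G /Tl[lF _] /Sl[_ lH]]//]; exists (fun=> 0).
split=> [[g /TE[t t'] /SE[s s']]|[[G t s] [G' t' s']]].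
  by split; [exists (re g)|exists (im g)].
by exists (cplx G G'); [apply/TE|apply/SE].
Qed.

End ComplexL2.

(** * The Gaussian density, the potential and the complex form *)

Section GaussianWeight.
Context {R : realType}.
Implicit Types (F G H K : R -> R).
Local Notation leb := (@lebesgue_measure R).

Definition gpdf : R -> R := normal_pdf 0 1.

Lemma gpdfE (x : R) : gpdf x = normal_peak 1 * expR (- 2^-1 * (x * x)).
Proof.
rewrite /gpdf normal_pdfE ?oner_neq0//; transitivity (normal_peak 1 * normal_fun 0 1 x) => //.
by rewrite /normal_fun subr0 expr1n; congr (_ * expR _); rewrite expr2 mulNr mulrC mulr2n; field.
Qed.

Lemma is_derive_gpdf (x : R) : is_derive x 1 gpdf (- x * gpdf x).
Proof.
rewrite (_ : gpdf = fun y => normal_peak 1 * expR (- 2^-1 * (y * y))); last exact/funext/gpdfE.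
have d1 : is_derive x 1 (fun y : R => y) 1 by exact: is_derive_id.
have d2 := is_derive_mul (is_derive_const (- 2^-1) x) (is_derive_mul d1 d1).
have d3 := @is_derive1_comp R expR _ x _ _ (is_derive_expR _) d2.
have := is_derive_mul (is_derive_const (normal_peak 1) x) d3.
by congr (is_derive _ _ _ _) => /=; field.
Qed.

Lemma gpdf'E (x : R) : derive1 gpdf x = - x * gpdf x.
Proof. by have [] := is_derive_derive1 (is_derive_gpdf x). Qed.

Lemma gaussian_weight : weight (@gaussian R) gpdf.
Proof.
have cg : continuous gpdf by apply: continuous_normal_pdf; exact: oner_neq0.
split=> [x|x||A mA].
- by rewrite gpdfE mulr_gt0 ?expR_gt0// normal_peak_gt0// oner_neq0.
- by have [] := is_derive_derive1 (is_derive_gpdf x).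
- rewrite (_ : derive1 gpdf = fun x => - x * gpdf x); last exact/funext/gpdf'E.
  by apply: continuous_mul cg => x; apply: cvgN; exact: cvg_id.
- by [].
Qed.

Lemma nu_weight (e : {mfun measurableTypeR R >-> R}) : (forall x, 0 < e x) ->
  (forall x, derivable (e : R -> R) x 1) -> continuous (derive1 (e : R -> R)) ->
  weight (nu_ e) (fun x => e x ^+ 2 * gpdf x).
Proof.
move=> e0 de ce'; have hg := gaussian_weight; have [g0 dg cg' gE] := hg.
have ce : continuous (e : R -> R) by apply: wloc_continuous; exact: wloc_C1.
have cg := weight_continuous hg.
have dd (x : R) : is_derive x 1 (fun x => e x ^+ 2 * gpdf x)
   ((derive1 e x * e x + e x * derive1 e x) * gpdf x + e x ^+ 2 * derive1 gpdf x).
  have de' := derivable_is_derive (de x).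
  exact: is_derive_mul (is_derive_mul de' de') (derivable_is_derive (dg x)).
have me2 : measurable_fun [set: measurableTypeR R] (fun x => (e x ^+ 2)%:E).
  by apply/measurable_EFinP; apply: measurable_funX; exact: continuous_meas.
split=> [x|x||A mA].
- by rewrite mulr_gt0// exprn_gt0.
- by have [] := is_derive_derive1 (dd x).
- rewrite (_ : derive1 _ = (fun x => (derive1 e x * e x + e x * derive1 e x) * gpdf x + (e x * e x) * derive1 gpdf x)); last first.
    by apply/funext => x; have [_ ->] := is_derive_derive1 (dd x).
  move=> x; apply: cvgD; last exact: (continuous_mul (continuous_mul ce ce) cg').
  apply: cvgM; last exact: cg.
  by apply: cvgD; apply: cvgM; [exact: ce'|exact: ce|exact: ce|exact: ce'].
- rewrite [LHS]integral_mkcond (ge0_integral_density (weight_meas hg) _ gE).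
  + rewrite [RHS]integral_mkcond; apply: eq_integral => x _; rewrite !patchE.
    by case: ifPn => _; rewrite ?mul0e.
  + by move=> x; exact: ltW.
  + exact: ((measurable_restrictT _ mA).1 (measurable_funTS me2)).
  + by move=> x; apply: erestrict_ge0 => y _; rewrite lee_fin sqr_ge0.
Qed.

(* This is c x^2 1_{x < 0}, written so that continuity is visible. *)
Definition pot (c x : R) : R := c / 4 * (x - `|x|) ^+ 2.

Lemma pot_continuous c : continuous (pot c).
Proof.
have cm : continuous (fun x : R => x - `|x|).
  by move=> x; apply: cvgB; [exact: cvg_id|exact: norm_continuous].
move=> x; apply: cvgM; first exact: cvg_cst.
exact: (continuous_mul cm cm).
Qed.

Lemma pot_bound c x : 0 <= c -> 0 <= pot c x <= c * x ^+ 2.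
Proof.
move=> c0; rewrite /pot; have [x0|x0] := leP 0 x.
  by rewrite ger0_norm// subrr expr0n mulr0 lexx; apply: mulr_ge0 => //; exact: sqr_ge0.
rewrite ltr0_norm// (_ : c / 4 * (x - - x) ^+ 2 = c * x ^+ 2) ?lexx ?andbT; last by field.
by apply: mulr_ge0 => //; exact: sqr_ge0.
Qed.

Lemma pot_integral c k : measurable_fun [set: measurableTypeR R] k ->
  leb.-integrable setT (EFin \o (fun x => x ^+ 2 * k x * gpdf x)) ->
  c * \int[gaussian]_(x in [set x | x < 0]) (x ^+ 2 * k x) = \int[leb]_x (pot c x * k x * gpdf x).
Proof.
move=> mk ik; have hg := gaussian_weight.
have mx2 : measurable_fun [set: measurableTypeR R] (fun x : R => x ^+ 2 * k x).
  by apply: measurable_funM mk; apply: measurable_funX; exact: measurable_id.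
have mp : measurable_fun [set: measurableTypeR R] (fun x => pot 1 x * k x).
  by apply: measurable_funM mk; apply: continuous_meas; exact: pot_continuous.
have ip1 : gaussian.-integrable setT (EFin \o (fun x => pot 1 x * k x)).
  apply: (@integrable_dom _ _ _ (fun x => `|x ^+ 2 * k x|)) => //.
    by apply: integrable_norm; exact: (weight_integrable hg mx2).2.
  move=> x; have /andP[h1 h2] := pot_bound x (@ler01 R); rewrite normrM (ger0_norm h1) normrM.
  by rewrite ler_wpM2r// ger0_norm ?sqr_ge0// -[x ^+ 2]mul1r.
have -> : \int[gaussian]_(x in [set x | x < 0]) (x ^+ 2 * k x) = \int[gaussian]_x (pot 1 x * k x).
  rewrite /Rintegral integral_mkcond; congr fine; apply: eq_integral => x _; rewrite patchE /pot.
  have [x0|x0] := leP 0 x; last by rewrite mem_set//= ltr0_norm//; congr EFin; field.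
  rewrite memNset; first by rewrite ger0_norm// subrr expr0n !mulr0 mul0r.
  by move=> /= /lt_le_trans /(_ x0); rewrite ltxx.
rewrite -Rintegral_scale// (weight_Rintegral hg); last exact: measurable_funM.
by congr Rintegral; apply/funext => x; rewrite /pot; ring.
Qed.

Lemma test_fun0 : test_fun (fun=> 0 : R).
Proof. by split; [exact: smooth_cst|exists 0]. Qed.

Lemma Cc_inftyP (f : R -> R[i]) : Cc_infty f <-> test_fun (re f) /\ test_fun (im f).
Proof.
split=> [[sr si [M fM]]|[[sr [M rM]] [si [N iN]]]].
  by split; (split; [assumption|]); exists M => x /fM; rewrite /re /im => ->.
split; [exact: sr|exact: si|exists (Num.max M N) => x].
rewrite gt_max => /andP[/rM + /iN].
by rewrite /re /im; case: (f x) => a b /= -> ->.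
Qed.

Lemma complex_scaleE (c a b : R) : c%:C%C * Complex a b = Complex (c * a) (c * b).
Proof. by apply/eqP; rewrite eq_complex /= !mul0r subr0 addr0 !eqxx. Qed.

Lemma complex_addACA (a b c d a' b' c' d' : R) :
  Complex (a + b) (c - d) + Complex (a' + b') (c' - d') =
  Complex (a + a' + (b + b')) (c + c' - (d + d')).
Proof. by apply/eqP; rewrite eq_complex /= opprD !(addrACA _ _ a') !(addrACA _ _ c') !eqxx. Qed.

Lemma W12P (m : {measure set (measurableTypeR R) -> \bar R}) (f : R -> R[i]) :
  W12 m f <-> rW12 m (re f) /\ rW12 m (im f).
Proof.
split=> [[[a1 a2] /L2P[l1 l2] /L2P[d1 d2]]|[[a1 l1 d1] [a2 l2 d2]]]; first by [].
by split=> //; apply/L2P.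
Qed.

Variable e : {mfun measurableTypeR R >-> R}.
Hypothesis e_gt0 : forall x, 0 < e x.
Hypothesis de : forall x, derivable (e : R -> R) x 1.
Hypothesis ce' : continuous (derive1 (e : R -> R)).
Let hnu := nu_weight e_gt0 de ce'.

Lemma rD0 : rD (nu_ e) (fun=> 0) (fun=> 0).
Proof.
have := rD_test hnu test_fun0; congr rD; apply/funext => x; exact: derive1_cst.
Qed.

Lemma split_D : split_graph (nu_ e) (D_ e) (rD (nu_ e)).
Proof.
split; last by split=> [|F G []//]; exact: rD0.
move=> f g; split=> [[/L2P[lf lf'] /L2P[lg lg'] h]|[[lf lg h] [lf' lg' h']]].
  split; split=> // d d0; have [f1 [g1 [[/Cc_inftyP[t1 t2] ->]]]] := h d d0.
    have [_ l1 l1'] := test_fun_rW12 hnu t1; have [_ l2 l2'] := test_fun_rW12 hnu t2.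
    rewrite !L2sqE; [|apply/L2P..]; rewrite !re_sub !im_sub; try (split; exact: l2B).
    rewrite !lte_fin => h1 h2; exists (re f1) => //.
    split; [apply: le_lt_trans h1|apply: le_lt_trans h2]; rewrite lerDl; exact: ip_ge0.
  have [_ l1 l1'] := test_fun_rW12 hnu t1; have [_ l2 l2'] := test_fun_rW12 hnu t2.
  rewrite !L2sqE; [|apply/L2P..]; rewrite !re_sub !im_sub; try (split; exact: l2B).
  rewrite !lte_fin => h1 h2; exists (im f1) => //.
  split; [apply: le_lt_trans h1|apply: le_lt_trans h2]; rewrite lerDr; exact: ip_ge0.
split; [exact/L2P|exact/L2P|move=> d d0].
have d20 : 0 < d / 2 by rewrite divr_gt0.
have [p1 t1 [h1 h2]] := h _ d20; have [p2 t2 [h3 h4]] := h' _ d20.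
have [_ l1 l1'] := test_fun_rW12 hnu t1; have [_ l2 l2'] := test_fun_rW12 hnu t2.
exists (cplx p1 p2), (cderiv (cplx p1 p2)); split; first by split=> //; apply/Cc_inftyP.
  rewrite L2sqE; last by apply/L2P; rewrite re_sub im_sub; split; exact: l2B.
  by rewrite re_sub im_sub lte_fin (splitr d); exact: ltrD h1 h3.
rewrite L2sqE; last by apply/L2P; rewrite re_sub im_sub; split; exact: l2B.
by rewrite re_sub im_sub lte_fin (splitr d); exact: ltrD h2 h4.
Qed.

Section Form.
Variable mu : R.
Hypotheses (mu_gt0 : 0 < mu) (mu_le1 : mu <= 1).
Let V := pot (c_ mu).

Lemma c_mu_ge0 : 0 <= c_ mu.
Proof.
rewrite /c_ divr_ge0//; last by rewrite mulr_ge0// sqr_ge0.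
by rewrite subr_ge0 exprn_ile1// ltW.
Qed.

Lemma V_bnd x : 0 <= V x <= c_ mu * x ^+ 2.
Proof. exact: pot_bound c_mu_ge0. Qed.

Let rq := q_form gpdf V.

Let V_int F G : rW12 gaussian F -> rW12 gaussian G ->
  leb.-integrable setT (EFin \o (fun x => V x * F x * G x * gpdf x)) /\
  leb.-integrable setT (EFin \o (fun x => x ^+ 2 * F x * G x * gpdf x)).
Proof.
move=> WF WG; split; first exact: (integrable_V gaussian_weight gpdf'E (@pot_continuous _) V_bnd).
have cid2 : continuous (fun x : R => x ^+ 2).
  by apply: (@continuous_mul _ (fun x => x) (fun x => x)) => x; exact: cvg_id.
apply: (integrable_V gaussian_weight gpdf'E cid2 (c := 1)) => // x.
by rewrite mul1r lexx sqr_ge0.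
Qed.

Lemma a_formE f g : W12 gaussian f -> W12 gaussian g -> a_form mu f g =
  Complex (rq (re f) (re g) + rq (im f) (im g)) (rq (im f) (re g) - rq (re f) (im g)).
Proof.
move=> Wf Wg; have [_ _ Lf'] := Wf; have [_ _ Lg'] := Wg.
have /W12P[Wr Wi] := Wf; have /W12P[Wr' Wi'] := Wg.
have hg := gaussian_weight.
have mW F : rW12 gaussian F -> measurable_fun [set: measurableTypeR R] F by move=> [_ /l2_meas].
have mWd F : rW12 gaussian F -> measurable_fun [set: measurableTypeR R] (derive1 F) by move=> [_ _ /l2_meas].
have qE F G : rW12 gaussian F -> rW12 gaussian G ->
  rq F G = ip gaussian (derive1 F) (derive1 G) + \int[leb]_x (V x * F x * G x * gpdf x).
  by move=> WF WG; rewrite (weight_ip hg)//; exact: mWd.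
have kint F G F' G' (s : R) : rW12 gaussian F -> rW12 gaussian G -> rW12 gaussian F' -> rW12 gaussian G' ->
   c_ mu * \int[gaussian]_(x in [set x | x < 0]) (x ^+ 2 * (F x * G x + s * (F' x * G' x))) =
   \int[leb]_x (V x * F x * G x * gpdf x) + s * \int[leb]_x (V x * F' x * G' x * gpdf x).
  move=> WF WG WF' WG'; have [i1 j1] := V_int WF WG; have [i2 j2] := V_int WF' WG'.
  rewrite pot_integral.
  - rewrite -Rintegral_scale// -Rintegral_add//; last exact: integrable_scale.
    by congr Rintegral; apply/funext => x; rewrite /V; ring.
  - apply: measurable_funD; first exact: measurable_funM (mW _ WF) (mW _ WG).
    by apply: measurable_funM => //; exact: measurable_funM (mW _ WF') (mW _ WG').
  - have := integrable_add j1 (integrable_scale s j2).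
    by apply: eq_integrable => // x _ /=; congr EFin; ring.
rewrite /a_form innerE// /cintegral !qE//.
have e1 := kint _ _ _ _ 1 Wr Wr' Wi Wi'; have e2 := kint _ _ _ _ (-1) Wi Wr' Wr Wi'.
rewrite mul1r in e1; rewrite mulN1r in e2.
rewrite (_ : (fun x => complex.Re ((x ^+ 2)%:C%C * f x * conjc (g x))) =
   (fun x => x ^+ 2 * (re f x * re g x + 1 * (im f x * im g x)))); last first.
  by apply/funext => x; rewrite /re /im; case: (f x) (g x) => [? ?] [? ?] /=; ring.
rewrite (_ : (fun x => complex.Im ((x ^+ 2)%:C%C * f x * conjc (g x))) =
   (fun x => x ^+ 2 * (im f x * re g x + -1 * (re f x * im g x)))); last first.
  by apply/funext => x; rewrite /re /im; case: (f x) (g x) => [? ?] [? ?] /=; ring.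
by rewrite complex_scaleE e1 e2 complex_addACA.
Qed.

Lemma rW12_0 (m : {measure set (measurableTypeR R) -> \bar R}) w : weight m w -> rW12 m (fun=> 0).
Proof. by move=> hw; exact: test_fun_rW12 hw _ test_fun0. Qed.

Lemma q_form0 F : rq F (fun=> 0) = 0.
Proof.
rewrite /rq /q_form; under eq_Rintegral do rewrite derive1_cst mulr0 mul0r.
under [X in _ + X]eq_Rintegral do rewrite mulr0 mul0r.
by rewrite Rintegral_cst// mul0r addr0.
Qed.

(** Real test functions decouple the form equation into two real ones; conversely a complex test
    function is reassembled from its two parts by [a_formE]. *)
Lemma A_split f h : A_ mu f h <->
  rA gaussian gpdf V (re f) (re h) /\ rA gaussian gpdf V (im f) (im h).
Proof.
have hg := gaussian_weight; have W0 := rW12_0 hg; have [_ l0 _] := W0.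
split=> [[/L2P[lf lf'] Lh [f1 [Wf1 /aeqP[a1 a2] f1E]]]|[[lf lh [F1 [WF1 a1 E1]]] [lf' lh' [F2 [WF2 a2 E2]]]]].
  have /L2P[lh lh'] := Lh; have /W12P[Wr Wi] := Wf1.
  have key G : rW12 gaussian G -> rq (re f1) G = ip gaussian (re h) G /\ rq (im f1) G = ip gaussian (im h) G.
    move=> WG; have [_ lG _] := WG; have Wg : W12 gaussian (cplx G (fun=> 0)) := (W12P _ (cplx _ _)).2 (conj WG W0).
    have := f1E _ Wg; rewrite a_formE// innerE//; last by case: Wg.
    move=> [] /=; rewrite -[re (cplx _ _)]/G -[im (cplx _ _)]/(fun=> 0).
    by rewrite !q_form0 !(ipC _ _ (fun=> 0)) !ip0l// !addr0 !subr0.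
  split; split=> //; [exists (re f1)|exists (im f1)]; split=> //; try exact/(weight_ae hg).
  - by move=> G /key[].
  - by move=> G /key[].
split; [exact/L2P|exact/L2P|exists (cplx F1 F2)].
have Wc : W12 gaussian (cplx F1 F2) by apply/W12P.
split=> //; first by apply/aeqP; split; exact/(weight_ae hg).
move=> g Wg; rewrite a_formE// innerE//; [|exact/L2P|by case: Wg].
by have /W12P[W1 W2] := Wg; rewrite -!E1 -?E2.
Qed.

Variable al : R.

Lemma split_N f h : N_ mu al e f h <->
  rN gaussian (nu_ e) gpdf e V al (re f) (re h) /\ rN gaussian (nu_ e) gpdf e V al (im f) (im h).
Proof.

have E1 : re (G_ e f) = (fun x => e x * re f x).
  by apply/funext => x; rewrite /G_ /re; case: (f x) => ? ? /=; ring.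
have E2 : im (G_ e f) = (fun x => e x * im f x).
  by apply/funext => x; rewrite /G_ /im; case: (f x) => ? ? /=; ring.
have E3 : re (fun x => G_ e h x + al%:C%C * G_ e f x) = (fun x => e x * re h x + al * (e x * re f x)).
  by apply/funext => x; rewrite /G_ /re; case: (f x) (h x) => [? ?] [? ?] /=; ring.
have E4 : im (fun x => G_ e h x + al%:C%C * G_ e f x) = (fun x => e x * im h x + al * (e x * im f x)).
  by apply/funext => x; rewrite /G_ /im; case: (f x) (h x) => [? ?] [? ?] /=; ring.
split=> [[/L2P[lf lf'] /L2P[lh lh'] /A_split]|[[lf lh A1] [lf' lh' A2]]].
  by rewrite E1 E2 E3 E4 => -[].
by split; [exact/L2P|exact/L2P|apply/A_split; rewrite E1 E2 E3 E4].
Qed.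

End Form.
End GaussianWeight.

(** * Square roots of [D^* D] in complex L^2 *)

Section SquareRoot.
Context {R : realType}.
Variables (m : {measure set (measurableTypeR R) -> \bar R}) (w : R -> R).
Hypothesis hw : weight m w.
Implicit Types (F G H K : R -> R) (f g h k : R -> R[i]).
Local Notation lip := (@l2_ip R m).
Local Notation cls := (l2_class m).

Lemma addr_cancel0 (a b c d : R) : b = 0 -> d = 0 -> a + b = c + d -> a = c.
Proof. by move=> -> ->; rewrite !addr0. Qed.

Lemma add0r_cancel (a b c d : R) : a = 0 -> c = 0 -> a + b = c + d -> b = d.
Proof. by move=> -> ->; rewrite !add0r. Qed.

Lemma hD_dense : hdense lip (hdom (@hD R m)).
Proof.
move=> f e e0; have hax := l2_hilbert m.
have [D0 DD DZ] := hD_lin hw.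
have sK : lin_subspace (hclosure lip (hdom (@hD R m))).
  apply: (hclosure_subspace hax); split.
  - by exists 0.
  - by move=> x y [x' Dx] [y' Dy]; exists (x' + y'); exact: DD.
  - by move=> a x [x' Dx]; exists (a *: x'); exact: DZ.
have [k Kk orth] := hilbert_projection hax sK (hclosure_closed hax (K := _)) f.
have lr := l2_repP (f - k).
suff fk : f - k = 0.
  have fE : f = k by apply/eqP; rewrite -subr_eq0 fk.
  have [y Dy yk] := (hclosureP lip _ k).1 Kk e e0.
  by exists y => //; rewrite fE (hnormBC hax).
rewrite -(l2_repK (f - k)) -l2_class0; apply/l2_class_eq => //; first exact: l2_0.
apply/(weight_ae hw)/(test_fun_dense hw lr) => psi tp.
have [_ lp lp'] := test_fun_rW12 hw tp.
rewrite -(l2_ipE lr lp) l2_repK; apply: orth; apply: sub_hclosure => //.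
by exists (cls (derive1 psi)); apply/(hD_class hw) => //; exact: (rD_test hw tp).
Qed.

(** Pulls a relation on classes back to functions; the L^2 conditions are explicit because classes
    represent functions only there. *)
Definition real_of (T : l2space m -> l2space m -> Prop) F K : Prop :=
  [/\ l2 m F, l2 m K & T (cls F) (cls K)].

Lemma real_of_rep (T : l2space m -> l2space m -> Prop) (u v : l2space m) :
  T u v -> real_of T (l2_rep u) (l2_rep v).
Proof. by move=> Tuv; split; [exact: l2_repP|exact: l2_repP|rewrite !l2_repK]. Qed.

Lemma rD_real_of : rD m = real_of (@hD R m).
Proof.
apply/funext => F; apply/funext => K; apply/propext; split=> [FK|[lF lK /(hD_class hw)]//]; last exact.
by have [lF lK _] := FK; split=> //; apply/(hD_class hw).
Qed.

Lemma radjoint_real_of T : radjoint m (real_of T) = real_of (hadj lip T).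
Proof.
apply/funext => G; apply/funext => H; apply/propext; split=> [[lG lH GH]|[lG lH GH]];
  (split; [exact: lG|exact: lH|]).
  move=> f k fk; have := GH _ _ (real_of_rep fk); rewrite -!l2_ipE ?l2_repK//; exact: l2_repP.
by move=> F K [lF lK FK]; have := GH _ _ FK; rewrite !l2_ipE.
Qed.

Lemma rcompose_real_of S T : rcompose (real_of S) (real_of T) = real_of (hcompose S T).
Proof.
apply/funext => F; apply/funext => H; apply/propext; split=> [[G [lF lG FG] [_ lH GH]]|[lF lH [g Fg gH]]].
  by split=> //; exists (cls G).
by exists (l2_rep g); split; rewrite ?l2_repK//; exact: l2_repP.
Qed.

Lemma real_sqrt_exists : exists S : l2space m -> l2space m -> Prop,
  [/\ radjoint m (real_of S) = real_of S, real_of S (fun=> 0) (fun=> 0),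
    forall F e, l2 m F -> 0 < e -> exists2 G, (exists K, real_of S G K) &
      ip m (fun x => F x - G x) (fun x => F x - G x) < e,
    forall F K, real_of S F K -> 0 <= ip m K F &
    rcompose (real_of S) (real_of S) = rcompose (radjoint m (rD m)) (rD m)].
Proof.
have hax := l2_hilbert m.
have [S [SE Sd S0 SS]] := sqrt_graph_exists hax (hD_lin hw) (hD_closed hw) hD_dense.
have SA : hadj lip S = S by apply/funext => f; apply/funext => g; apply/propext; split=> /SE.
exists S; split.
- by rewrite radjoint_real_of SA.
- split; [exact: l2_0|exact: l2_0|rewrite l2_class0 -SA].
  by have [] := hadj_lin hax S.
- move=> F e lF e0; have se0 : 0 < Num.sqrt e by rewrite sqrtr_gt0.
  have [y [z yz] Fy] := Sd (cls F) _ se0.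
  exists (l2_rep y); first by exists (l2_rep z); exact: real_of_rep.
  have ly := l2_repP y.
  move: Fy; rewrite -(hnorm_lt hax)// sqr_sqrtr ?(ltW e0)// -{1 2}(l2_repK y).
  by rewrite -l2_classB// l2_ipE//; exact: l2B.
- by move=> F K [lF lK /S0]; rewrite l2_ipE.
- rewrite rcompose_real_of rD_real_of radjoint_real_of rcompose_real_of.
  congr real_of; apply/funext => f; apply/funext => g; apply/propext; exact: SS.
Qed.

Variable D : graph R.
Hypothesis splitD : split_graph m D (rD m).

Theorem complex_sqrt_exists : exists S : graph R, [/\ self_adjoint m S, nonnegative m S &
  forall f h, compose S S f h <-> compose (adjoint m D) D f h].
Proof.
have [hS [SA S0 Sd Sp SS]] := real_sqrt_exists.
pose S : graph R := fun f k => real_of hS (re f) (re k) /\ real_of hS (im f) (im k).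
have sS : split_graph m S (real_of hS) by split=> //; split=> // F K [].
exists S; split.
- split=> [f /L2P[lf lf'] e e0|f g].
    have e20 : 0 < e / 2 by rewrite divr_gt0.
    have [G [K GK] FG] := Sd _ _ lf e20; have [G' [K' GK'] FG'] := Sd _ _ lf' e20.
    exists (cplx G G'); first by exists (cplx K K').
    have [lG _ _] := GK; have [lG' _ _] := GK'.
    rewrite L2sqE; last by apply/L2P; rewrite re_sub im_sub; split; exact: l2B.
    by rewrite re_sub im_sub lte_fin (splitr e); exact: ltrD FG FG'.
  by have [h _] := split_radjoint sS; rewrite h SA.
- move=> f g [fg fg']; have [lf lg _] := fg; have [lf' lg' _] := fg'.
  rewrite innerE; [|exact/L2P|exact/L2P].
  (* The imaginary part of <g, f> measures the asymmetry of the real operator between the two parts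
     of f, hence it is 0. *)
  move: (fg); rewrite -SA => -[_ _ /(_ _ _ fg')] E.
  rewrite lecE /= E ipC subrr eqxx /= addr_ge0//; exact: Sp.
- move=> f h; have [-> _] := split_compose sS sS.
  by have [-> _] := split_compose (split_radjoint splitD) splitD; rewrite SS.
Qed.

(** Complex L^2 as a real Hilbert space: [lip2] is the real part of the inner product, so the real
    theory covers operators that do not split into real and imaginary parts. *)
Let H2 : lmodType R := (l2space m * l2space m)%type.
Let lip2 : H2 -> H2 -> R := ip2 lip.

Definition cls2 f : H2 := (cls (re f), cls (im f)).
Definition rep2 (u : H2) : R -> R[i] := cplx (l2_rep u.1) (l2_rep u.2).

Lemma rep2K u : cls2 (rep2 u) = u.
Proof.
by case: u => a b; congr pair; [rewrite -[re _]/(l2_rep a)|rewrite -[im _]/(l2_rep b)]; exact: l2_repK.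
Qed.

Lemma rep2_L2 u : L2 m (rep2 u).
Proof. by apply/L2P; split; exact: l2_repP. Qed.

Lemma lip2E f g : L2 m f -> L2 m g -> lip2 (cls2 f) (cls2 g) = complex.Re (inner m f g).
Proof.
by move=> Lf Lg; rewrite innerE//; have [/L2P[? ?] /L2P[? ?]] := (Lf, Lg); rewrite /lip2 /ip2 !l2_ipE.
Qed.

Definition complex_of (T : H2 -> H2 -> Prop) : graph R := fun f g =>
  [/\ L2 m f, L2 m g & T (cls2 f) (cls2 g)].

Lemma complex_of_rep (T : H2 -> H2 -> Prop) u v : T u v -> complex_of T (rep2 u) (rep2 v).
Proof. by move=> Tuv; split; [exact: rep2_L2|exact: rep2_L2|rewrite !rep2K]. Qed.

Lemma complex_of_inj (S T : H2 -> H2 -> Prop) :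
  (forall f g, complex_of S f g -> complex_of T f g) -> forall u v, S u v -> T u v.
Proof. by move=> ST u v /complex_of_rep/ST[_ _]; rewrite !rep2K. Qed.

Lemma compose_complex_of S T f h :
  compose (complex_of S) (complex_of T) f h <-> complex_of (hcompose S T) f h.
Proof.
split=> [[g [Lf Lg fg] [_ Lh gh]]|[Lf Lh [g fg gh]]]; first by split=> //; exists (cls2 g).
by exists (rep2 g); split; rewrite ?rep2K//; exact: rep2_L2.
Qed.

Definition hD2 (u v : H2) : Prop := @hD R m u.1 v.1 /\ @hD R m u.2 v.2.

Lemma D_complex_of f g : D f g <-> complex_of hD2 f g.
Proof.
have [-> _] := splitD; rewrite rD_real_of.
split=> [[[l1 l2 h1] [l3 l4 h2]]|[/L2P[l1 l3] /L2P[l2 l4] [h1 h2]]].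
  by split; [exact/L2P|exact/L2P|split; [exact: h1|exact: h2]].
by split; (split; [assumption|assumption|]); [exact: h1|exact: h2].
Qed.

Lemma adjD_complex_of f g : adjoint m D f g <-> complex_of (hadj lip2 hD2) f g.
Proof.
have [-> _] := split_radjoint splitD; rewrite rD_real_of radjoint_real_of.
have [D0 _ _] := hD_lin hw; have hax := l2_hilbert m.
split=> [[[l1 l2 h1] [l3 l4 h2]]|[/L2P[l1 l3] /L2P[l2 l4] h]].
  split; [exact/L2P|exact/L2P|move=> u v [u1 u2]].
  by rewrite /lip2 /ip2 (h1 _ _ u1) (h2 _ _ u2).
split; (split; [assumption|assumption|move=> u v uv]).
  exact: (addr_cancel0 (hilb0l hax _) (hilb0l hax _) (h (u, 0) (v, 0) (conj uv D0))).
exact: (add0r_cancel (hilb0l hax _) (hilb0l hax _) (h (0, u) (0, v) (conj D0 uv))).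
Qed.

Lemma DstarD_complex_of f h :
  compose (adjoint m D) D f h <-> complex_of (hcompose (hadj lip2 hD2) hD2) f h.
Proof.
rewrite -compose_complex_of.
by split=> -[g /D_complex_of fg /adjD_complex_of gh]; exists g.
Qed.

Section Uniqueness.
Variable S : graph R.
Hypothesis selfS : self_adjoint m S.

Let hS (u v : H2) := S (rep2 u) (rep2 v).

Lemma self_adjoint_L2 f g : S f g -> L2 m f /\ L2 m g.
Proof. by move=> /(selfS.2 f g)[]. Qed.

Lemma rep2_class f : L2 m f -> aeq m (rep2 (cls2 f)) f.
Proof. by move=> /L2P[lf lf']; apply/aeqP; split; exact: l2_rep_class. Qed.

Lemma aeq_sym f g : aeq m f g -> aeq m g f.
Proof. by apply: ae_mono => x h /h. Qed.

Lemma inner_aeq f g g' : L2 m f -> L2 m g -> L2 m g' -> aeq m g g' -> inner m f g = inner m f g'.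
Proof.
move=> Lf Lg Lg' /aeqP[a1 a2]; rewrite !innerE//.
have [/L2P[lf lf'] /L2P[lg lg']] := (Lf, Lg); have /L2P[l1 l2] := Lg'.
rewrite !(ipC _ (re f)) !(ipC _ (im f)).
by rewrite (ip_ae lg l1 lf a1) (ip_ae lg' l2 lf' a2) (ip_ae lg l1 lf' a1) (ip_ae lg' l2 lf a2).
Qed.

(** S coincides with its adjoint, which is defined by integrals and does not see null sets; this
    lets S descend to classes. *)
Lemma self_adjoint_aeq f g f' g' : S f g -> L2 m f' -> L2 m g' -> aeq m f f' -> aeq m g g' -> S f' g'.
Proof.
move=> /(selfS.2 f g)[Lf Lg fg] Lf' Lg' ff' gg'; apply/(selfS.2 f' g'); split=> // a b ab.
have [La Lb] := self_adjoint_L2 ab.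
by rewrite -(inner_aeq Lb Lf Lf' ff') -(inner_aeq La Lg Lg' gg'); exact: fg.
Qed.

Lemma S_complex_of f g : S f g <-> complex_of hS f g.
Proof.
split=> [fg|[Lf Lg fg]].
  have [Lf Lg] := self_adjoint_L2 fg; split=> //.
  by apply: (self_adjoint_aeq fg); [exact: rep2_L2|exact: rep2_L2|
    apply: aeq_sym; exact: rep2_class|apply: aeq_sym; exact: rep2_class].
by apply: (self_adjoint_aeq fg) => //; exact: rep2_class.
Qed.

Definition imul f : R -> R[i] := cplx (fun x => -1 * im f x) (re f).

Lemma imul_L2 f : L2 m f -> L2 m (imul f).
Proof. by move=> /L2P[lf lf']; apply/L2P; split=> //; exact: l2Z. Qed.

(** The adjoint identity for (i f, i g) is the one for (f, g) multiplied by -i. *)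
Lemma self_adjoint_imul f g : S f g -> S (imul f) (imul g).
Proof.
move=> fg; have [Lf Lg] := self_adjoint_L2 fg.
apply/(selfS.2 (imul f) (imul g)); split; [exact: imul_L2|exact: imul_L2|move=> a b ab].
have [La Lb] := self_adjoint_L2 ab.
have [/L2P[lf lf'] /L2P[lg lg']] := (Lf, Lg); have [/L2P[la la'] /L2P[lb lb']] := (La, Lb).
have [_ _ /(_ _ _ ab)] := (selfS.2 f g).1 fg; rewrite !innerE//; try exact: imul_L2.
move=> [E1 E2]; congr Complex.
  rewrite -[re (imul f)]/(fun x => -1 * im f x) -[re (imul g)]/(fun x => -1 * im g x).
  rewrite -[im (imul f)]/(re f) -[im (imul g)]/(re g) !ipZr//; move: E2.
  move: (ip _ _ _) (ip _ _ _) (ip _ _ _) (ip _ _ _) => p q r s; lra.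
rewrite -[re (imul f)]/(fun x => -1 * im f x) -[re (imul g)]/(fun x => -1 * im g x).
rewrite -[im (imul f)]/(re f) -[im (imul g)]/(re g) !ipZr//; move: E1.
move: (ip _ _ _) (ip _ _ _) (ip _ _ _) (ip _ _ _) => p q r s; lra.
Qed.

(** The real adjoint sees only real parts of inner products. The imaginary part is recovered by
    testing with (i f, i k), which again belongs to S. *)
Lemma hS_self_adjoint : hadj lip2 hS = hS.
Proof.
apply/funext => u; apply/funext => v; apply/propext; split=> [h|uv f k fk].
  apply/(selfS.2 (rep2 u) (rep2 v)); split; [exact: rep2_L2|exact: rep2_L2|move=> f k fk].
  have Re_eq a b : S a b -> complex.Re (inner m b (rep2 u)) = complex.Re (inner m a (rep2 v)).
    move=> ab; have [La Lb ab'] := (S_complex_of a b).1 ab.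
    by rewrite -!lip2E ?rep2K//; [exact: h|exact: rep2_L2|exact: rep2_L2].
  have [Lf Lk] := self_adjoint_L2 fk; have Lu := rep2_L2 u; have Lv := rep2_L2 v.
  have := Re_eq _ _ fk; have := Re_eq _ _ (self_adjoint_imul fk).
  rewrite !innerE//; try exact: imul_L2.
  have [/L2P[lf lf'] /L2P[lk lk']] := (Lf, Lk); have [/L2P[lu lu'] /L2P[lv lv']] := (Lu, Lv).
  rewrite /= -[re (imul f)]/(fun x => -1 * im f x) -[re (imul k)]/(fun x => -1 * im k x).
  rewrite -[im (imul f)]/(re f) -[im (imul k)]/(re k) !ipZl// => E1 E2; congr Complex => //.
  move: E1; move: (ip _ _ _) (ip _ _ _) (ip _ _ _) (ip _ _ _) => p q r s; lra.
have [_ _ /(_ _ _ fk) E] := (selfS.2 _ _).1 uv.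
by rewrite -(rep2K f) -(rep2K k) -(rep2K u) -(rep2K v) !lip2E ?E//; exact: rep2_L2.
Qed.

Lemma hS_dense : hdense lip2 (hdom hS).
Proof.
move=> u e e0; have hax2 := hilbert_axioms2 (l2_hilbert m).
have e20 : 0 < e ^+ 2 by rewrite exprn_gt0.
have [g [k gk] ug] := selfS.1 _ (rep2_L2 u) _ e20.
have [Lg Lk gk'] := (S_complex_of g k).1 gk.
exists (cls2 g); first by exists (cls2 k).
have /L2P[lg lg'] := Lg.
rewrite -(hnorm_lt hax2)//; move: ug; rewrite L2sqE; last first.
  by apply/L2P; rewrite re_sub im_sub; split; apply: l2B => //; exact: l2_repP.
rewrite re_sub im_sub lte_fin; apply: le_lt_trans.
have [l1 l2] := (l2_repP u.1, l2_repP u.2).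
rewrite /lip2 /ip2 /= -{1 2}(l2_repK u.1) -{1 2}(l2_repK u.2) -!l2_classB// !l2_ipE//; exact: l2B.
Qed.

Theorem sqrt_dom : (forall f h, compose S S f h <-> compose (adjoint m D) D f h) ->
  forall f, dom S f <-> dom D f.
Proof.
move=> SS f; have hax2 := hilbert_axioms2 (l2_hilbert m).
have DD u v : hcompose (hadj lip2 hD2) hD2 u v <-> hcompose (hadj lip2 hS) hS u v.
  rewrite hS_self_adjoint; have key a b : complex_of (hcompose (hadj lip2 hD2) hD2) a b <-> complex_of (hcompose hS hS) a b.
    rewrite -DstarD_complex_of -SS -compose_complex_of.
    by split=> -[g /S_complex_of ag /S_complex_of gb]; exists g.
  by split; apply: complex_of_inj => a b; rewrite key.
have linS : lin_graph hS by rewrite -hS_self_adjoint; exact: hadj_lin.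
have cloS : closed_graph lip2 hS by rewrite -hS_self_adjoint; exact: hadj_closed.
(* A self-adjoint relation with dense domain is single-valued: k is orthogonal to that domain. *)
have sepS (k : H2) : hS 0 k -> k = 0.
  rewrite -hS_self_adjoint => h; apply: (hdense_orth hax2 hS_dense) => g [g' gg'].
  rewrite (hilbC hax2); transitivity (lip2 g' 0); last exact: hilb0r hax2 _.
  exact/esym/(h g g' gg').
have [D0 DDl DZ] := hD_lin hw.
have linD : lin_graph hD2.
  split; first by split.
    by move=> ? ? ? ? [? ?] [? ?]; split; exact: DDl.
  by move=> ? ? ? [? ?]; split; exact: DZ.
have cloD : closed_graph lip2 hD2.
  have hax := l2_hilbert m.
  move=> u v a b uv /(hcvg2 hax)[u1 u2] /(hcvg2 hax)[v1 v2]; split.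
    by apply: (hD_closed hw) u1 v1 => n; exact: (uv n).1.
  by apply: (hD_closed hw) u2 v2 => n; exact: (uv n).2.
(* The absolutely continuous representative of the class 0 is the function 0, whose derivative is
   0. *)
have sep1 (k : l2space m) : @hD R m 0 k -> k = 0.
  rewrite -(l2_repK k) -(l2_class0 m) => /(hD_class hw (l2_0 m) (l2_repP k)).
  move=> /(rD_ac hw)[F1 [aF1 _ _] [F10 kF1]].
  apply/l2_class_eq; [exact: l2_repP|exact: l2_0|apply/(weight_ae hw)].
  have E : (fun=> 0) = F1.
    by apply: ae_eq_continuous F10; [move=> x; exact: cvg_cst|exact: loc_ac_continuous].
  by apply: ae_mono kF1 => x ->; rewrite -E derive1_cst.
have sepD (k : H2) : hD2 0 k -> k = 0 by case: k => a b [/sep1 /= -> /sep1 /= ->].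
(* The core argument is symmetric in D and S and gives both inclusions. *)
split=> [[k /S_complex_of[Lf _ fk]]|[k /D_complex_of[Lf _ fk]]].
  have [g fg] := hdom_sub hax2 linD cloD linS cloS sepS DD (ex_intro _ _ fk).
  by exists (rep2 g); apply/D_complex_of; split; rewrite ?rep2K//; exact: rep2_L2.
have DD' u v : hcompose (hadj lip2 hS) hS u v <-> hcompose (hadj lip2 hD2) hD2 u v by rewrite DD.
have [g fg] := hdom_sub hax2 linS cloS linD cloD sepD DD' (ex_intro _ _ fk).
by exists (rep2 g); apply/S_complex_of; split; rewrite ?rep2K//; exact: rep2_L2.
Qed.

End Uniqueness.
End SquareRoot.

(** * The deformed number operator *)

Section DeformedNumberOperator.
Context {R : realType}.
Variables (mu al : R) (e : {mfun measurableTypeR R >-> R}).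
Hypotheses (mu_gt0 : 0 < mu) (mu_le1 : mu <= 1).
Hypothesis he : is_ground_state mu al e.
Implicit Types (F G H K U : R -> R) (f g h k : R -> R[i]).
Local Notation leb := (@lebesgue_measure R).
Local Notation nu := (nu_ e).
Let w (x : R) : R := e x ^+ 2 * gpdf x.
Let V : R -> R := pot (c_ mu).

Let e_gt0 x : 0 < e x. Proof. by case: he. Qed.
Let de x : derivable (e : R -> R) x 1. Proof. by case: he => _ _ _ []. Qed.
Let ce' : continuous (derive1 (e : R -> R)). Proof. by case: he => _ _ _ []. Qed.
Let hg : weight (@gaussian R) gpdf := gaussian_weight.
Let hnu : weight nu w := nu_weight e_gt0 de ce'.
Let Vb x : 0 <= V x <= c_ mu * x ^+ 2 := V_bnd mu_gt0 mu_le1 x.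
Let cV : continuous V := @pot_continuous R (c_ mu).
Let sD : split_graph nu (D_ e) (rD nu) := split_D e_gt0 de ce'.

(** Membership in Dom(A) provides an a.e. equal form-domain representative of e. Both are
    continuous, so it is e itself and the form equation involves [derive1 e]. *)
Lemma ground_state_weak psi : test_fun psi ->
  \int[leb]_x (derive1 (e : R -> R) x * derive1 psi x * gpdf x) + \int[leb]_x (V x * e x * psi x * gpdf x) =
  al * \int[leb]_x (e x * psi x * gpdf x).
Proof.
move=> tp; have [_ /(A_split mu_gt0 mu_le1)[[le _ [F1 [WF1 eF1 E]]] _] _ _ _] := he.
have eE : re (fun x => (e x)%:C%C) = (e : R -> R) by [].
rewrite eE in le eF1.
have F1E : (e : R -> R) = F1.
  apply: ae_eq_continuous eF1; last by apply: loc_ac_continuous; case: WF1.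
  by apply: wloc_continuous; exact: wloc_C1.
have Wp := test_fun_rW12 hg tp; have [_ lp _] := Wp.
have := E psi Wp; rewrite -F1E /q_form => ->.
have -> : re (fun x => al%:C%C * (e x)%:C%C) = (fun x => al * e x).
  by apply/funext => x; rewrite /re /= mul0r subr0.
by rewrite ipZl// (weight_ip_l2 hg).
Qed.

Lemma rN_iff F H : rN gaussian nu gpdf e V al F H <-> rcompose (radjoint nu (rD nu)) (rD nu) F H.
Proof.
split=> [FH|[G FG GH]]; last first.
  exact: (DstarD_rN hg (@gpdf'E R) e_gt0 de ce' hnu cV Vb ground_state_weak FG GH).
have [U WU [FU UH]] := rN_DstarD hg e_gt0 de ce' hnu cV ground_state_weak FH.
have [lF _ _] := FH; have [_ _ lU'] := WU.
exists (derive1 U); last exact: UH.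
apply: (rD_ae hnu (W12_rD hnu WU) lF lU'); last exact: aeW.
by apply/(weight_ae hnu); exact: ae_sym_eq.
Qed.

Let splitN f h := split_N e mu_gt0 mu_le1 al f h.

Lemma N_iff f h : N_ mu al e f h <-> compose (delta_ e) (D_ e) f h.
Proof.
rewrite splitN; have [-> _] := split_compose (split_radjoint sD) sD.
by rewrite !rN_iff.
Qed.

(** Two absolutely continuous representatives of F coincide everywhere, so they have the same
    derivative; closability follows from this. *)
Lemma rD_fun F G G' : rD nu F G -> rD nu F G' -> {ae nu, forall x, G x = G' x}.
Proof.
move=> /(rD_ac hnu)[F1 [aF1 _ _] [h1 g1]] /(rD_ac hnu)[F2 [aF2 _ _] [h2 g2]].
have E : F1 = F2.
  apply: ae_eq_continuous; [exact: loc_ac_continuous|exact: loc_ac_continuous|].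
  by apply: ae_mono (ae_and h1 h2) => x [<- <-].
by apply/(weight_ae hnu); apply: ae_mono (ae_and g1 g2) => x [-> ->]; rewrite E.
Qed.

Lemma rN_strong F H : rN gaussian nu gpdf e V al F H -> exists U,
  [/\ rW12 nu U, {ae nu, forall x, F x = U x}, loc_ac_real (derive1 U),
      l2 nu (divw w (derive1 U)) & {ae nu, forall x, H x = divw w (derive1 U) x}].
Proof.
move=> FH; have [U WU [FU UH]] := rN_DstarD hg e_gt0 de ce' hnu cV ground_state_weak FH.
have [dU aU' dE] := radj_strong hnu WU UH; have [_ lH _] := FH.
have HE := ae_sym_eq dE.
exists U; split=> //; [exact/(weight_ae hnu)| |exact/(weight_ae hnu)].
apply: (l2_ae_leb hnu) HE lH; apply: measurable_funB.
  by apply: measurableT_comp => //; exact: meas_derive1.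
apply: measurable_funM; last by apply: continuous_meas; exact: loc_ac_continuous.
apply: continuous_meas; apply: continuous_mul; first by case: hnu.
exact: weightV_continuous hnu.
Qed.

Lemma strong_rN F U : l2 nu F -> {ae nu, forall x, F x = U x} -> rW12 nu U ->
  loc_ac_real (derive1 U) -> l2 nu (divw w (derive1 U)) ->
  rN gaussian nu gpdf e V al F (divw w (derive1 U)).
Proof.
move=> lF FU WU aU' ld; have [_ _ lU'] := WU; apply/rN_iff; exists (derive1 U).
  by apply: (rD_ae hnu (W12_rD hnu WU) lF lU'); [exact: ae_sym_eq|exact: aeW].
exact: (radj_divw hnu aU' lU' ld).
Qed.

Lemma rN_fun F H H' : rN gaussian nu gpdf e V al F H -> rN gaussian nu gpdf e V al F H' ->
  {ae nu, forall x, H x = H' x}.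
Proof.
move=> /rN_strong[U [[aU _ _] FU _ _ h]] /rN_strong[U1 [[aU1 _ _] FU1 _ _ h1]].
have E : U = U1.
  apply: ae_eq_continuous; [exact: loc_ac_continuous|exact: loc_ac_continuous|].
  by apply/(weight_ae hnu); apply: ae_mono (ae_and FU FU1) => x [<- <-].
by apply: ae_mono (ae_and h h1) => x [-> ->]; rewrite E.
Qed.

(** Since w = e^2 p and p' = -x p, the logarithmic derivative is w' / w = 2 e' / e - x. *)
Lemma divwE G x : divw w G x = - derive1 G x + (x - 2 * (derive1 (e : R -> R) x / e x)) * G x.
Proof.
have de' := derivable_is_derive (@de x).
have [_] := is_derive_derive1 (is_derive_mul (is_derive_mul de' de') (is_derive_gpdf x)).
rewrite /divw => ->; have e0 := e_gt0 x; have g0 := weight_gt0 hg x.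
by rewrite /w; field; rewrite !gt_eqF.
Qed.

Lemma re_divergence g : re (divergence_expr e g) = divw w (re g).
Proof.
apply/funext => x; rewrite divwE /divergence_expr /cderiv /re /=.
by case: (g x) => a b /=; rewrite mul0r subr0.
Qed.

Lemma im_divergence g : im (divergence_expr e g) = divw w (im g).
Proof.
apply/funext => x; rewrite divwE /divergence_expr /cderiv /im /=.
by case: (g x) => a b /=; rewrite mul0r addr0.
Qed.

Lemma closable_test_derivative : closable nu test_derivative.
Proof.
move=> f g h /(sD.1 f g)[fg fg'] /(sD.1 f h)[fh fh'].
by apply/aeqP; split; [exact: rD_fun fg fh|exact: rD_fun fg' fh'].
Qed.

Lemma dom_D_W12 f : dom (D_ e) f <-> W12_class nu f.
Proof.
split=> [[g /(sD.1 f g)[fg fg']]|[/L2P[lf lf'] [f1 /W12P[W1 W2] /aeqP[a1 a2]]]].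
  have [lf _ _] := fg; have [lf' _ _] := fg'; split; first exact/L2P.
  have [F1 W1 [h1 _]] := rD_ac hnu fg; have [F2 W2 [h2 _]] := rD_ac hnu fg'.
  exists (cplx F1 F2); first exact/W12P.
  by apply/aeqP; split; exact/(weight_ae hnu).
exists (cderiv f1); apply/(sD.1 f (cderiv f1)); have [_ _ l1] := W1; have [_ _ l2] := W2.
split; [apply: (rD_ae hnu (W12_rD hnu W1) lf l1)|apply: (rD_ae hnu (W12_rD hnu W2) lf' l2)];
  by [exact: ae_sym_eq|exact: aeW].
Qed.

(** The coefficient w' / w is continuous, so [divw w G] is continuous with compact support and lies
    in L^2(nu). *)
Lemma test_divw G : test_fun G -> radj nu G (divw w G).
Proof.
move=> tG; have [aG lG _] := test_fun_rW12 hnu tG; have [sG [M G0]] := tG.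
apply: (radj_divw hnu aG lG); apply: (loc_l2_cpt (M := M) hnu) => [|x Mx]; last first.
  by rewrite /divw (derive1_eq0_cpt G0 Mx) G0// mulr0 subr0 oppr0.
apply: continuous_loc_l2 => x; apply: cvgB; first by apply: cvgN; exact: smooth_continuous (smooth_derive1 sG) x.
apply: cvgM; last exact: smooth_continuous sG x.
by apply: cvgM; [case: hnu => _ _ + _; apply|exact: weightV_continuous hnu x].
Qed.

Lemma delta_divergence g : Cc_infty g -> value_at nu (delta_ e) g (divergence_expr e g).
Proof.
move=> /Cc_inftyP[tr ti]; have sA := split_adjoint sD.
split=> [|k /sA[h1 h2]].
  by apply/sA; rewrite re_divergence im_divergence; split; exact: test_divw.
apply/aeqP; rewrite re_divergence im_divergence.
by split; apply/(weight_ae hnu); [exact: (radj_unique hnu h1 (test_divw tr))|exact: (radj_unique hnu h2 (test_divw ti))].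
Qed.

Lemma dom_N f : dom (N_ mu al e) f <-> L2 nu f /\ exists f1,
  [/\ aeq nu f f1, W12 nu f1, loc_ac (cderiv f1) & L2 nu (divergence_expr e (cderiv f1))].
Proof.
split=> [[h /splitN[N1 N2]]|[/L2P[lf lf'] [f1 [/aeqP[a1 a2] /W12P[W1 W2] [c1 c2] /L2P]]]].
  have [lf _ _] := N1; have [lf' _ _] := N2; split; first exact/L2P.
  have [U1 [WU1 FU1 aU1 l1 _]] := rN_strong N1; have [U2 [WU2 FU2 aU2 l2 _]] := rN_strong N2.
  exists (cplx U1 U2); split; [exact: (aeqP _ f (cplx _ _)).2 (conj FU1 FU2)|
    exact: (W12P _ (cplx _ _)).2 (conj WU1 WU2)|exact: conj aU1 aU2|].
  by apply/L2P; rewrite re_divergence im_divergence; exact: conj l1 l2.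
rewrite re_divergence im_divergence => -[l1 l2].
exists (divergence_expr e (cderiv f1)); apply/splitN.
rewrite re_divergence im_divergence.
by split; [exact: strong_rN lf a1 W1 c1 l1|exact: strong_rN lf' a2 W2 c2 l2].
Qed.

Lemma N_divergence f : W12 nu f -> loc_ac (cderiv f) -> L2 nu (divergence_expr e (cderiv f)) ->
  value_at nu (N_ mu al e) f (divergence_expr e (cderiv f)).
Proof.
move=> /W12P[W1 W2] [c1 c2] /L2P; rewrite re_divergence im_divergence => -[l1 l2].
have [_ lf _] := W1; have [_ lf' _] := W2.
have Nf : N_ mu al e f (divergence_expr e (cderiv f)).
  apply/splitN; rewrite re_divergence im_divergence.
  have re_eq (F : R -> R) : {ae nu, forall x, F x = F x} by exact: aeW.
  by split; [exact: strong_rN lf (re_eq _) W1 c1 l1|exact: strong_rN lf' (re_eq _) W2 c2 l2].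
split=> // k /splitN[k1 k2]; move/splitN: Nf => [n1 n2].
by apply/aeqP; split; [exact: rN_fun k1 n1|exact: rN_fun k2 n2].
Qed.

Lemma sqrt_N_exists : exists S : graph R, is_sqrt_of nu (N_ mu al e) S.
Proof.
have [S [S1 S2 S3]] := complex_sqrt_exists hnu sD.
by exists S; split; [exact: S1|exact: S2|move=> f h; rewrite S3 N_iff].
Qed.

Lemma dom_sqrt_N (S : graph R) : is_sqrt_of nu (N_ mu al e) S ->
  forall f, dom S f <-> dom (D_ e) f.
Proof.
by move=> [S1 _ S3]; apply: (sqrt_dom hnu sD S1) => f h; rewrite S3 N_iff.
Qed.

End DeformedNumberOperator.

Theorem proposition3p2 (R : realType) (mu : R) (mu_gt0 : 0 < mu)
    (mu_le1 : mu <= 1) (alpha0 : R)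
    (e0 : {mfun measurableTypeR R >-> R})
    (he0 : is_ground_state mu alpha0 e0) :
  closable (nu_ e0) test_derivative /\
  (forall f : R -> R[i], dom (D_ e0) f <-> W12_class (nu_ e0) f) /\
  (exists S : graph R, is_sqrt_of (nu_ e0) (N_ mu alpha0 e0) S) /\
  (forall S : graph R, is_sqrt_of (nu_ e0) (N_ mu alpha0 e0) S ->
     forall f : R -> R[i], dom S f <-> dom (D_ e0) f) /\
  (forall f h : R -> R[i],
     N_ mu alpha0 e0 f h <-> compose (delta_ e0) (D_ e0) f h) /\
  (forall g : R -> R[i], Cc_infty g ->
     value_at (nu_ e0) (delta_ e0) g (divergence_expr e0 g)) /\
  (forall f : R -> R[i],
     dom (N_ mu alpha0 e0) f <->
     L2 (nu_ e0) f /\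
     exists f1 : R -> R[i],
       [/\ aeq (nu_ e0) f f1, W12 (nu_ e0) f1, loc_ac (cderiv f1) &
           L2 (nu_ e0) (divergence_expr e0 (cderiv f1))]) /\
  (forall f : R -> R[i],
     W12 (nu_ e0) f -> loc_ac (cderiv f) ->
     L2 (nu_ e0) (divergence_expr e0 (cderiv f)) ->
     value_at (nu_ e0) (N_ mu alpha0 e0) f
       (divergence_expr e0 (cderiv f))).
Proof.
split; first exact: closable_test_derivative he0.
split; first exact: dom_D_W12 he0.
split; first exact: sqrt_N_exists mu_gt0 mu_le1 he0.
split; first exact: dom_sqrt_N mu_gt0 mu_le1 he0.
split; first exact: N_iff mu_gt0 mu_le1 he0.
split; first exact: delta_divergence he0.
split; first exact: dom_N mu_gt0 mu_le1 he0.
exact: N_divergence mu_gt0 mu_le1 he0.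
Qed.
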